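(* Let $(X,d,\mu)$ be $Q$-homogeneous, $0<\alpha<Q$, $b\in BMO(X)$ and $\Phi,\Psi\in\mathcal{Y}$. Consider the condition $(\ast)$ there is a constant $A'>0$ such that $r^\alpha\Phi^{-1}(r^{-Q})\le A'\,\Psi^{-1}(r^{-Q})$ for all $0<r<\infty$. 1. If $\Phi\in\nabla_2$ and $\Psi\in\Delta_2$, then the condition $$r^\alpha\Phi^{-1}(r^{-Q})+\int_r^\infty\Big(1+\ln\frac tr\Big)\Phi^{-1}(t^{-Q})\,t^\alpha\frac{dt}{t}\le C\,\Psi^{-1}(r^{-Q})\quad\text{for all }r>0,$$ where $C>0$ does not depend on $r$, is sufficient for the boundedness of $[b,I_\alpha]$ from $L_\Phi(X)$ to $L_\Psi(X)$. 2. If $\Psi\in\Delta_2$, then condition $(\ast)$ is necessary for the boundedness of $|b,I_\alpha|$ from $L_\Phi(X)$ to $L_\Psi(X)$. 3. Let $\Phi\in\nabla_2$ and $\Psi\in\Delta_2$. If $$\int_r^\infty\Big(1+\ln\frac tr\Big)\Phi^{-1}(t^{-Q})\,t^\alpha\frac{dt}{t}\le C\,r^\alpha\Phi^{-1}(r^{-Q})$$ holds for all $r>0$, where $C>0$ does not depend on $r$, then condition $(\ast)$ is necessary and sufficient for the boundedness of $|b,I_\alpha|$ from $L_\Phi(X)$ to $L_\Psi(X)$.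
   Context: $(X,d,\mu)$ is a space of homogeneous type: $X$ is a topological space with a quasi-distance $d$ (i.e. $d(x,y)\ge 0$, $d(x,y)=0$ iff $x=y$, $d(x,y)=d(y,x)$, $d(x,y)\le K_1(d(x,z)+d(z,y))$) and a positive measure $\mu$; the balls $B(x,r)=\{y\in X:d(x,y)<r\}$, $r>0$, form a basis of neighborhoods of $x$; $\mu$ is defined on a $\sigma$-algebra containing the balls, and $0<\mu(B(x,2r))\le K_2\mu(B(x,r))<\infty$; $K_1,K_2\ge1$ are constants independent of $x,y,z,r$. Standing assumptions: $\mu(X)=\infty$; the compactly supported continuous functions are dense in $L_1(X,\mu)$. $X$ is $Q$-homogeneous ($Q>0$): $K_3^{-1}r^Q\le\mu(B(x,r))\le K_3r^Q$ for all $x\in X$, $r>0$, with a constant $K_3\ge1$. A Young function is a convex, left-continuous $\Phi:[0,\infty)\to[0,\infty]$ with $\lim_{r\to+0}\Phi(r)=\Phi(0)=0$ and $\lim_{r\to\infty}\Phi(r)=\infty$. $\mathcal{Y}$ is the set of Young functions with $0<\Phi(r)<\infty$ for $0<r<\infty$. $\Phi^{-1}(s)=\inf\{r\ge0:\Phi(r)>s\}$ ($\inf\emptyset=\infty$). $\Phi\in\Delta_2$ means $\Phi(2r)\le k\Phi(r)$ for all $r>0$, for some $k>1$; $\Phi\in\nabla_2$ means $\Phi(r)\le\frac1{2k}\Phi(kr)$ for all $r\ge0$, for some $k>1$. $L_\Phi(X)$ is the set of $f\in L_1^{\rm loc}(X)$ with $\int_X\Phi(\epsilon|f|)d\mu<\infty$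 for some $\epsilon>0$, with $\|f\|_{L_\Phi}=\inf\{\lambda>0:\int_X\Phi(|f(x)|/\lambda)d\mu(x)\le1\}$. $BMO(X)$ is the set of $b\in L_1^{\rm loc}(X)$ with $\|b\|_*=\sup_{x\in X,r>0}\frac1{\mu(B(x,r))}\int_{B(x,r)}|b(y)-b_{B(x,r)}|d\mu(y)<\infty$, where $b_B=\frac1{\mu(B)}\int_Bb\,d\mu$. $I_\alpha f(x)=\int_X\frac{f(y)}{d(x,y)^{Q-\alpha}}d\mu(y)$; $[b,I_\alpha]f(x)=\int_X\frac{b(x)-b(y)}{d(x,y)^{Q-\alpha}}f(y)d\mu(y)$; $|b,I_\alpha|f(x)=\int_X\frac{|b(x)-b(y)|}{d(x,y)^{Q-\alpha}}f(y)d\mu(y)$. An operator $T$ is bounded from $A$ to $A'$ if there is $C>0$ with $\|Tf\|_{A'}\le C\|f\|_A$ for all $f\in A$.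
   Formalization: Necessity in parts 2 and 3 assumes |b,I_α| bounded for every b in BMO(X), since for one fixed b (e.g. constant b, where |b,I_α|=0) it is false; sufficiency holds for each b. That Tf lies in L_Ψ is asserted when d is jointly measurable. *)

(* Defs.v *)
From HB Require Import structures.
From mathcomp Require Import all_boot all_order all_algebra.
From mathcomp Require Import all_classical all_reals all_analysis.
Set Implicit Arguments.
Unset Strict Implicit.
Unset Printing Implicit Defensive.
Import Order.TTheory GRing.Theory Num.Theory.
Import numFieldNormedType.Exports.
Local Open Scope classical_set_scope.
Local Open Scope ring_scope.
Local Open Scope ereal_scope.

(* No compatibility between the topology and the sigma-algebra is built in:
   the only link is the measurability of quasi-balls required below. *)
#[short(type="topMeasurableType")]
HB.structure Definition TopMeasurable (d : measure_display) :=
  {T of Topological T & Measurable d T}.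

Section HomogeneousType.
Context (R : realType) (d : measure_display) (X : topMeasurableType d).
Variables (rho : X -> X -> R) (mu : {measure set X -> \bar R}).

Definition qball (x : X) (r : R) : set X := [set y | (rho x y < r)%R].

Record quasi_distance : Prop := {
  qd_ge0 : forall x y, (0 <= rho x y)%R ;
  qd_eq0 : forall x y, (rho x y = 0)%R <-> x = y ;
  qd_sym : forall x y, rho x y = rho y x ;
  qd_triangle : exists2 K1 : R, (1 <= K1)%R &
    forall x y z, (rho x y <= K1 * (rho x z + rho z y))%R }.

Record homogeneous_type : Prop := {
  ht_quasi_distance : quasi_distance ;
  (* the balls are neighborhoods, but need not be open *)
  ht_nbhs : forall (x : X) (A : set X),
    nbhs x A <-> exists2 r : R, (0 < r)%R & qball x r `<=` A ;
  ht_measurable : forall x r, (0 < r)%R -> measurable (qball x r) ;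
  ht_doubling : exists2 K2 : R, (1 <= K2)%R &
    forall x r, (0 < r)%R ->
      [/\ 0 < mu (qball x (2 * r)%R),
          mu (qball x (2 * r)%R) <= K2%:E * mu (qball x r) &
          K2%:E * mu (qball x r) < +oo] }.

Definition Cc_dense_L1 : Prop :=
  forall (f : X -> R) (e : R), (0 < e)%R ->
    mu.-integrable [set: X] (EFin \o f) ->
    exists g : X -> R,
      [/\ continuous g,
          compact (closure [set x | g x != 0%R]),
          mu.-integrable [set: X] (EFin \o g) &
          \int[mu]_x `|f x - g x|%:E < e%:E].

Definition Q_homogeneous (Q : R) : Prop :=
  exists2 K3 : R, (1 <= K3)%R &
    forall x r, (0 < r)%R ->
      (K3^-1 * r `^ Q)%:E <= mu (qball x r) <= (K3 * r `^ Q)%:E.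

(* Local integrability means integrability on every ball, which is what the
   averages in the definition of BMO need. *)
Definition L1loc (f : X -> R) : Prop :=
  measurable_fun [set: X] f /\
  forall x r, (0 < r)%R -> mu.-integrable (qball x r) (EFin \o f).

Definition mean (A : set X) (b : X -> R) : R :=
  ((fine (mu A))^-1 * \int[mu]_(y in A) b y)%R.

Definition mean_oscillation (A : set X) (b : X -> R) : \bar R :=
  (fine (mu A))^-1%:E * \int[mu]_(y in A) `|b y - mean A b|%:E.

Definition bmo_norm (b : X -> R) : \bar R :=
  ereal_sup [set mean_oscillation (qball p.1 p.2) b |
             p in [set p : X * R | (0 < p.2)%R]].

Definition BMO (b : X -> R) : Prop := L1loc b /\ bmo_norm b < +oo.

End HomogeneousType.

Section YoungFunctions.
Context (R : realType).
Implicit Types Phi : R -> \bar R.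

(* A function on [0, +oo[ is represented by a function on R, of which only the
   values at nonnegative reals are used. *)
Record young Phi : Prop := {
  young_ge0 : forall r, (0 <= r)%R -> 0 <= Phi r ;
  young_convex : forall x y t, (0 <= x)%R -> (0 <= y)%R -> (0 <= t <= 1)%R ->
    Phi ((1 - t) * x + t * y)%R <= (1 - t)%:E * Phi x + t%:E * Phi y ;
  young_left_continuous : forall r, (0 < r)%R ->
    Phi x @[x --> r^'-] --> Phi r ;
  young_at0 : Phi x @[x --> (0 : R)%R^'+] --> 0 ;
  young0 : Phi 0%R = 0 ;
  young_at_pinfty : Phi x @[x --> +oo%R] --> +oo }.

Definition youngY Phi : Prop :=
  young Phi /\ forall r, (0 < r)%R -> 0 < Phi r < +oo.

Definition young_inv Phi (s : \bar R) : \bar R :=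
  ereal_inf [set r%:E | r in [set r : R | (0 <= r)%R /\ s < Phi r]].

Definition Delta2 Phi : Prop :=
  exists2 k : R, (1 < k)%R &
    forall r, (0 < r)%R -> Phi (2 * r)%R <= k%:E * Phi r.

Definition nabla2 Phi : Prop :=
  exists2 k : R, (1 < k)%R &
    forall r, (0 <= r)%R -> Phi r <= ((2 * k)^-1)%:E * Phi (k * r)%R.

End YoungFunctions.

Section Operators.
Context (R : realType) (d : measure_display) (X : topMeasurableType d).
Variables (rho : X -> X -> R) (mu : {measure set X -> \bar R}).

Definition orlicz (Phi : R -> \bar R) (f : X -> R) : Prop :=
  L1loc rho mu f /\
  exists2 e : R, (0 < e)%R & \int[mu]_x Phi (e * `|f x|)%R < +oo.

Definition orlicz_norm (Phi : R -> \bar R) (f : X -> R) : \bar R :=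
  ereal_inf [set l%:E | l in
    [set l : R | (0 < l)%R /\ \int[mu]_x Phi (`|f x| / l)%R <= 1]].

Definition kernel_op (k : X -> X -> R) (f : X -> R) (x : X) : R :=
  (\int[mu]_y (k x y * f y))%R.

(* The axioms of a space of homogeneous type make each rho x measurable, but
   not rho itself on X * X.  If rho is not jointly measurable, kernel_op k f
   may fail to be measurable; its norm is then computed with the integral of
   the library, which is a lower integral, and membership in the target space
   is not claimed. *)
Definition kernel_bounded (k : X -> X -> R) (Phi Psi : R -> \bar R) : Prop :=
  exists2 C : R, (0 < C)%R & forall f : X -> R, orlicz Phi f ->
    [/\ {ae mu, forall x,
           mu.-integrable [set: X] (fun y => (k x y * f y)%:E)},
        measurable_fun [set: X * X] (fun p : X * X => rho p.1 p.2) ->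
          orlicz Psi (kernel_op k f) &
        orlicz_norm Psi (kernel_op k f) <= C%:E * orlicz_norm Phi f].

(* The exponent is that of 1 / rho x y `^ (Q - alpha); on the diagonal, a null
   set for Q-homogeneous mu, the numerators below vanish. *)
Definition commutator_ker (b : X -> R) (Q alpha : R) (x y : X) : R :=
  ((b x - b y) / rho x y `^ (Q - alpha))%R.

Definition abs_commutator_ker (b : X -> R) (Q alpha : R) (x y : X) : R :=
  (`|b x - b y| / rho x y `^ (Q - alpha))%R.

Definition commutator_bounded (b : X -> R) (Q alpha : R) :=
  kernel_bounded (commutator_ker b Q alpha).

Definition abs_commutator_bounded (b : X -> R) (Q alpha : R) :=
  kernel_bounded (abs_commutator_ker b Q alpha).

End Operators.

Section Conditions.
Context (R : realType).
Variables (Q alpha : R) (Phi Psi : R -> \bar R).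

Definition frac_inv (r : R) : \bar R :=
  (r `^ alpha)%:E * young_inv Phi (r `^ (- Q))%:E.

Definition log_tail (r : R) : \bar R :=
  \int[lebesgue_measure]_(t in `]r, +oo[)
    ((1 + ln (t / r))%:E * young_inv Phi (t `^ (- Q))%:E *
     (t `^ alpha / t)%:E).

Definition cond_star : Prop :=
  exists2 A' : R, (0 < A')%R & forall r, (0 < r)%R ->
    frac_inv r <= A'%:E * young_inv Psi (r `^ (- Q))%:E.

Definition cond_sufficient : Prop :=
  exists2 C : R, (0 < C)%R & forall r, (0 < r)%R ->
    frac_inv r + log_tail r <= C%:E * young_inv Psi (r `^ (- Q))%:E.

Definition cond_tail : Prop :=
  exists2 C : R, (0 < C)%R & forall r, (0 < r)%R ->
    log_tail r <= C%:E * frac_inv r.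

End Conditions.

(* Main.v *)
(* Sufficiency.  The kernel is discretized over a net of balls at all dyadic
   scales: on a ball with mean [a], one has
   [|b(x) - b(y)| <= |b(x) - a| + |b(y) - a|].  By the John-Nirenberg and Hoelder
   inequalities, the second term is controlled by averages of [f ^ q] with [q]
   close to [1], which are dominated by a maximal function; the condition
   [nabla2] on [Phi] gives a modular inequality for this maximal function, and
   Hedberg's argument turns the integral condition on [Phi] and [Psi] into a
   pointwise bound.  In the first term the oscillation of [b] sits outside of the
   average; by duality it is moved to the test function, where the conjugate of
   [Psi], which satisfies [nabla2] since [Psi] satisfies [Delta2], admits the
   same maximal inequality.  The first term is thus reduced to the sum of the
   averages over disjoint cores of the balls, to which Hedberg's argument applies.

   Necessity.  For [b] the indicator of every other annulus around a point,
   [|b(x) - b(y)| = 1] when [x] and [y] lie in consecutive annuli; testing on the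
   indicator of an annulus of radius about [r] gives the condition at [r]. *)
Require Import Defs.
From HB Require Import structures.
From mathcomp Require Import all_boot all_order all_algebra.
From mathcomp Require Import all_classical all_reals all_analysis.
From mathcomp Require Import measurable_realfun ring lra zify.
Set Implicit Arguments.
Unset Strict Implicit.
Unset Printing Implicit Defensive.
Import Order.TTheory GRing.Theory Num.Theory.
Import numFieldNormedType.Exports.
Local Open Scope classical_set_scope.
Local Open Scope ring_scope.
Local Open Scope ereal_scope.

(** * Covering by balls *)

(** Balls need not be open and the quasi-distance need not be jointly measurable. The estimates
    therefore run over finitely many members of a countable family of balls, with constants
    independent of their number; monotone convergence recovers the kernel, and its possibly
    nonmeasurable image is compared with measurable majorants through the monotonicity of the lower
    integral.

    Hoelder pairs [f] with the oscillation of [b], which has moments of all finite orders but no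
    bound, so some [q > 1] is forced. It has to be close to [1]: when the level drops by [k ^+ i],
    [nabla2] gains [(2 * k) ^- i], while the weak type inequality for [f ^ q] loses [k ^ (q * i)],
    and the series converges when [k ^ (q - 1) < 2].

    Hedberg's argument needs at most one ball per scale at each point. Cells provide this, but the
    duality argument spreads each term over a set of measure comparable to its ball, and a cell may
    be much smaller; the cores are sets of comparable measure that are still disjoint at each
    scale. *)

Section LowerIntegral.
Context (R : realType) (d : measure_display) (X : measurableType d).
Variable mu : {measure set X -> \bar R}.
Import HBNNSimple.

(* No measurability is needed: the integral of a nonnegative function is a
   supremum over the simple functions below it. *)
Lemma le_ge0_integral (D : set X) (f g : X -> \bar R) :
  (forall x, D x -> 0 <= f x) -> (forall x, D x -> f x <= g x) ->
  \int[mu]_(x in D) f x <= \int[mu]_(x in D) g x.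
Proof.
move=> f0 fg; rewrite !ge0_integralE//; last first.
  by move=> x Dx; rewrite (le_trans (f0 _ Dx)) ?fg.
apply: ge_ereal_sup => _ [h/= hf] <-.
apply: le_ereal_sup_tmp; exists (sintegral mu h) => //; exists h => // x.
rewrite (le_trans (hf x))// /patch; case: ifPn => // xD; apply: fg.
by rewrite inE in xD.
Qed.

End LowerIntegral.

Section BallBasis.
Context (R : realType) (d : measure_display) (X : measurableType d).
Variable mu : {measure set X -> \bar R}.

(* The parent [B (P n)] stands for a fixed dilate of the ball [B n]. *)
Record ball_basis (B : nat -> set X) (m : nat -> R) (P : nat -> nat) (D : R) : Prop := {
  bb_measurable : forall n, measurable (B n) ;
  bb_mu : forall n, mu (B n) = (m n)%:E ;
  bb_gt0 : forall n, (0 < m n)%R ;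
  bb_parent : forall n, (m (P n) <= D * m n)%R ;
  bb_double : forall n, (2 * m n <= m (P n))%R ;
  bb_engulf : forall n l, B n `&` B l !=set0 -> (m n <= m l)%R ->
    B n `<=` B (P l) }.

Variables (B : nat -> set X) (m : nat -> R) (P : nat -> nat) (D : R).
Hypothesis HB : ball_basis B m P D.

Lemma bb_sub n : B n `<=` B (P n).
Proof.
have mn := bb_gt0 HB n.
have [->|/set0P B0] := eqVneq (B n) set0; first exact: sub0set.
by apply: (bb_engulf HB); rewrite ?setIid.
Qed.

Lemma bb_D_ge2 : (2 <= D)%R.
Proof.
have := le_trans (bb_double HB 0) (bb_parent HB 0).
by rewrite ler_pM2r// (bb_gt0 HB).
Qed.

(** Greedy selection by induction on the length: a ball of largest measure is kept, the balls
    meeting it are dropped since its parent engulfs them, and the remaining ones are disjoint from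
    it. *)
Lemma vitali_disjoint (s : seq nat) : exists t : seq nat,
  [/\ {subset t <= s}, uniq t, trivIset [set` t] B &
      forall n, n \in s -> exists2 i, i \in t & B n `<=` B (P i)].
Proof.
have [k] := ubnP (size s); elim: k s => // k IH [|n0 s0] sk.
  by exists [::]; split=> //; move=> i j /=.
set s := n0 :: s0 in sk *.
have [l ls lmax] : exists2 l, l \in s & forall i, i \in s -> (m i <= m l)%R.
  suff : forall r : seq nat, r != [::] ->
      exists2 l, l \in r & forall i, i \in r -> (m i <= m l)%R by apply.
  elim=> // a [|b r] IHr _.
    by exists a => [|i]; rewrite ?mem_head// inE => /eqP ->.
  have [l lr lmax] := IHr isT.
  have [al|la] := leP (m a) (m l).
    exists l => [|i]; first by rewrite inE lr orbT.
    by rewrite inE => /predU1P[->//|]; exact: lmax.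
  exists a => [|i]; rewrite ?mem_head//.
  by rewrite inE => /predU1P[->//|/lmax/le_trans]; apply; exact: ltW.
pose s' := [seq i <- s | `[< B i `&` B l = set0 >]].
have Bl : B l `&` B l !=set0.
  rewrite setIid; apply/set0P/eqP => Bl0.
  have := bb_gt0 HB l; have := bb_mu HB l; rewrite Bl0 measure0 => -[<-].
  by rewrite ltxx.
have s'k : (size s' < k)%N.
  rewrite (leq_trans _ (ltnSE sk))// size_filter -(count_predC (fun i => `[< B i `&` B l = set0 >]) s).
  rewrite -[X in (X < _)%N]addn0 ltn_add2l -has_count; apply/hasP; exists l => //=.
  by apply/asboolPn; apply/eqP/set0P.
have [t [ts ut tt tc]] := IH s' s'k.
exists (l :: t); split.
- move=> i; rewrite inE => /predU1P[->//|/ts].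
  by rewrite mem_filter => /andP[].
- rewrite /= ut andbT; apply/negP => /ts; rewrite mem_filter => /andP[/asboolP Bl0 _].
  by move/set0P/eqP: Bl.
- have lt i : i \in t -> B i `&` B l = set0.
    by move=> /ts; rewrite mem_filter => /andP[/asboolP].
  apply/trivIsetP => i j /=; rewrite !inE => /predU1P[->|it] /predU1P[->|jt].
  + by rewrite eqxx.
  + by rewrite setIC lt.
  + by rewrite lt.
  + by move/trivIsetP : tt => /(_ i j it jt).
- move=> n ns.
  have [n0'|n0'] := pselect (B n `&` B l = set0).
    have [|i it Bi] := tc n; last by exists i => //; rewrite inE it orbT.
    by rewrite mem_filter ns andbT; apply/asboolP.
  exists l; rewrite ?mem_head//; apply: (bb_engulf HB); last exact: lmax.
  exact/set0P/eqP.
Qed.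

Lemma vitali (s : seq nat) : exists t : seq nat,
  [/\ {subset t <= s},
      (forall n, n \in s -> exists2 i, i \in t & B n `<=` B (P i)) &
      forall phi : X -> \bar R, measurable_fun [set: X] phi ->
        (forall x, 0 <= phi x) ->
        \sum_(i <- t) \int[mu]_(x in B i) phi x <= \int[mu]_x phi x].
Proof.
have [t [ts ut tt tc]] := vitali_disjoint s; exists t; split=> // phi mphi phi0.
rewrite -ge0_integral_bigsetU//.
- apply: ge0_subset_integral => //.
  by apply: bigsetU_measurable => i _; exact: (bb_measurable HB).
- exact: (bb_measurable HB).
- exact: measurable_funTS.
Qed.

(** A selected parent has measure at most [D * m i], and [a * m i] is at most the integral of [phi]
    over the selected ball; disjointness allows these to be summed, whatever the length of the
    list. *)
Lemma weak_type (s : seq nat) (a : R) (phi : X -> \bar R) : (0 <= a)%R ->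
  measurable_fun [set: X] phi -> (forall x, 0 <= phi x) ->
  (forall n, n \in s -> (a * m n)%:E <= \int[mu]_(x in B n) phi x) ->
  a%:E * mu (\big[setU/set0]_(n <- s) B n) <= D%:E * \int[mu]_x phi x.
Proof.
move=> a0 mphi phi0 sa; have D0 : (0 <= D)%R by rewrite (le_trans _ bb_D_ge2).
have [t [ts tc tphi]] := vitali s.
apply: (@le_trans _ _ (D%:E * \sum_(i <- t) \int[mu]_(x in B i) phi x)); last first.
  by rewrite lee_wpmul2l ?lee_fin ?tphi.
rewrite ge0_sume_distrr; last by move=> *; exact: integral_ge0.
apply: (@le_trans _ _ (a%:E * \sum_(i <- t) mu (B (P i)))).
  rewrite lee_wpmul2l ?lee_fin//.
  apply: (@le_trans _ _ (mu (\big[setU/set0]_(i <- t) B (P i)))).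
    apply: le_measure; rewrite ?inE; try by apply: bigsetU_measurable => *; exact: (bb_measurable HB).
    move=> x; rewrite -!bigcup_seq => -[n /= /tc[i it ni] nx].
    by exists i => //; exact: ni.
  elim: t {ts tc tphi} => [|i t IH]; first by rewrite !big_nil measure0.
  rewrite !big_cons (le_trans (measureU2 _ _ _))//.
  - exact: (bb_measurable HB).
  - by apply: bigsetU_measurable => *; exact: (bb_measurable HB).
  - exact: leeD2l.
rewrite ge0_sume_distrr; last by [].
rewrite [X in X <= _]big_seq [X in _ <= X]big_seq; apply: lee_sum => i /ts/sa ia.
rewrite (bb_mu HB) -EFinM (@le_trans _ _ (D%:E * (a * m i)%:E))//.
  rewrite -EFinM lee_fin mulrCA ler_wpM2l//; exact: (bb_parent HB).
by rewrite lee_wpmul2l.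
Qed.

End BallBasis.

(** * Averages on balls and pointwise values *)

Section NegligibleSmall.
Context (R : realType) (d : measure_display) (X : measurableType d).
Variable mu : {measure set X -> \bar R}.

(** Measurable covers of measure at most [1 / (i + 1)] intersect in a measurable null cover. *)
Lemma negligible_small (N : set X) :
  (forall e : R, (0 < e)%R -> exists A, [/\ measurable A, N `<=` A & mu A <= e%:E]) ->
  mu.-negligible N.
Proof.
move=> NA.
have /choice[A PA] : forall i : nat, exists A, [/\ measurable A, N `<=` A & mu A <= (i.+1%:R^-1)%:E].
  by move=> i; apply: NA; rewrite invr_gt0.
have mA : measurable (\bigcap_i A i) by apply: bigcapT_measurable => i; case: (PA i).
exists (\bigcap_i A i); split=> //; last first.
  by move=> x Nx i _; case: (PA i) => _ /(_ _ Nx).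
apply/eqP; rewrite eq_le measure_ge0 andbT; apply/lee_addgt0Pr => e e0; rewrite add0e.
have [i _ /(_ i (leqnn i)) ie] := near_infty_natSinv_lt (PosNum e0).
have [mAi _ Ai] := PA i; apply: le_trans (le_trans Ai _).
  by apply: le_measure; rewrite ?inE//; exact: bigcap_inf.
by rewrite lee_fin ltW.
Qed.

Lemma measure_bigcup_le (F : nat -> set X) (c : \bar R) :
  (forall n, measurable (F n)) ->
  (forall N, mu (\big[setU/set0]_(n < N) F n) <= c) -> mu (\bigcup_n F n) <= c.
Proof.
move=> mF Fc; rewrite -bigcup_bigsetU_bigcup.
set G := fun n => \big[setU/set0]_(k < n.+1) F k.
have mG n : measurable (G n) by exact: bigsetU_measurable.
have nG : nondecreasing_seq G.
  by move=> i j ij; apply/subsetPset; apply: subset_bigsetU.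
have cG := @nondecreasing_cvg_mu _ _ _ mu _ mG (bigcupT_measurable _ mG) nG.
rewrite -(cvg_lim _ cG)//; apply: lime_le; first by apply/cvg_ex; exists (mu (\bigcup_n G n)).
by apply: nearW => n /=; exact: Fc.
Qed.

End NegligibleSmall.

Section Lebesgue.
Context (R : realType) (d : measure_display) (X : topMeasurableType d).
Variable mu : {measure set X -> \bar R}.
Variables (B : nat -> set X) (m : nat -> R) (P : nat -> nat) (D : R).
Hypothesis HB : ball_basis mu B m P D.
Hypothesis B_nbhs : forall (x : X) (U : set X), nbhs x U ->
  exists2 n, B n x & B n `<=` U.
Hypothesis dense : Cc_dense_L1 mu.

(* [h] is approximated by a continuous [g], for which the bound is clear, and
   the weak type inequality controls the averages of [h - g]. *)
Lemma le_average_ae (h : X -> R) : mu.-integrable [set: X] (EFin \o h) ->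
  {ae mu, forall x, forall L : R,
    (forall n, B n x -> \int[mu]_(y in B n) `|h y|%:E <= (L * m n)%:E) ->
    (`|h x| <= L)%R}.
Proof.
move=> ih.
(* The level [L] ranges over all reals; quantifying the gap [dl] instead, along [1 / (k + 1)],
   reduces the exceptional set to a countable union. *)
pose Bad (dl : R) := [set x | exists2 L : R,
   (forall n, B n x -> \int[mu]_(y in B n) `|h y|%:E <= (L * m n)%:E) &
   (L + dl < `|h x|)%R].
suff bad dl : (0 < dl)%R -> mu.-negligible (Bad dl).
  have : mu.-negligible (\bigcup_k Bad (k.+1%:R^-1)%R).
    by apply: negligible_bigcup => k; apply: bad; rewrite invr_gt0.
  apply: negligibleS => x /= /existsNP[L /not_implyP[HL /negP]].
  rewrite -ltNge => Lh.
  have dl0 : (0 < `|h x| - L)%R by rewrite subr_gt0.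
  have [k _ /(_ k (leqnn k)) /= kd] := near_infty_natSinv_lt (PosNum dl0).
  by exists k => //; exists L => //; rewrite -ltrBrDl.
move=> dl0; apply: negligible_small => e e0.
have mh : measurable_fun [set: X] h.
  by apply/measurable_EFinP; case/integrableP : ih.
have D0 : (0 < D)%R by rewrite (lt_le_trans _ (bb_D_ge2 HB)).
(* Chebyshev's inequality for [A1] costs [2 / dl * e'] and the weak type inequality for the balls
   [S n] costs [2 / dl * (D * e')]; together they make [e]. *)
pose e' := (e * dl / (2 * (1 + D)))%R.
have e'0 : (0 < e')%R by rewrite divr_gt0 ?mulr_gt0// addr_gt0.
have [g [cg _ ig hg]] := dense e'0 ih.
have mg : measurable_fun [set: X] g.
  by apply/measurable_EFinP; case/integrableP : ig.
have mhg : measurable_fun [set: X] (fun x => `|h x - g x|%:E).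
  by apply/measurable_EFinP; apply: measurableT_comp => //; exact: measurable_funB.
pose A1 := [set x | (dl / 2)%:E <= `|(h x - g x)%:E| ].
have mA1 : measurable A1.
  rewrite -[A1]setTI; apply: emeasurable_fun_c_infty => //.
pose S n := if `[< (dl / 2 * m n)%:E <= \int[mu]_(y in B n) `|h y - g y|%:E >]
  then B n else set0.
have mS n : measurable (S n).
  by rewrite /S; case: ifP => // _; exact: (bb_measurable HB).
exists (A1 `|` \bigcup_n S n); split.
- by apply: measurableU => //; exact: bigcupT_measurable.
- move=> x [L HL Lh]; have [hgx|hgx] := leP (dl / 2)%R `|h x - g x|%R.
    by left; rewrite /A1 /= lee_fin.
  right; apply: contrapT => nS.
  have Bx n : B n x -> \int[mu]_(y in B n) `|h y - g y|%:E <= (dl / 2 * m n)%:E.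
    move=> Bnx; rewrite leNgt; apply/negP => dlt; apply: nS; exists n => //.
    by rewrite /S; case: ifPn => // /asboolPn []; exact: ltW.
  have gx : (`|g x| <= L + dl / 2)%R.
    apply/ler_addgt0Pr => eta eta0.
    (* Continuity of [g] yields a ball of the family through [x] on which [g] keeps almost its size
       at [x]; its average there is controlled by those of [h] and [h - g]. *)
    have : nbhs x [set y | `|g x| - eta < `|g y| ]%R.
      have /cvgrPdist_lt /(_ eta eta0) := cg x.
      apply: filterS => y /= xy; rewrite ltrBlDl -ltrBlDr.
      by rewrite (le_lt_trans _ xy)// lerB_dist.
    move=> /B_nbhs[n Bnx Bng]; have mn0 := bb_gt0 HB n.
    rewrite -lerBlDr -(ler_pM2r mn0) -lee_fin.
    have mBn := bb_measurable HB n.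
    apply: (@le_trans _ _ (\int[mu]_(y in B n) `|g y|%:E)).
      have [g0|g0] := leP 0%R (`|g x| - eta)%R; last first.
        by rewrite (@le_trans _ _ 0) ?integral_ge0// lee_fin nmulr_rle0// ltW.
      rewrite EFinM -(bb_mu HB) -integral_cst//; apply: ge0_le_integral => //.
      + apply/measurable_EFinP; apply: measurableT_comp => //; exact: measurable_funTS.
      + by move=> y /Bng /= /ltW; rewrite lee_fin.
    apply: (@le_trans _ _ (\int[mu]_(y in B n) (`|h y|%:E + `|h y - g y|%:E))).
      apply: ge0_le_integral => //.
      + apply/measurable_EFinP; apply: measurableT_comp => //; exact: measurable_funTS.
      + apply: emeasurable_funD; last exact: measurable_funTS.
        apply/measurable_EFinP; apply: measurableT_comp => //; exact: measurable_funTS.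
      + move=> y _; rewrite -EFinD lee_fin -{1}(subKr (h y) (g y)).
        exact: ler_normB.
    rewrite ge0_integralD//; last 2 first.
    + apply/measurable_EFinP; apply: measurableT_comp => //; exact: measurable_funTS.
    + exact: measurable_funTS.
    by rewrite mulrDl EFinD leeD ?HL ?Bx.
  have : (L + dl < L + dl)%R.
    apply: (lt_le_trans Lh); rewrite -(subrK (g x) (h x)).
    rewrite (le_trans (ler_normD _ _))// (le_trans (lerD (ltW hgx) gx))//.
    lra.
  by rewrite ltxx.
- have ihg0 : 0 <= \int[mu]_x `|h x - g x|%:E by exact: integral_ge0.
  have d20 : (0 < dl / 2)%R by rewrite divr_gt0.
  have b1 : (dl / 2)%:E * mu A1 <= e'%:E.
    rewrite -[A1]setTI (le_trans _ (ltW hg))//.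
    apply: (@le_integral_abse _ _ _ mu _ measurableT (fun x => (h x - g x)%:E)) => //.
    by apply/measurable_EFinP; exact: measurable_funB.
  have b2 : mu (\bigcup_n S n) <= (2 / dl * (D * e'))%:E.
    apply: measure_bigcup_le => // N.
    pose s := [seq n <- iota 0 N | `[< (dl / 2 * m n)%:E <= \int[mu]_(y in B n) `|h y - g y|%:E >] ].
    have -> : \big[setU/set0]_(n < N) S n = \big[setU/set0]_(n <- s) B n.
      rewrite /s [RHS]big_filter [RHS]big_mkcond -(big_mkord xpredT S) /index_iota subn0.
      by [].
    rewrite EFinM -lee_pdivrMl ?divr_gt0// invf_div.
    rewrite (le_trans (@weak_type _ _ _ mu B m P D HB s (dl/2) (fun x => `|h x - g x|%:E) _ _ _ _)) ?(ltW d20)//.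
    + by move=> n; rewrite mem_filter => /andP[/asboolP].
    + by rewrite EFinM; apply: lee_wpmul2l; [rewrite lee_fin ltW|exact: ltW].
  rewrite (le_trans (measureU2 _ _ _))//; first exact: bigcupT_measurable.
  rewrite (_ : e%:E = (2 / dl * e')%:E + (2 / dl * (D * e'))%:E); last first.
    rewrite -EFinD; congr EFin; rewrite /e'; field.
    by rewrite !gt_eqF ?addr_gt0// (lt_le_trans _ (bb_D_ge2 HB)).
  apply: leeD => //; rewrite EFinM -lee_pdivrMl ?divr_gt0// invf_div//.
Qed.

End Lebesgue.

(** * The John-Nirenberg inequality *)

Section IntegralUnions.
Context (R : realType) (d : measure_display) (X : measurableType d).
Variable mu : {measure set X -> \bar R}.
Variable f : X -> \bar R.
Hypotheses (mf : measurable_fun [set: X] f) (f0 : forall x, 0 <= f x).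

Lemma integral_setU_le (A C : set X) : measurable A -> measurable C ->
  \int[mu]_(x in A `|` C) f x <= \int[mu]_(x in A) f x + \int[mu]_(x in C) f x.
Proof.
move=> mA mC; rewrite -(setDUK (@subsetUl _ A C)) ge0_integral_setU//.
- apply: leeD => //; apply: ge0_subset_integral => //.
  + by apply: measurableD => //; exact: measurableU.
  + exact: measurable_funTS.
  + by move=> x [[]].
- by apply: measurableD => //; exact: measurableU.
- exact: measurable_funTS.
- by apply/disj_set2P; rewrite setDIK.
Qed.

Lemma integral_bigsetU_le (I : Type) (s : seq I) (F : I -> set X) :
  (forall i, measurable (F i)) ->
  \int[mu]_(x in \big[setU/set0]_(i <- s) F i) f x <=
  \sum_(i <- s) \int[mu]_(x in F i) f x.
Proof.
move=> mF; elim: s => [|i s IH]; first by rewrite !big_nil integral_set0.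
rewrite !big_cons (le_trans (integral_setU_le _ _))//.
  exact: bigsetU_measurable.
exact: leeD2l.
Qed.

Lemma integral_bigcup_le (F : nat -> set X) (c : \bar R) :
  (forall n, measurable (F n)) ->
  (forall N, \int[mu]_(x in \big[setU/set0]_(n < N) F n) f x <= c) ->
  \int[mu]_(x in \bigcup_n F n) f x <= c.
Proof.
move=> mF Fc; rewrite -bigcup_bigsetU_bigcup.
set G := fun n => \big[setU/set0]_(k < n.+1) F k.
have mG n : measurable (G n) by exact: bigsetU_measurable.
have nG : nondecreasing_seq G.
  by move=> i j ij; apply/subsetPset; apply: subset_bigsetU.
have cG := @ge0_nondecreasing_set_cvg_integral _ _ _ G f mu nG mG
  (fun n => measurable_funTS mf) (fun _ x _ => f0 x).
rewrite -(cvg_lim _ cG)//; apply: lime_le.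
  by apply/cvg_ex; exists (\int[mu]_(x in \bigcup_i G i) f x).
by apply: nearW => n /=; exact: Fc.
Qed.

End IntegralUnions.

Section JohnNirenberg.
Context (R : realType) (d : measure_display) (X : measurableType d).
Variable mu : {measure set X -> \bar R}.

(** The conclusion of the differentiation argument, isolated as a hypothesis so that what follows is
    pure measure theory, without a topology. *)
Definition average_dominated (B : nat -> set X) (m : nat -> R) : Prop :=
  forall h : X -> R, mu.-integrable [set: X] (EFin \o h) ->
  {ae mu, forall x, forall L : R,
    (forall n, B n x -> \int[mu]_(y in B n) `|h y|%:E <= (L * m n)%:E) ->
    (`|h x| <= L)%R}.

Variables (B : nat -> set X) (m : nat -> R) (P : nat -> nat) (D : R).
Hypothesis HB : ball_basis mu B m P D.
Hypothesis leb : average_dominated B m.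
Variables (b : X -> R) (a : nat -> R) (beta : R).
Hypothesis mb : measurable_fun [set: X] b.
Hypothesis beta0 : (0 <= beta)%R.
Hypothesis ab : forall n,
  \int[mu]_(x in B n) `|b x - a n|%:E <= (beta * m n)%:E.

Let mB := bb_measurable HB.
Let D0 : (0 < D)%R. Proof. exact: lt_le_trans (bb_D_ge2 HB). Qed.

Let D0w : (0 <= D)%R. Proof. exact: ltW. Qed.
Let p2_ge0 k : (0 <= 2 ^+ k :> R)%R. Proof. exact: exprn_ge0. Qed.

Let mba c : measurable_fun [set: X] (fun x => `|b x - c|%R).
Proof. by apply: measurableT_comp => //; exact: measurable_funB. Qed.

Let mbaE c : measurable_fun [set: X] (fun x => `|b x - c|%:E).
Proof. exact/measurable_EFinP. Qed.

Let mean_dist n (c e : R) : \int[mu]_(x in B n) `|b x - c|%:E <= (e * m n)%:E ->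
  (`|a n - c| <= e + beta)%R.
Proof.
move=> H; have mn := bb_gt0 HB n; rewrite -(ler_pM2r mn) -lee_fin.
rewrite EFinM -(bb_mu HB) -integral_cst//.
apply: (@le_trans _ _ (\int[mu]_(x in B n) (`|b x - c|%:E + `|b x - a n|%:E))).
  apply: ge0_le_integral => //.
  - by move=> x _; rewrite lee_fin.
  - by apply: emeasurable_funD; exact: measurable_funTS.
  - move=> x _; rewrite -EFinD lee_fin /cst.
    rewrite (_ : a n - c = (b x - c) - (b x - a n))%R; last by ring.
    exact: ler_normB.
rewrite ge0_integralD//; try exact: measurable_funTS.
by rewrite mulrDl EFinD leeD.
Qed.

(* Truncation at level [c] makes the integrals finite, so that [step] can be
   iterated; its bound does not depend on [c]. *)
Let trunc_pow (s : nat) (c : R) (n : nat) (x : X) : R := ((Num.min `|b x - a n| c) ^+ s)%R.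

Let mtp s (c : R) n : measurable_fun [set: X] (fun x => (trunc_pow s c n x)%:E).
Proof.
apply/measurable_EFinP; apply: measurable_funX; apply: measurable_minr => //.
Qed.

Let tp0 s (c : R) n x : (0 <= c)%R -> (0 <= trunc_pow s c n x)%R.
Proof. by move=> c0; rewrite exprn_ge0// le_min normr_ge0. Qed.

(* One Calderon-Zygmund step: off the selected balls the oscillation is at
   most [L]; those balls carry at most the fraction [1 / 2 ^ s.+1] of the
   measure, so that the contribution of [kappa] is halved. *)
Let step s : exists2 E : R, (0 <= E)%R & forall c kappa : R, (0 <= c)%R ->
  (0 <= kappa)%R ->
  (forall n, \int[mu]_(x in B n) (trunc_pow s c n x)%:E <= (kappa * m n)%:E) ->
  forall n, \int[mu]_(x in B n) (trunc_pow s c n x)%:E <=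
    ((E + kappa / 2) * m n)%:E.
Proof.
(* On the parent of [B n0]: mean oscillation [beta], plus a distance at most [beta * (D + 1)]
   between [a n0] and [a (P n0)], on a set of measure at most [D * m n0]. *)
pose b1 := (beta * (D + 2) * D)%R.
have b10 : (0 <= b1)%R by rewrite !mulr_ge0// addr_ge0.
(* The term [2 ^+ s.+1 * D * b1] keeps the parents of the selected balls inside [B (P n0)] and
   produces the factor [1 / 2] in front of [kappa]; the term [beta] absorbs the change of mean. *)
pose L := (2 ^+ s.+1 * D * b1 + beta + 1)%R.
have q10 : (0 <= 2 ^+ s.+1 * D * b1)%R := mulr_ge0 (mulr_ge0 (p2_ge0 _) D0w) b10.
have L1 : (1 <= L)%R by rewrite /L lerDr addr_ge0.
have L0 : (0 < L)%R by exact: lt_le_trans L1.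
pose E := ((2 * L) ^+ s)%R.
have L0w := ltW L0.
have E0 : (0 <= E)%R by apply: exprn_ge0; rewrite mulr_ge0.
exists (2 * E)%R; first by rewrite mulr_ge0.
move=> c kappa c0 kappa0 Hk n0.
have mn0 := bb_gt0 HB n0.
(* Cutting off outside the parent gives a function integrable on the whole space, to which [leb]
   applies; the parents of the selected balls stay where [h] is uncut. *)
pose h := (fun x => `|b x - a n0| * \1_(B (P n0)) x)%R.
have mh : measurable_fun [set: X] h.
  by apply: measurable_funM => //; exact: measurable_indic.
have h0 x : (0 <= h x)%R by rewrite mulr_ge0.
have inth_sub A : measurable A -> A `<=` B (P n0) ->
    \int[mu]_(x in A) (h x)%:E = \int[mu]_(x in A) `|b x - a n0|%:E.
  move=> mA AP; apply: eq_integral => x; rewrite inE => /AP xA.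
  by rewrite /h indicE mem_set// mulr1.
have inth : \int[mu]_x (h x)%:E <= (b1 * m n0)%:E.
  have -> : \int[mu]_x (h x)%:E = \int[mu]_(x in B (P n0)) `|b x - a n0|%:E.
    rewrite [RHS]integral_mkcond; apply: eq_integral => x _.
    by rewrite /patch /h indicE; case: (x \in _); rewrite ?mulr1 ?mulr0.
  have aP : (`|a n0 - a (P n0)| <= beta * D + beta)%R.
    apply: mean_dist; apply: (@le_trans _ _ (\int[mu]_(x in B (P n0)) `|b x - a (P n0)|%:E)).
      apply: ge0_subset_integral => //; first exact: measurable_funTS.
      exact: (bb_sub HB).
    rewrite (le_trans (ab _))// lee_fin -mulrA ler_wpM2l//; exact: (bb_parent HB).
  apply: (@le_trans _ _ (\int[mu]_(x in B (P n0)) (`|b x - a (P n0)|%:E + (beta * D + beta)%:E))).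
    apply: ge0_le_integral => //.
    - exact: measurable_funTS.
    - by apply: emeasurable_funD => //; exact: measurable_funTS.
    - move=> x _; rewrite -EFinD lee_fin.
      rewrite (_ : b x - a n0 = (b x - a (P n0)) - (a n0 - a (P n0)))%R; last by ring.
      by rewrite (le_trans (ler_normB _ _))// lerD2l.
  have bD0 : (0 <= beta * D + beta)%R by rewrite addr_ge0// mulr_ge0// ltW.
  rewrite ge0_integralD//; last by exact: measurable_funTS.
  rewrite integral_cst// (bb_mu HB).
  apply: (le_trans (leeD (ab _) (lexx _))).
  rewrite -EFinM -EFinD lee_fin -mulrDl.
  rewrite /b1 (_ : (beta * (D + 2) * D * m n0 = (beta + (beta * D + beta)) * (D * m n0))%R); last by ring.
  by apply: ler_wpM2l; [exact: addr_ge0|exact: (bb_parent HB)].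
have ih : mu.-integrable [set: X] (EFin \o h).
  apply/integrableP; split; first exact/measurable_EFinP.
  under eq_integral do rewrite /= ger0_norm//.
  by rewrite (le_lt_trans inth)// ltry.
have h_le A : measurable A -> \int[mu]_(x in A) (h x)%:E <= (b1 * m n0)%:E.
  move=> mA; apply: le_trans inth; apply: ge0_subset_integral => //.
    exact/measurable_EFinP.
  by move=> x _; rewrite lee_fin.
(* Stopping balls: the average of [h] exceeds [L] on the ball but not on its parent. *)
pose FF n := (L * m n)%:E < \int[mu]_(x in B n) (h x)%:E /\
  \int[mu]_(x in B (P n)) (h x)%:E <= (L * m (P n))%:E.
pose F n := if `[< FF n /\ B n `&` B n0 !=set0 >] then B n else set0.
have mF n : measurable (F n) by rewrite /F; case: ifP.
(* Climbing through the parents reaches a stopping ball: the measure at least doubles at each step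
   while the integral of [h] stays below [b1 * m n0], so that averages above [L] cannot persist. *)
have chain x n : B n x -> (L * m n)%:E < \int[mu]_(y in B n) (h y)%:E ->
    exists2 l, B l x & FF l.
  move=> Bnx Ln; apply: contrapT => nF.
  have H k : [/\ B (iter k P n) x,
     (L * m (iter k P n))%:E < \int[mu]_(y in B (iter k P n)) (h y)%:E &
      (2 ^+ k * m n <= m (iter k P n))%R].
    elim: k => [|k [H1 H2 H3]]; first by rewrite expr0 mul1r.
    split => /=.
    - exact: (bb_sub HB).
    - rewrite ltNge; apply/negP => H4; apply: nF; exists (iter k P n) => //.
    - rewrite exprS -mulrA (le_trans _ (bb_double HB _))// ler_wpM2l//.
  pose z := (b1 * m n0 / m n)%R.
  have mn := bb_gt0 HB n.
  have [_ H2 H3] := H (Num.truncn z).+1.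
  have := lt_le_trans H2 (h_le _ (mB _)).
  rewrite lte_fin ltNge => /negP; apply.
  rewrite (le_trans _ (ler_wpM2l (ltW L0) H3))//.
  rewrite (@le_trans _ _ (1 * (z * m n))%R)//.
    by rewrite mul1r /z divfK// gt_eqF.
  have z0 : (0 <= z)%R by apply: divr_ge0; [apply: mulr_ge0 => //; exact: ltW|exact: ltW].
  apply: ler_pM => //; first by apply: mulr_ge0 => //; exact: ltW.
  rewrite ler_pM2r// (le_trans (ltW (truncnS_gt _)))//.
  by rewrite -natrX ler_nat ltnW// ltn_expl.
have tp_mono n x : (trunc_pow s c n x <= `|b x - a n| ^+ s)%R.
  by rewrite lerXn2r ?nnegrE ?le_min ?normr_ge0// ge_min lexx.
have E1 : (L ^+ s <= E)%R.
  by rewrite lerXn2r ?nnegrE ?mulr_ge0// ?(ltW L0)// ler_peMl ?ler1n// ltW.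
pose v := (fun x => (trunc_pow s c n0 x)%:E).
have mv : measurable_fun [set: X] v by exact: mtp.
have v0 x : 0 <= v x by rewrite lee_fin tp0.
(* At a point of [B n0] off the stopping balls, every ball of the family through the point has
   average at most [L], hence so has [h] itself almost everywhere. *)
have vE : {ae mu, forall x, B n0 x ->
    v x <= (E * 1)%:E + (v \_ (\bigcup_n F n)) x}.
  apply: filterS (leb ih) => x Hx Bx.
  have [xF|xF] := boolP (x \in \bigcup_n F n).
    by rewrite patchE xF leeDr// lee_fin mulr1.
  rewrite patchE (negbTE xF) adde0 mulr1 lee_fin.
  rewrite (le_trans (tp_mono _ _))// (le_trans _ E1)// lerXn2r ?nnegrE ?(ltW L0)//.
  have -> : `|b x - a n0|%R = `|h x|%R.
    rewrite (ger0_norm (h0 x)) /h indicE mem_set ?mulr1//; exact: (bb_sub HB).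
  apply: Hx => n Bnx; rewrite leNgt; apply/negP.
  under eq_integral do rewrite ger0_norm//.
  move=> /(chain _ _ Bnx)[l Blx Fl]; move/negP: xF; apply.
  rewrite inE; exists l => //; rewrite /F ifT//; apply/asboolP.
  by split=> //; exists x.
have main : \int[mu]_(x in \bigcup_n F n) v x <= ((E + kappa) / 2 * m n0)%:E.
  apply: integral_bigcup_le => // N.
  pose sq := [seq n <- iota 0 N | `[< FF n /\ B n `&` B n0 !=set0 >] ].
  have -> : \big[setU/set0]_(n < N) F n = \big[setU/set0]_(n <- sq) B n.
    rewrite /sq [RHS]big_filter [RHS]big_mkcond -(big_mkord xpredT F).
    by rewrite /index_iota subn0.
  have [t [ts tc tphi]] := vitali HB sq.
  have tF i : i \in t -> [/\ (L * m i)%:E < \int[mu]_(x in B i) (h x)%:E,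
     B (P i) `<=` B (P n0),
     \int[mu]_(x in B (P i)) `|b x - a n0|%:E <= (L * m (P i))%:E &
      (`|a (P i) - a n0| <= L + beta)%R].
    move=> /ts; rewrite mem_filter => /andP[/asboolP[[F1 F2] [y [y1 y2]]] _].
    have PP : B (P i) `<=` B (P n0).
      apply: (bb_engulf HB); first by exists y; split=> //; exact: (bb_sub HB).
      have := lt_le_trans F1 (h_le _ (mB i)); rewrite lte_fin => Li.
      rewrite -(ler_pM2l L0) (le_trans (ler_wpM2l (ltW L0) (bb_parent HB i)))//.
      rewrite mulrCA (le_trans (ler_wpM2l (ltW D0) (ltW Li)))// mulrA ler_wpM2r ?(ltW mn0)//.
      apply: (@le_trans _ _ (2 ^+ s.+1 * D * b1)%R); last first.
        by rewrite /L -addrA lerDl addr_ge0.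
      rewrite -[leRHS]mulrA; apply: ler_peMl; first exact: mulr_ge0.
      by apply: exprn_ege1; rewrite ler1n.
    have F3 : \int[mu]_(x in B (P i)) `|b x - a n0|%:E <= (L * m (P i))%:E.
      by rewrite -inth_sub.
    by split => //; exact: mean_dist.
  apply: (@le_trans _ _ (\int[mu]_(x in \big[setU/set0]_(i <- t) B (P i)) v x)).
    apply: ge0_subset_integral => //.
    - exact: bigsetU_measurable.
    - exact: bigsetU_measurable.
    - exact: measurable_funTS.
    - move=> x; rewrite -!bigcup_seq => -[n /= /tc[i it ni] nx].
      by exists i => //; exact: ni.
  rewrite (le_trans (integral_bigsetU_le _ _ _ _ _))//.
  (* On the parent of a selected ball, [b - a n0] exceeds [b - a (P i)] by at most [2 * L] in
     absolute value, and [(w + 2 * L) ^+ s <= 2 ^+ s * (w ^+ s + E)]; integrated with the hypothesis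
     on [kappa], this gives [q * m (P i)]. *)
  pose q := (2 ^+ s * (kappa + E))%R.
  have q0 : (0 <= q)%R by rewrite mulr_ge0// addr_ge0.
  have qDL0 : (0 <= q * D / L)%R by apply: divr_ge0 => //; exact: mulr_ge0.
  apply: (@le_trans _ _ (\sum_(i <- t) (q * D / L)%:E * \int[mu]_(x in B i) (h x)%:E)).
    rewrite [X in X <= _]big_seq [X in _ <= X]big_seq; apply: lee_sum => i /tF[F1 _ _ F4].
    apply: (@le_trans _ _ (\int[mu]_(x in B (P i)) ((2 ^+ s)%:E * ((trunc_pow s c (P i) x)%:E + E%:E)))).
      apply: ge0_le_integral => //.
      - exact: measurable_funTS.
      - apply: measurable_funeM; apply: emeasurable_funD => //; exact: measurable_funTS.
      - move=> x _; rewrite -EFinD -EFinM lee_fin /v /trunc_pow.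
        set u := `|b x - a (P i)|%R; set w := Num.min u c.
        have u0 : (0 <= u)%R by exact: normr_ge0.
        have w0 : (0 <= w)%R by rewrite /w le_min u0.
        have L20 : (0 <= 2 * L)%R by rewrite mulr_ge0// ltW.
        have uw : (Num.min `|b x - a n0| c <= w + 2 * L)%R.
          have H : (`|b x - a n0| <= u + 2 * L)%R.
            rewrite (_ : b x - a n0 = (b x - a (P i)) + (a (P i) - a n0))%R; last by ring.
            rewrite (le_trans (ler_normD _ _))// lerD2l (le_trans F4)//.
            by rewrite mulr_natl mulr2n lerD2l /L addrAC lerDr addr_ge0.
          rewrite /w; have [uc|cu] := leP u c; first by rewrite ge_min H.
          by rewrite ge_min orbC lerDl L20.
        apply: (@le_trans _ _ ((2 * Num.max w (2 * L)) ^+ s)%R).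
          rewrite lerXn2r ?nnegrE ?mulr_ge0// ?le_min ?normr_ge0 ?le_max ?w0//.
          by rewrite (le_trans uw)// [leRHS]mulr_natl mulr2n lerD// le_max lexx ?orbT.
        rewrite exprMn ler_wpM2l ?exprn_ge0//.
        have [wl|lw] := leP w (2 * L)%R.
          by rewrite /E lerDr exprn_ge0.
        by rewrite lerDl.
    rewrite ge0_integralZl_EFin//; last 2 first.
    - by move=> x _; rewrite adde_ge0// lee_fin tp0.
    - by apply: emeasurable_funD => //; exact: measurable_funTS.
    rewrite ge0_integralD//; last 2 first.
    - by move=> x _; rewrite lee_fin tp0.
    - exact: measurable_funTS.
    rewrite integral_cst// (bb_mu HB).
    apply: (@le_trans _ _ (q * m (P i))%:E).
      rewrite /q -mulrA EFinM; apply: lee_wpmul2l; first by rewrite lee_fin exprn_ge0.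
      by rewrite mulrDl EFinD leeD.
    rewrite (le_trans _ (lee_wpmul2l _ (ltW F1)))//.
    rewrite -EFinM lee_fin (_ : (q * D / L * (L * m i))%R = (q * (D * m i))%R); last first.
      by field; rewrite gt_eqF.
    by rewrite ler_wpM2l//; exact: (bb_parent HB).
  rewrite -ge0_sume_distrr; last by move=> i _; apply: integral_ge0 => x _; rewrite lee_fin.
  apply: (@le_trans _ _ ((q * D / L)%:E * (b1 * m n0)%:E)).
    apply: lee_wpmul2l; first by rewrite lee_fin.
    apply: le_trans inth; apply: tphi; first exact/measurable_EFinP.
    by move=> x; rewrite lee_fin.
  rewrite -EFinM lee_fin mulrA ler_wpM2r ?(ltW mn0)//.
  rewrite (_ : (q * D / L * b1 = q * (D * b1) / L)%R); last by ring.
  rewrite ler_pdivrMr// [leRHS]mulrAC ler_pdivlMr//.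
  rewrite /q (_ : (2 ^+ s * (kappa + E) * (D * b1) * 2 = (E + kappa) * (2 ^+ s.+1 * D * b1))%R); last by rewrite exprS; ring.
  rewrite ler_wpM2l ?addr_ge0// /L -addrA lerDl addr_ge0//.
apply: (@le_trans _ _ (\int[mu]_(x in B n0) ((E * 1)%:E + (v \_ (\bigcup_n F n)) x))).
  apply: ae_ge0_le_integral => //.
  - by move=> x _; exact: v0.
  - exact: measurable_funTS.
  - move=> x _; apply: adde_ge0; first by rewrite lee_fin mulr1.
    by rewrite patchE; case: ifP.
  - apply: emeasurable_funD => //; apply: measurable_funTS.
    by apply/(measurable_restrictT _ (bigcupT_measurable _ mF)); exact: measurable_funTS.
have mvF : measurable_fun [set: X] (v \_ (\bigcup_n F n)).
  by apply/(measurable_restrictT _ (bigcupT_measurable _ mF)); exact: measurable_funTS.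
have vF0 x : 0 <= (v \_ (\bigcup_n F n)) x by rewrite patchE; case: ifP.
rewrite mulr1 ge0_integralD//; last exact: measurable_funTS.
rewrite integral_cst// (bb_mu HB).
apply: (@le_trans _ _ ((E * m n0)%:E + ((E + kappa) / 2 * m n0)%:E)).
  rewrite EFinM leeD2l//; apply: le_trans main.
  rewrite [leRHS]integral_mkcond; exact: ge0_subset_integral.
rewrite -EFinD lee_fin -mulrDl ler_wpM2r ?(ltW mn0)//.
have := E0; lra.
Qed.

(** [step] turns a bound [kappa] into [E + kappa / 2], whose fixed point is [2 * E]. Started from
    the trivial bound for the truncation at [c], the iterates tend to it; the truncation is then
    removed by monotone convergence. Each order [s] has its own constant. *)
Lemma john_nirenberg s : exists2 K : R, (0 <= K)%R &
  forall n, \int[mu]_(x in B n) (`|b x - a n| ^+ s)%:E <= (K * m n)%:E.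
Proof.
have [E E0 HE] := step s.
exists (2 * E)%R => [|n]; first by rewrite mulr_ge0.
have mn := bb_gt0 HB n.
have tr (c : R) : (0 <= c)%R ->
    \int[mu]_(x in B n) (trunc_pow s c n x)%:E <= (2 * E * m n)%:E.
  move=> c0.
  have H i l : \int[mu]_(x in B l) (trunc_pow s c l x)%:E <=
      ((2 * E + c ^+ s / 2 ^+ i) * m l)%:E.
    elim: i l => [|i IH] l.
      rewrite EFinM -(bb_mu HB) -integral_cst//; apply: ge0_le_integral => //.
      - by move=> x _; rewrite lee_fin tp0.
      - exact: measurable_funTS.
      - move=> x _; rewrite lee_fin expr0 divr1.
        rewrite (@le_trans _ _ (c ^+ s)%R) ?lerDr ?mulr_ge0//.
        by rewrite lerXn2r ?nnegrE ?le_min ?normr_ge0// ge_min lexx orbT.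
    have := HE c _ c0 _ IH l; move=> /(_ _)/le_trans; apply.
      by rewrite addr_ge0 ?mulr_ge0// ?invr_ge0 exprn_ge0.
    rewrite lee_fin ler_wpM2r ?(ltW (bb_gt0 HB l))//.
    rewrite exprS invfM; set z := (c ^+ s)%R; set w := (2 ^+ i)^-1%R.
    by rewrite le_eqVlt; apply/orP; left; apply/eqP; field.
  apply/lee_addgt0Pr => e e0; rewrite -EFinD.
  pose z := (c ^+ s * m n / e)%R.
  have z0 : (0 <= z)%R by rewrite !mulr_ge0 ?invr_ge0 ?exprn_ge0// ltW.
  rewrite (le_trans (H (Num.truncn z).+1 n))// lee_fin mulrDl lerD2l mulrAC ler_pdivrMr ?exprn_gt0//.
  rewrite [leRHS]mulrC -ler_pdivrMr// (le_trans (ltW (truncnS_gt z)))//.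
  by rewrite -natrX ler_nat ltnW// ltn_expl.
pose g k (x : X) := (trunc_pow s k%:R n x)%:E.
have mbs : measurable_fun [set: X] (fun x => (`|b x - a n| ^+ s)%:E).
  by apply/measurable_EFinP; exact: measurable_funX.
have gg x : limn (g ^~ x) = (`|b x - a n| ^+ s)%:E.
  apply/cvg_lim => //; apply: cvg_near_cst; near=> k.
  rewrite /g /trunc_pow; congr EFin; congr (_ ^+ _)%R; apply/min_idPl.
  near: k; exists (Num.truncn `|b x - a n|%R).+1 => // k /= kb.
  by rewrite (le_trans (ltW (truncnS_gt _)))// ler_nat.
under eq_integral do rewrite -gg.
rewrite monotone_convergence//.
- apply: lime_le.
    apply: ereal_nondecreasing_is_cvgn => i j ij; apply: ge0_le_integral => //.
    + by move=> x _; rewrite lee_fin tp0.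
    + apply: measurable_funTS; exact: mtp.
    + apply: measurable_funTS; exact: mtp.
    + move=> x _; rewrite lee_fin lerXn2r ?nnegrE ?le_min ?normr_ge0 ?ler0n//=.
      by rewrite !ge_min lexx/= ler_nat ij orbT.
  by apply: nearW => k; exact: tr.
- by move=> k; apply: measurable_funTS; exact: mtp.
- by move=> k x _; rewrite lee_fin tp0.
- move=> x _ i j ij; rewrite lee_fin lerXn2r ?nnegrE ?le_min ?normr_ge0 ?ler0n//=.
  by rewrite !ge_min lexx/= ler_nat ij orbT.
Unshelve. all: by end_near. Qed.

End JohnNirenberg.

(** * Starshaped functions *)

Section Starshaped.
Context (R : realType).
Implicit Types Theta : R -> \bar R.

(** What convexity through the origin provides. Young functions, their conjugates, which may take
    the value [+oo], and rescalings of these all qualify, so that one maximal inequality serves for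
    all. *)
Record starshaped Theta : Prop := {
  star0 : Theta 0%R = 0 ;
  star_ge0 : forall r : R, (0 <= r)%R -> 0 <= Theta r ;
  star_shrink : forall c r : R, (0 <= c <= 1)%R -> (0 <= r)%R ->
    Theta (c * r)%R <= c%:E * Theta r }.

Lemma star_mono Theta : starshaped Theta ->
  forall r s : R, (0 <= r)%R -> (r <= s)%R -> Theta r <= Theta s.
Proof.
move=> H r s r0 rs; have s0 := le_trans r0 rs.
have [s00|sn0] := eqVneq s 0%R.
  by have -> : r = s by apply/eqP; rewrite eq_le rs s00 r0.
have sp : (0 < s)%R by rewrite lt_neqAle eq_sym sn0.
rewrite -{1}(divfK sn0 r) (le_trans (star_shrink H _ s0))//.
  by rewrite divr_ge0//= ler_pdivrMr// mul1r.
by rewrite gee_pMl ?(star_ge0 H)// lee_fin ler_pdivrMr// mul1r.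
Qed.

Lemma star_dilate Theta : starshaped Theta -> forall c r : R, (1 <= c)%R ->
  (0 <= r)%R -> c%:E * Theta r <= Theta (c * r)%R.
Proof.
move=> H c r c1 r0; have c0 : (0 < c)%R by exact: lt_le_trans c1.
have cr0 : (0 <= c * r)%R by rewrite mulr_ge0// ltW.
have ci : (0 <= c^-1 <= 1)%R by rewrite invr_ge0 ltW//= invf_le1.
have := star_shrink H ci cr0; rewrite mulKf ?gt_eqF// => Hr.
by rewrite -(lee_pdivlMl _ _ c0).
Qed.

(** By monotonicity the superlevel sets of [Theta] in [[0, +oo[] are intervals. *)
Lemma star_measurable_comp Theta (d : measure_display) (X : measurableType d)
    (f : X -> R) : starshaped Theta -> measurable_fun [set: X] f ->
  (forall x, (0 <= f x)%R) -> measurable_fun [set: X] (fun x => Theta (f x)).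
Proof.
move=> H mf f0; apply: (measurability _ (ErealGenCInfty.measurableE R)) => // /= _ [_ [y ->] <-].
rewrite setTI.
have -> : (fun x => Theta (f x)) @^-1` `[y%:E, +oo[%classic =
    [set: X] `&` f @^-1` [set r | (0 <= r)%R /\ y%:E <= Theta r].
  apply/seteqP; split=> x /=; rewrite in_itv/= andbT; first by move=> ?; split.
  by case=> _ [].
apply: mf => //; apply: is_interval_measurable => s t /= [s0 ys] [t0 yt] r /andP[sr rt].
have r0 : (0 <= r)%R by exact: le_trans sr.
by split=> //; rewrite (le_trans ys)// (star_mono H).
Qed.

End Starshaped.

Section RealSequences.
Context (R : realType).

(** Bernoulli's inequality. *)
Lemma expr_unbounded (k z : R) : (1 < k)%R -> exists l, (z < k ^+ l)%R.
Proof.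
move=> k1; have k0 : (0 < k - 1)%R by rewrite subr_gt0.
have bern l : (1 + l%:R * (k - 1) <= k ^+ l)%R.
  elim: l => [|l IH]; first by rewrite mul0r addr0 expr0.
  rewrite exprSr (le_trans _ (ler_wpM2r _ IH)) ?(le_trans _ (ltW k1))//.
  rewrite -natr1; have : (0 <= l%:R * (k - 1) * (k - 1))%R by rewrite !mulr_ge0// ltW.
  nra.
exists (Num.truncn (z / (k - 1))%R).+1; apply: lt_le_trans (bern _).
rewrite (@lt_trans _ _ ((Num.truncn (z / (k - 1))%R).+1%:R * (k - 1))%R)// ?ltrDr//.
by rewrite -ltr_pdivrMr// truncnS_gt.
Qed.

Lemma sum_geometric_le (rho : R) n : (0 <= rho < 1)%R ->
  (\sum_(i < n) rho ^+ i <= (1 - rho)^-1)%R.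
Proof.
move=> /andP[r0 r1]; have r10 : (0 < 1 - rho)%R by rewrite subr_gt0.
rewrite -[leRHS]mul1r ler_pdivlMr// mulrC.
rewrite -[(1 - rho)%R]opprB mulNr -subrX1 opprB.
by rewrite gerBl exprn_ge0.
Qed.

End RealSequences.

Lemma measurable_set_lt (R : realType) (d : measure_display)
    (X : measurableType d) (f g : X -> R) :
  measurable_fun [set: X] f -> measurable_fun [set: X] g ->
  measurable [set x | (f x < g x)%R].
Proof.
move=> mf mg; rewrite -[X in measurable X]setTI.
under eq_set do rewrite -lte_fin.
by apply: measurable_lte => //; exact/measurable_EFinP.
Qed.

(** * A modular maximal inequality *)

Section PowerAverages.
Context (R : realType) (d : measure_display) (X : measurableType d).
Variable mu : {measure set X -> \bar R}.
Variables (B : nat -> set X) (m : nat -> R) (P : nat -> nat) (D : R).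
Hypothesis HB : ball_basis mu B m P D.
Let mB := bb_measurable HB.

Definition bounded_nneg (f : X -> R) : Prop :=
  measurable_fun [set: X] f /\ exists M : R, forall x, (0 <= f x <= M)%R.

Variable t : nat.
Hypothesis t0 : (0 < t)%N.

(* The conjugate exponent of [t + 1]. *)
Definition expo : R := (1 + t%:R^-1)%R.
Local Notation q := expo.

Lemma expo_gt1 : (1 < q)%R.
Proof. by rewrite ltrDl invr_gt0 ltr0n. Qed.

Let q0 : (0 < q)%R. Proof. exact: lt_trans expo_gt1. Qed.

Definition avgq (f : X -> R) (n : nat) : R :=
  ((fine (\int[mu]_(x in B n) (f x `^ q)%:E) / m n) `^ q^-1)%R.

(** A finite stage of the maximal function of order [q]: measurable, bounded when [f] is, and
    estimated uniformly in [N]. *)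
Definition maxq (N : nat) (f : X -> R) (x : X) : R :=
  \big[Num.max/0%R]_(n < N) (avgq f n * \1_(B n) x)%R.

Lemma avgq_ge0 f n : (0 <= avgq f n)%R. Proof. exact: powR_ge0. Qed.

Lemma measurable_powq (f : X -> R) : measurable_fun [set: X] f ->
  measurable_fun [set: X] (fun x => (f x `^ q)%:E).
Proof.
move=> mf; apply/measurable_EFinP.
by apply: (@measurableT_comp _ _ _ _ _ _ (fun u : R => u `^ q)%R); [exact: measurable_powR|].
Qed.

Lemma avgqE f n : bounded_nneg f ->
  \int[mu]_(x in B n) (f x `^ q)%:E = (avgq f n `^ q * m n)%:E.
Proof.
move=> [mf [M fM]]; have mn := bb_gt0 HB n.
have I0 : 0 <= \int[mu]_(x in B n) (f x `^ q)%:E.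
  by apply: integral_ge0 => x _; rewrite lee_fin powR_ge0.
have If : \int[mu]_(x in B n) (f x `^ q)%:E \is a fin_num.
  rewrite ge0_fin_numE//; apply: (@le_lt_trans _ _ ((M `^ q)%:E * mu (B n))).
    rewrite -integral_cst; last exact: mB.
    apply: le_ge0_integral => x _; first by rewrite lee_fin powR_ge0.
    have /andP[fx0 fxM] := fM x.
    by rewrite lee_fin ge0_ler_powR ?nnegrE ?(ltW q0)// (le_trans fx0).
  by rewrite (bb_mu HB) -EFinM ltry.
rewrite /avgq -powRrM mulVf ?gt_eqF// powRr1; last by rewrite divr_ge0 ?fine_ge0// ltW.
by rewrite divfK ?gt_eqF// fineK.
Qed.

Lemma le_avgq f n (c : R) : bounded_nneg f -> (0 <= c)%R ->
  \int[mu]_(x in B n) (f x `^ q)%:E <= (c `^ q * m n)%:E -> (avgq f n <= c)%R.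
Proof.
move=> bf c0; rewrite avgqE// lee_fin ler_pM2r ?(bb_gt0 HB)// => H.
rewrite leNgt; apply/negP => /(@gt0_ltr_powR _ q q0 c _ _ _).
by rewrite !nnegrE avgq_ge0 c0 => /(_ isT isT); rewrite ltNge H.
Qed.

Lemma avgq_le f n (M : R) : bounded_nneg f -> (forall x, (f x <= M)%R) ->
  (avgq f n <= M)%R.
Proof.
move=> bf fM; have [mf [M' fM']] := bf.
have x0 : (0 <= M)%R.
  have /set0P[x _] : B n != set0.
    apply/eqP => B0; have := bb_gt0 HB n; have := bb_mu HB n.
    by rewrite B0 measure0 => -[<-]; rewrite ltxx.
  by have /andP[/le_trans/(_ (fM x))] := fM' x.
apply: le_avgq => //; rewrite EFinM -(bb_mu HB) -integral_cst; last exact: mB.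
apply: le_ge0_integral => x _; first by rewrite lee_fin powR_ge0.
have /andP[fx0 _] := fM' x.
by rewrite lee_fin ge0_ler_powR ?nnegrE// ltW.
Qed.

Lemma maxq_ge0 N f x : (0 <= maxq N f x)%R.
Proof. exact: bigmax_ge_id. Qed.

Lemma avgq_le_maxq N f x n : (n < N)%N -> B n x -> (avgq f n <= maxq N f x)%R.
Proof.
move=> nN Bx; apply: (@bigmax_sup _ _ _ _ (Ordinal nN)) => //=.
by rewrite indicE mem_set// mulr1.
Qed.

Lemma maxq_le N f x (M : R) : bounded_nneg f -> (forall x, (f x <= M)%R) ->
  (maxq N f x <= M)%R.
Proof.
move=> bf fM; have M0 : (0 <= M)%R by rewrite (le_trans _ (avgq_le 0 bf fM))// avgq_ge0.
apply: bigmax_le => // i _; rewrite indicE; case: (x \in B i); last by rewrite mulr0.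
by rewrite mulr1 avgq_le.
Qed.

Lemma maxq_gtP N f x (l : R) : (0 <= l)%R -> (l < maxq N f x)%R ->
  exists n, [/\ (n < N)%N, B n x & (l < avgq f n)%R].
Proof.
move=> l0; rewrite ltNge => H; apply: contrapT => nH; move/negP: H; apply.
apply: bigmax_le => // i _; rewrite indicE.
have [xB|] := boolP (x \in B i); last by rewrite mulr0.
rewrite mulr1 leNgt; apply/negP => li; apply: nH; exists i; split=> //.
by rewrite inE in xB.
Qed.

Lemma measurable_maxq N f : measurable_fun [set: X] (maxq N f).
Proof.
rewrite (_ : maxq N f = fun x =>
    \big[Num.max/0%R]_(n <- index_iota 0 N) (avgq f n * \1_(B n) x)%R); last first.
  by apply/funext => x; rewrite big_mkord.
elim: (index_iota 0 N) => [|n s IH].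
  by rewrite (_ : (fun _ => _) = cst 0%R)//; apply/funext => x; rewrite big_nil.
under eq_fun do rewrite big_cons.
by apply: measurable_maxr => //; exact: measurable_funM.
Qed.

(* Only the part of [f] above half the level contributes. *)
Lemma maxq_weak_type N f (l : R) : bounded_nneg f -> (0 < l)%R ->
  (l `^ q)%:E * mu [set x | (l < maxq N f x)%R] <=
  (2 * D)%:E * \int[mu]_x (f x `^ q * \1_[set x | (l < 2 * f x)%R] x)%:E.
Proof.
move=> bf l0; have [mf [M fM]] := bf.
have D0 : (0 <= D)%R by rewrite (le_trans _ (bb_D_ge2 HB)).
pose s := [seq n <- iota 0 N | (l < avgq f n)%R].
have mS : measurable [set x | (l < 2 * f x)%R].
  by apply: measurable_set_lt => //; exact: measurable_funM.
have mI : measurable_fun [set: X] (fun x => f x `^ q * \1_[set x | (l < 2 * f x)%R] x)%R.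
  apply: measurable_funM; last exact: measurable_indic.
  by apply/measurable_EFinP; exact: measurable_powq.
pose phi x := (2 * (f x `^ q * \1_[set x | (l < 2 * f x)%R] x))%:E.
have phi0 x : 0 <= phi x.
  by rewrite /phi lee_fin mulr_ge0// mulr_ge0// powR_ge0.
have mphi : measurable_fun [set: X] phi.
  by apply/measurable_EFinP; exact: measurable_funM.
have I0 x : (0 <= f x `^ q * \1_[set x | (l < 2 * f x)%R] x)%R.
  by rewrite mulr_ge0 ?powR_ge0.
have lq0 : (0 <= l `^ q)%R by exact: powR_ge0.
apply: (@le_trans _ _ ((l `^ q)%:E * mu (\big[setU/set0]_(n <- s) B n))).
  apply: lee_wpmul2l => //; apply: le_measure; rewrite ?inE.
  - by apply: measurable_set_lt => //; exact: measurable_maxq.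
  - exact: bigsetU_measurable.
  - move=> x /= /(maxq_gtP (ltW l0))[n [nN Bx ln]]; rewrite -bigcup_seq.
    by exists n => //=; rewrite mem_filter ln mem_iota.
rewrite (le_trans (weak_type HB lq0 mphi _ _))//.
- move=> n; rewrite mem_filter => /andP[ln _].
  have mn := bb_gt0 HB n.
  have H : (l `^ q * m n)%:E <= \int[mu]_(x in B n) (f x `^ q)%:E.
    by rewrite avgqE// lee_fin ler_wpM2r ?(ltW mn)// ge0_ler_powR ?nnegrE ?avgq_ge0 ?(ltW l0) ?(ltW q0) ?(ltW ln).
  have H2 : \int[mu]_(x in B n) (f x `^ q)%:E <= \int[mu]_(x in B n) (2^-1%:E * phi x + (2^-1 * l `^ q)%:E).
    apply: ge0_le_integral => //.
    - by move=> x _; rewrite lee_fin powR_ge0.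
    - by apply: measurable_funTS; exact: measurable_powq.
    - by apply: measurable_funTS; apply: emeasurable_funD => //; exact: measurable_funeM.
    - move=> x _; rewrite -EFinM -EFinD lee_fin mulKf// indicE.
      have /andP[fx0 _] := fM x.
      have [lf|fl] := ltP l (2 * f x)%R.
        by rewrite mem_set// mulr1 lerDl mulr_ge0.
      rewrite memNset/= ?mulr0 ?add0r; last by apply/negP; rewrite -leNgt.
      apply: (@le_trans _ _ ((2^-1 * l) `^ q)%R).
        by rewrite ge0_ler_powR// ?nnegrE ?(ltW q0) ?mulr_ge0 ?(ltW l0)// ler_pdivlMl.
      rewrite powRM// ?(ltW l0)// ler_wpM2r// -[leRHS]powRr1//.
      by rewrite ger_powR ?(ltW expo_gt1)// invr_gt0 ltr0n/= invf_le1// ler1n.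
  move: (le_trans H H2); rewrite ge0_integralD//; last 3 first.
  - by move=> x _; rewrite mule_ge0// lee_fin invr_ge0.
  - by apply: measurable_funTS; exact: measurable_funeM.
  - by move=> x _; rewrite lee_fin mulr_ge0.
  rewrite integral_cst// (bb_mu HB) ge0_integralZl_EFin//; last exact: measurable_funTS.
  have : 0 <= \int[mu]_(x in B n) phi x by exact: integral_ge0.
  case: (\int[mu]_(x in B n) phi x) => [r _||]//; last by move=> _ _; rewrite leey.
  rewrite -!EFinM -EFinD !lee_fin; lra.
rewrite /phi; under eq_integral do rewrite EFinM.
rewrite ge0_integralZl_EFin//; first by rewrite muleA -EFinM mulrC.
  by move=> x _; rewrite lee_fin.
exact/measurable_EFinP.
Qed.

(** Hoelder's inequality in additive form: [f] is divided by a level [tau] above its mean of order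
    [q], and a product inequality of Young type is applied pointwise. This gives the crude constant
    [K + 1] in place of a root of [K]. *)
Lemma avgq_hoelder f n (u : X -> R) (K : R) : bounded_nneg f ->
  measurable_fun [set: X] u -> (forall x, (0 <= u x)%R) -> (0 <= K)%R ->
  \int[mu]_(x in B n) (u x ^+ t.+1)%:E <= (K * m n)%:E ->
  \int[mu]_(x in B n) (u x * f x)%:E <= ((K + 1) * avgq f n * m n)%:E.
Proof.
move=> bf mu0 u0 K0 uK; have [mf [M fM]] := bf.
have mn := bb_gt0 HB n.
(* Either [w <= v ^+ t], and the product is at most the first term, or [v] is at most the [t]-th
   root of [w], and it is at most the second. *)
have young (v w : R) : (0 <= v)%R -> (0 <= w)%R -> (v * w <= v ^+ t.+1 + w `^ q)%R.
  move=> v0 w0; have [wv|vw] := leP w (v ^+ t)%R.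
    by rewrite (@le_trans _ _ (v ^+ t.+1)%R) ?lerDl ?powR_ge0// exprS ler_wpM2l.
  have {}vw : (v <= w `^ t%:R^-1)%R.
    have -> : v = ((v ^+ t) `^ t%:R^-1)%R.
      by rewrite -powR_mulrn// -powRrM divff ?powRr1// pnatr_eq0 -lt0n.
    by rewrite ge0_ler_powR ?nnegrE ?invr_ge0 ?exprn_ge0// ltW.
  rewrite (@le_trans _ _ (w `^ q)%R) ?lerDr ?exprn_ge0// /q.
  have [->|wn0] := eqVneq w 0%R; first by rewrite mulr0 powR_ge0.
  by rewrite powRD ?wn0 ?implybT// powRr1// mulrC ler_wpM2l.
(* The level has to be positive for the division, whereas [avgq f n] may vanish; [tau] tends to it
   at the end. *)
have key (tau : R) : (0 < tau)%R -> (avgq f n <= tau)%R ->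
    \int[mu]_(x in B n) (u x * f x)%:E <= ((K + 1) * tau * m n)%:E.
  move=> tau0 ftau.
  have tq0 : (0 < tau `^ q)%R by exact: powR_gt0.
  pose c := (tau / tau `^ q)%R; have c0 : (0 <= c)%R by rewrite divr_ge0 ?powR_ge0 ?ltW.
  apply: (@le_trans _ _ (\int[mu]_(x in B n) (tau%:E * (u x ^+ t.+1)%:E + c%:E * (f x `^ q)%:E))).
    apply: ge0_le_integral => //.
    - by move=> x _; have /andP[? _] := fM x; rewrite lee_fin mulr_ge0.
    - by apply: measurable_funTS; apply/measurable_EFinP; exact: measurable_funM.
    - apply: measurable_funTS; apply: emeasurable_funD; apply: measurable_funeM.
        by apply/measurable_EFinP; exact: measurable_funX.
      exact: measurable_powq.
    - move=> x _; have /andP[fx0 _] := fM x; rewrite -!EFinM -EFinD lee_fin.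
      have := young (u x) (f x / tau)%R (u0 x) (divr_ge0 fx0 (ltW tau0)).
      have -> : ((f x / tau) `^ q = f x `^ q / tau `^ q)%R.
        rewrite powRM ?invr_ge0 ?(ltW tau0)//; congr (_ * _)%R.
        by rewrite -powR_inv1 ?(ltW tau0)// -powRrM mulN1r powRN.
      move=> /(ler_wpM2l (ltW tau0)).
      rewrite (_ : (tau * (u x * (f x / tau)) = u x * f x)%R); last first.
        by field; rewrite gt_eqF.
      by move=> /le_trans; apply; rewrite mulrDr lerD2l /c mulrCA mulrC.
  rewrite ge0_integralD//; last 4 first.
  - by move=> x _; rewrite mule_ge0 ?lee_fin ?exprn_ge0// ltW.
  - apply: measurable_funTS; apply: measurable_funeM.
    by apply/measurable_EFinP; exact: measurable_funX.
  - by move=> x _; rewrite mule_ge0 ?lee_fin ?powR_ge0.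
  - by apply: measurable_funTS; apply: measurable_funeM; exact: measurable_powq.
  rewrite !ge0_integralZl_EFin ?(ltW tau0)//; last 3 first.
  - by apply: measurable_funTS; exact: measurable_powq.
  - by move=> x _; rewrite lee_fin exprn_ge0.
  - by apply: measurable_funTS; apply/measurable_EFinP; exact: measurable_funX.
  rewrite avgqE// (@le_trans _ _ (tau%:E * (K * m n)%:E + c%:E * (tau `^ q * m n)%:E))//.
    apply: leeD; first by apply: lee_wpmul2l => //; rewrite lee_fin ltW.
    apply: lee_wpmul2l => //; rewrite lee_fin ler_pM2r//.
    by rewrite ge0_ler_powR ?nnegrE ?avgq_ge0 ?(ltW q0) ?(ltW tau0).
  rewrite -!EFinM -EFinD lee_fin /c le_eqVlt; apply/orP; left; apply/eqP.
    by field; rewrite gt_eqF.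
  by move=> x _; rewrite lee_fin powR_ge0.
apply/lee_addgt0Pr => e e0; rewrite -EFinD.
pose dl := (e / ((K + 1) * m n))%R.
have K1 : (0 < (K + 1) * m n)%R by rewrite mulr_gt0// ltr_wpDl.
have dl0 : (0 < dl)%R by rewrite divr_gt0.
rewrite (le_trans (key (avgq f n + dl)%R _ _))//.
- by rewrite ltr_wpDl// avgq_ge0.
- by rewrite lerDl ltW.
- rewrite lee_fin /dl le_eqVlt; apply/orP; left; apply/eqP; field.
  by rewrite gt_eqF//= gt_eqF// ltr_wpDl.
Qed.

End PowerAverages.

Section Modular.
Context (R : realType) (d : measure_display) (X : measurableType d).
Variable mu : {measure set X -> \bar R}.
Variables (B : nat -> set X) (m : nat -> R) (P : nat -> nat) (D : R).
Hypothesis HB : ball_basis mu B m P D.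
Variables (t : nat) (k : R).
Hypotheses (t0 : (0 < t)%N) (k1 : (1 < k)%R) (kt : (k < 2 ^+ t)%R).
Local Notation q := (expo R t).

Let k0 : (0 < k)%R. Proof. exact: lt_trans k1. Qed.
Let k0w : (0 <= k)%R. Proof. exact: ltW. Qed.
Let q1 : (1 < q)%R. Proof. exact: expo_gt1. Qed.
Let q0 : (0 < q)%R. Proof. exact: lt_trans q1. Qed.
(** Ratio of the geometric series in [weight_sum]: one level down, [Theta] is divided by at least
    [2 * k] and the weight grows by at most [k] to the power [q]. It is below [1] because the [t]-th
    root of [k] is below [2], which is [kt]. *)
Let rho : R := (k `^ q / (2 * k))%R.

Let rho_bound : (0 <= rho < 1)%R.
Proof.
rewrite /rho divr_ge0 ?powR_ge0 ?mulr_ge0//= ltr_pdivrMr ?mulr_gt0// mul1r.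
rewrite /expo powRD ?gt_eqF ?implybT// powRr1// mulrC ltr_pM2r//.
have -> : (2 : R)%R = ((2 ^+ t) `^ t%:R^-1)%R.
  by rewrite -powR_mulrn// -powRrM divff ?powRr1// pnatr_eq0 -lt0n.
by rewrite gt0_ltr_powR ?nnegrE ?invr_gt0 ?ltr0n// exprn_ge0.
Qed.

(** The factor [2 * D] comes from the weak type inequality, the rest from [weight_sum]. *)
Definition modular_const : R := (2 * D * (k `^ q * (1 - rho)^-1))%R.

Lemma modular_const_gt0 : (0 < modular_const)%R.
Proof.
have /andP[_ r1] := rho_bound.
rewrite !mulr_gt0 ?powR_gt0// ?invr_gt0 ?subr_gt0//.
exact: lt_le_trans (bb_D_ge2 HB).
Qed.

Variable Theta : R -> \bar R.
Hypothesis star : starshaped Theta.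
Hypothesis nabla : forall r : R, (0 <= r)%R ->
  Theta r <= ((2 * k)^-1)%:E * Theta (k * r)%R.

Let Theta_decay (r : R) i : (0 <= r)%R ->
  Theta (r / k ^+ i)%R <= ((2 * k) ^- i)%:E * Theta r.
Proof.
move=> r0; elim: i => [|i IH]; first by rewrite !expr0 !invr1 mulr1 mul1e.
have ri : (0 <= r / k ^+ i.+1)%R by rewrite divr_ge0// exprn_ge0.
rewrite (le_trans (nabla ri))//.
have -> : (k * (r / k ^+ i.+1) = r / k ^+ i)%R.
  by rewrite exprS; field; rewrite !gt_eqF// exprn_gt0.
rewrite exprS (invfM (2 * k)%R) EFinM -muleA lee_wpmul2l// lee_fin.
by rewrite invr_ge0 mulr_ge0.
Qed.

Variable M : R.
Hypothesis M0 : (0 < M)%R.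
Let lam l : R := (M / k ^+ l)%R.
Let lam_gt0 l : (0 < lam l)%R. Proof. by rewrite divr_gt0// exprn_gt0. Qed.
Let lamS l : lam l = (k * lam l.+1)%R.
Proof. by rewrite /lam exprS; field; rewrite !gt_eqF// exprn_gt0. Qed.

Let lam_small (v : R) : (0 < v)%R -> exists l, (lam l.+1 < v)%R.
Proof.
move=> v0; have [l Hl] := expr_unbounded (M / v)%R k1; exists l.
rewrite ltr_pdivrMr ?exprn_gt0// -ltr_pdivrMl// mulrC (lt_le_trans Hl)//.
by rewrite exprS ler_peMl ?exprn_ge0// ltW.
Qed.

(** What the weak type inequality at level [lam l.+1] charges, up to the factor [2 * D], to a point
    where [f] takes the value [v]. *)
Let weight (v : R) l : R :=
  ((lam l.+1 `^ q)^-1 * (v `^ q * (lam l.+1 < 2 * v)%R%:R))%R.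

Let weight_ge0 v l : (0 <= weight v l)%R.
Proof. by rewrite !mulr_ge0 ?invr_ge0 ?powR_ge0. Qed.

(** For [v > 0], let [l0] be the first index with [lam l0.+1 < 2 * v]. Earlier weights vanish, and
    [lam l0] lies between [v] and [2 * k * v]; from there on the decay of [Theta] beats the growth
    of the weights. *)
Let weight_sum (v : R) L : (0 <= v <= M)%R ->
  \sum_(l < L) Theta (lam l) * (weight v l)%:E <=
  (k `^ q * (1 - rho)^-1)%:E * Theta (2 * k * v)%R.
Proof.
move=> /andP[v0 vM]; have /andP[r0 r1] := rho_bound.
have T0 : 0 <= Theta (2 * k * v)%R by apply: (star_ge0 star); rewrite !mulr_ge0.
have C0 : (0 <= k `^ q * (1 - rho)^-1)%R.
  by rewrite mulr_ge0 ?powR_ge0 ?invr_ge0 ?subr_ge0 ?ltW.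
have [v00|vn0] := eqVneq v 0%R.
  rewrite big1 ?mule_ge0// => l _.
  by rewrite /weight v00 mulr0 ltNge ltW//= !mulr0 mule0.
have vp : (0 < v)%R by rewrite lt_neqAle eq_sym vn0.
have [|l0 Hl0 minl0] := @ex_minnP (fun l => (lam l.+1 < 2 * v)%R).
  by apply: lam_small; rewrite mulr_gt0.
have lamv : (v <= lam l0)%R.
  case: l0 Hl0 minl0 => [|l0] Hl0 minl0; first by rewrite /lam expr0 divr1.
  have : ~~ (lam l0.+1 < 2 * v)%R.
    by apply/negP => /minl0; rewrite ltnn.
  by rewrite -leNgt => /(le_trans _); apply; rewrite ler_peMl// ler1n.
have lamk i : lam (l0 + i)%N = (lam l0 / k ^+ i)%R.
  by rewrite /lam exprD; field; rewrite !gt_eqF ?exprn_gt0.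
have term i : Theta (lam (l0 + i)%N) * (weight v (l0 + i)%N)%:E <=
    (k `^ q * rho ^+ i)%:E * Theta (2 * k * v)%R.
  have T1 : Theta (lam (l0 + i)%N) <= ((2 * k) ^- i)%:E * Theta (2 * k * v)%R.
    rewrite lamk (le_trans (Theta_decay _ (ltW (lam_gt0 _))))//.
    rewrite lee_wpmul2l ?lee_fin ?invr_ge0 ?exprn_ge0 ?mulr_ge0//.
    rewrite (star_mono star) ?(ltW (lam_gt0 _))// lamS.
    by rewrite (mulrC 2%R) -mulrA ler_pM2l// ltW.
  have W1 : (weight v (l0 + i)%N <= k `^ q * (k `^ q) ^+ i)%R.
    have W2 : (weight v (l0 + i)%N <= (lam (l0 + i).+1 `^ q)^-1 * v `^ q)%R.
      rewrite /weight; apply: ler_wpM2l; first by rewrite invr_ge0 powR_ge0.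
      by rewrite ler_piMr ?powR_ge0// lern1; case: (_ < _)%R.
    apply: (le_trans W2); rewrite mulrC ler_pdivrMr ?powR_gt0//.
    have -> : ((k `^ q) ^+ i = (k ^+ i) `^ q)%R.
      by rewrite -[LHS]powR_mulrn ?powR_ge0// -powRrM mulrC powRrM powR_mulrn.
    have ki0 : (0 <= k ^+ i)%R by exact: exprn_ge0.
    have lw : (0 <= lam (l0 + i).+1)%R by exact: ltW.
    have kki := mulr_ge0 k0w ki0.
    rewrite -(powRM _ k0w ki0) -(powRM _ kki lw).
    apply: ge0_ler_powR; rewrite ?nnegrE ?(ltW q0)//; first exact: mulr_ge0.
    by rewrite mulrAC -lamS lamk divfK ?gt_eqF ?exprn_gt0.
  apply: (@le_trans _ _ (((2 * k) ^- i)%:E * Theta (2 * k * v)%R * (k `^ q * (k `^ q) ^+ i)%:E)).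
    apply: lee_pmul; rewrite ?lee_fin ?weight_ge0//.
    by apply: (star_ge0 star); exact: ltW.
  rewrite muleAC -EFinM lee_wpmul2r// lee_fin /rho expr_div_n.
  by rewrite mulrC -mulrA.
have zero l : (l < l0)%N -> Theta (lam l) * (weight v l)%:E = 0.
  move=> ll; rewrite /weight.
  have [/minl0|_] := boolP (lam l.+1 < 2 * v)%R; first by rewrite leqNgt ll.
  by rewrite !mulr0 mule0.
apply: (@le_trans _ _ (\sum_(0 <= i < L) (k `^ q * rho ^+ i)%:E * Theta (2 * k * v)%R)).
  rewrite -(big_mkord xpredT (fun l => Theta (lam l) * (weight v l)%:E)).
  have [Ll|lL] := leqP L l0.
    rewrite big_nat_cond big1; last first.
      by move=> i /andP[/andP[_ iL] _]; rewrite zero// (leq_trans iL).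
    apply: sume_ge0 => i _; rewrite mule_ge0// lee_fin mulr_ge0 ?powR_ge0 ?exprn_ge0//.
  rewrite (big_cat_nat (leq0n l0) (ltnW lL))//= [X in X + _]big_nat_cond big1; last first.
    by move=> i /andP[/andP[_ iL] _]; rewrite zero.
  rewrite add0e -{1}[l0]add0n big_addn.
  apply: (@le_trans _ _ (\sum_(0 <= i < L - l0) (k `^ q * rho ^+ i)%:E * Theta (2 * k * v)%R)).
    by apply: lee_sum => i _; rewrite addnC.
  apply: lee_sum_nneg_natr => [i _ _|]; last exact: leq_subr.
  by rewrite mule_ge0// lee_fin mulr_ge0 ?powR_ge0 ?exprn_ge0.
rewrite -ge0_sume_distrl; last first.
  by move=> i _; rewrite lee_fin mulr_ge0 ?powR_ge0 ?exprn_ge0.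
rewrite lee_wpmul2r// sumEFin lee_fin -mulr_sumr ler_wpM2l ?powR_ge0//.
by rewrite big_mkord sum_geometric_le// r0.
Qed.

(** A discrete layer cake formula: [Theta (g x)] is at most the sum of the [Theta (lam l)] over the
    levels with [lam l.+1 < g x]. The weak type inequality replaces the measure of each level set by
    an integral of [weight (f x) l], and the sum is then taken under the integral. *)
Lemma modular_maxq N (f : X -> R) : measurable_fun [set: X] f ->
  (forall x, (0 <= f x <= M)%R) ->
  \int[mu]_x Theta (maxq mu B m t N f x) <=
  modular_const%:E * \int[mu]_x Theta (2 * k * f x)%R.
Proof.
move=> mf fM; have bf : bounded_nneg f by split=> //; exists M.
set g := maxq mu B m t N f.
have mg : measurable_fun [set: X] g by exact: (measurable_maxq HB).
have g0 x : (0 <= g x)%R by exact: maxq_ge0.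
have gM x : (g x <= M)%R by apply: (maxq_le HB) => // y; case/andP: (fM y).
have mlev l : measurable [set x | (lam l.+1 < g x)%R] by exact: measurable_set_lt.
have mT : measurable_fun [set: X] (fun x => Theta (2 * k * f x)%R).
  apply: star_measurable_comp => //; first exact: measurable_funM.
  by move=> x; rewrite !mulr_ge0//; case/andP: (fM x).
have T0 l : 0 <= Theta (lam l) by apply: (star_ge0 star); exact: ltW.
have D0 : (0 <= 2 * D)%R by rewrite mulr_ge0// (le_trans _ (bb_D_ge2 HB)).
have pt x : Theta (g x) <= \sum_(l <oo) Theta (lam l) * (\1_[set x | (lam l.+1 < g x)%R] x)%:E.
  have tm l : 0 <= Theta (lam l) * (\1_[set x | (lam l.+1 < g x)%R] x)%:E.
    by rewrite mule_ge0// lee_fin.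
  have [gx0|gxn] := eqVneq (g x) 0%R.
    by rewrite gx0 (star0 star); exact: nneseries_ge0.
  have gxp : (0 < g x)%R by rewrite lt_neqAle eq_sym gxn g0.
  have [|l0 Hl0 minl0] := @ex_minnP (fun l => (lam l.+1 < g x)%R).
    exact: lam_small.
  have gl : (g x <= lam l0)%R.
    case: l0 Hl0 minl0 => [|l0] Hl0 minl0; first by rewrite /lam expr0 divr1.
    by rewrite leNgt; apply/negP => /minl0; rewrite ltnn.
  apply: le_trans (nneseries_lim_ge l0.+1 _) => //.
  rewrite big_mkord big_ord_recr/= indicE mem_set// mule1 (le_trans (star_mono star (g0 x) gl))//.
  by rewrite leeDr//; apply: sume_ge0.
apply: (@le_trans _ _ (\int[mu]_x \sum_(l <oo) Theta (lam l) * (\1_[set x | (lam l.+1 < g x)%R] x)%:E)).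
  apply: ge0_le_integral => //.
  - by move=> x _; exact: (star_ge0 star).
  - exact: star_measurable_comp.
  - apply: ge0_emeasurable_sum => [l x _ _|l _]; first by rewrite mule_ge0// lee_fin.
    by apply: measurable_funeM; apply/measurable_EFinP; exact: measurable_indic.
have mv l : measurable_fun [set: X]
    (fun x => (f x `^ q * (lam l.+1 < 2 * f x)%R%:R)%:E).
  have mS : measurable [set x | (lam l.+1 < 2 * f x)%R].
    by apply: measurable_set_lt => //; exact: measurable_funM.
  rewrite (_ : (fun x => _) = fun x =>
      (f x `^ q * \1_[set x | (lam l.+1 < 2 * f x)%R] x)%:E); last first.
    apply/funext => x; rewrite indicE; congr (_ * _)%:E%R.
    by have [H|H] := boolP (lam l.+1 < 2 * f x)%R; [rewrite mem_set|rewrite memNset//=; exact/negP].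
  apply/measurable_EFinP; apply: measurable_funM => //.
  by apply/measurable_EFinP; exact: measurable_powq.
have mw l : measurable_fun [set: X] (fun x => (weight (f x) l)%:E).
  rewrite /weight; under eq_fun do rewrite EFinM.
  exact: measurable_funeM.
rewrite integral_nneseries//; last 2 first.
- move=> l; apply: measurable_funeM; apply/measurable_EFinP; exact: measurable_indic.
- by move=> l x _; rewrite mule_ge0// lee_fin.
apply: (@le_trans _ _ (\sum_(l <oo) \int[mu]_x ((2 * D)%:E * (Theta (lam l) * (weight (f x) l)%:E)))).
  apply: lee_nneseries => [l _ _|l _].
    by apply: integral_ge0 => x _; rewrite mule_ge0// lee_fin.
  rewrite ge0_integralZl//; last first.
    by apply/measurable_EFinP; exact: measurable_indic.
  rewrite integral_indic// setIT.
  have := @maxq_weak_type _ _ _ mu B m P D HB t t0 N f (lam l.+1) bf (lam_gt0 _).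
  rewrite -lee_pdivlMl ?powR_gt0// => H.
  rewrite ge0_integralZl//; last 2 first.
  - exact: measurable_funeM.
  - by move=> x _; rewrite mule_ge0// lee_fin weight_ge0.
  rewrite ge0_integralZl//; last by move=> x _; rewrite lee_fin weight_ge0.
  rewrite muleCA; apply: lee_wpmul2l => //; apply: (le_trans H).
  rewrite /weight; under [in leRHS]eq_integral do rewrite EFinM.
  rewrite ge0_integralZl_EFin ?invr_ge0 ?powR_ge0//; last first.
    by move=> x _; rewrite lee_fin mulr_ge0 ?powR_ge0.
  rewrite muleCA le_eqVlt; apply/orP; left; apply/eqP.
  congr (_ * (_ * _)); apply: eq_integral => x _; rewrite indicE.
  by have [HH|HH] := boolP (lam l.+1 < 2 * f x)%R; [rewrite mem_set|rewrite memNset//=; exact/negP].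
rewrite -integral_nneseries//; last 2 first.
- by move=> l; do 2 apply: measurable_funeM.
- by move=> l x _; rewrite !mule_ge0// lee_fin weight_ge0.
rewrite -ge0_integralZl_EFin//; last 2 first.
- by move=> x _; apply: (star_ge0 star); rewrite !mulr_ge0//; case/andP: (fM x).
- exact: (ltW modular_const_gt0).
apply: ge0_le_integral => //.
- by move=> x _; apply: nneseries_ge0 => l _ _; rewrite !mule_ge0// lee_fin weight_ge0.
- apply: ge0_emeasurable_sum => [l x _ _|l _]; first by rewrite !mule_ge0// lee_fin weight_ge0.
  by do 2 apply: measurable_funeM.
- exact: measurable_funeM.
- move=> x _; rewrite nneseriesZl; last by move=> l _; rewrite mule_ge0// lee_fin weight_ge0.
  have -> : modular_const%:E = (2 * D)%:E * (k `^ q * (1 - rho)^-1)%:E by rewrite -EFinM.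
  rewrite -muleA; apply: lee_wpmul2l => //.
  apply: lime_le; first by apply: is_cvg_nneseries => l _ _; rewrite mule_ge0// lee_fin weight_ge0.
  apply: nearW => L; rewrite big_mkord; exact: weight_sum.
Qed.

End Modular.

(** * Young functions and dyadic scales *)

Section YoungInverse.
Context (R : realType) (Phi : R -> \bar R).

Lemma young_starshaped : young Phi -> starshaped Phi.
Proof.
move=> H; split; [exact: young0 H|exact: young_ge0 H|move=> c r c01 r0].
have := young_convex H (lexx 0%R) r0 c01.
by rewrite mulr0 add0r (young0 H) mule0 add0e.
Qed.

Hypothesis HY : youngY Phi.
Let star : starshaped Phi. Proof. by apply: young_starshaped; case: HY. Qed.

Lemma youngY_fin r : (0 <= r)%R -> Phi r \is a fin_num.
Proof.
rewrite le_eqVlt => /predU1P[<-|r0]; first by rewrite (star0 star).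
by rewrite ge0_fin_numE ?(star_ge0 star) ?ltW//; case/andP: (HY.2 _ r0).
Qed.

(** At positive reals the generalized inverse is positive and finite, so that [fine] loses nothing
    there. *)
Definition yinv (s : R) : R := fine (young_inv Phi s%:E).

Let p1 : R := fine (Phi 1%R).
Let Phi1 : Phi 1%R = p1%:E. Proof. by rewrite fineK// youngY_fin. Qed.
Let p1_gt0 : (0 < p1)%R.
Proof. by rewrite -lte_fin -Phi1; case/andP: (HY.2 _ ltr01). Qed.

Let yinv_bounds (s : R) : (0 < s)%R ->
  exists2 u : R, (0 < u)%R & young_inv Phi s%:E = u%:E.
Proof.
move=> s0; set I := young_inv Phi s%:E.
have up : I <= (s / p1 + 1)%:E.
  apply: ereal_inf_lbound; exists (s / p1 + 1)%R => //; split.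
    by rewrite addr_ge0// divr_ge0// ltW.
  have c1 : (1 <= s / p1 + 1)%R by rewrite lerDr divr_ge0// ltW.
  have := star_dilate star c1 ler01; rewrite mulr1 Phi1 => /(lt_le_trans _); apply.
  by rewrite -EFinM lte_fin mulrDl divfK ?gt_eqF// mul1r ltrDl.
pose c := Num.min 1%R (s / p1)%R.
have c0 : (0 < c)%R by rewrite lt_min ltr01 divr_gt0.
have lo : c%:E <= I.
  apply: le_ereal_inf_tmp => _ [r [r0 sr] <-]; rewrite lee_fin leNgt; apply/negP.
  rewrite lt_min => /andP[r1 rs]; move: sr; rewrite ltNge => /negP; apply.
  have := star_shrink star (c := r) (r := 1%R); rewrite mulr1 r0 ltW// Phi1 => /(_ isT ler01) /le_trans; apply.
  by rewrite -EFinM lee_fin -ler_pdivlMr// ltW.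
move: up lo; case: I => [u||]//; rewrite !lee_fin => _ cu.
by exists u => //; exact: lt_le_trans cu.
Qed.

Lemma yinvE s : (0 < s)%R -> young_inv Phi s%:E = (yinv s)%:E.
Proof. by move=> /yinv_bounds[u _ Hu]; rewrite /yinv Hu. Qed.

Lemma yinv_gt0 s : (0 < s)%R -> (0 < yinv s)%R.
Proof. by move=> /yinv_bounds[u u0 Hu]; rewrite /yinv Hu. Qed.

Lemma le_yinv u s : (0 < s)%R -> (0 <= u)%R -> Phi u <= s%:E -> (u <= yinv s)%R.
Proof.
move=> s0 u0 us; rewrite -lee_fin -yinvE//.
apply: le_ereal_inf_tmp => _ [r [r0 sr] <-]; rewrite lee_fin leNgt; apply/negP => ru.
have := lt_le_trans sr (star_mono star r0 (ltW ru)).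
by rewrite ltNge us.
Qed.

(** An argument strictly below the infimum is not among those where [Phi] exceeds [s]. The
    strictness is paid for by factors [2] in later constants. *)
Lemma lt_yinv u s : (0 < s)%R -> (0 <= u)%R -> (u < yinv s)%R -> Phi u <= s%:E.
Proof.
move=> s0 u0; rewrite -lte_fin -yinvE// leNgt => us; apply/negP => su.
move: us; rewrite ltNge => /negP; apply.
by apply: ereal_inf_lbound; exists u.
Qed.

Lemma yinv_scale (C s : R) : (0 < s)%R -> (1 <= C)%R ->
  (yinv (C * s) <= C * yinv s)%R.
Proof.
move=> s0 C1; have C0 : (0 < C)%R by exact: lt_le_trans C1.
rewrite -ler_pdivrMl// -lee_fin -(yinvE s0).
apply: le_ereal_inf_tmp => _ [r [r0 sr] <-]; rewrite lee_fin ler_pdivrMl//.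
rewrite -lee_fin -yinvE ?mulr_gt0//; apply: ereal_inf_lbound.
exists (C * r)%R => //; split; first by rewrite mulr_ge0// ltW.
rewrite (lt_le_trans _ (star_dilate star C1 r0))// EFinM lte_pmul2l//.
Qed.

Lemma yinv_mono (s s' : R) : (0 < s)%R -> (s <= s')%R -> (yinv s <= yinv s')%R.
Proof.
move=> s0 ss'; have s'0 := lt_le_trans s0 ss'.
rewrite -lee_fin -!yinvE//; apply: le_ereal_inf_tmp => _ [r [r0 sr] <-].
apply: ereal_inf_lbound; exists r => //; split=> //.
by rewrite (le_lt_trans _ sr)// lee_fin.
Qed.

End YoungInverse.

Section Dyadic.
Context (R : realType).

Definition dy (j : int) : R := (2 ^ j)%R.

Lemma dy_gt0 j : (0 < dy j)%R. Proof. by rewrite exprz_gt0. Qed.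
Lemma dy_ge0 j : (0 <= dy j)%R. Proof. exact/ltW/dy_gt0. Qed.

Lemma dyDn j (n : nat) : dy (j + n%:Z) = (dy j * 2 ^+ n)%R.
Proof. by rewrite /dy expfzDr ?pnatr_eq0. Qed.

(** The base is left free: sufficiency uses powers of [2], necessity powers of a base adapted to the
    homogeneity constant. *)
Lemma exprz_scale (M x : R) : (1 < M)%R -> (0 < x)%R ->
  exists j : int, (M ^ j <= x < M ^ (j + 1))%R.
Proof.
move=> M1 x0; have M0 : (0 < M)%R by exact: lt_trans M1.
have [l Hl] := expr_unbounded (x^-1)%R M1.
have [l' Hl'] := expr_unbounded x M1.
have Ml (i : nat) : (M ^ (i%:Z - l%:Z) = M ^+ i / M ^+ l)%R.
  by rewrite expfzDr ?gt_eqF// -exprnN.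
have lx : (M ^- l < x)%R by rewrite invf_plt ?posrE ?exprn_gt0.
have [|i Hi mini] := @ex_minnP (fun i => (x < M ^ (i%:Z - l%:Z))%R).
  by exists (l' + l)%N; rewrite Ml exprD mulfK ?gt_eqF ?exprn_gt0.
case: i Hi mini => [|i] Hi mini.
  by move: Hi; rewrite Ml expr0 mul1r ltNge ltW.
exists (i%:Z - l%:Z)%R; apply/andP; split.
  by rewrite leNgt; apply/negP => /mini; rewrite ltnn.
by move: Hi; rewrite intS -addrA addrC.
Qed.

Lemma dy_scale (x : R) : (0 < x)%R -> exists j, (dy j <= x < dy (j + 1))%R.
Proof. by apply: exprz_scale; rewrite ltr1n. Qed.

Lemma sum_reindex_le (s : seq nat) (g : nat -> nat) (F : nat -> R) (L : nat) :
  uniq s -> {in s &, injective g} -> (forall n, n \in s -> (g n < L)%N) ->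
  (forall i, (0 <= F i)%R) -> (\sum_(n <- s) F (g n) <= \sum_(i < L) F i)%R.
Proof.
move=> us ig gL F0; rewrite -(big_map g xpredT F) -(big_mkord xpredT F).
have um : uniq (map g s) by rewrite map_inj_in_uniq.
rewrite [leRHS](bigID (mem (map g s)))/= -[leLHS]addr0 lerD ?sumr_ge0//.
rewrite le_eqVlt; apply/orP; left; rewrite -[X in _ == X]big_filter; apply/eqP.
apply: perm_big.
apply: uniq_perm => //; first by rewrite filter_uniq// iota_uniq.
move=> i; rewrite mem_filter mem_index_iota/=; apply/idP/idP => [im|/andP[]//].
by rewrite im/=; case/mapP: im => n /gL nL ->.
Qed.

End Dyadic.

(** * Hedberg's inequality *)

Section Hedberg.
Context (R : realType).
Variables (Q alpha : R) (Phi Psi : R -> \bar R).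
Hypotheses (a0 : (0 < alpha)%R) (Q0 : (0 < Q)%R).
Hypotheses (HPhi : youngY Phi) (HPsi : youngY Psi).

Definition tail_term (j : int) : R :=
  (dy R j `^ alpha * yinv Phi (dy R j `^ (- Q)))%R.

Let dyQ_gt0 j : (0 < dy R j `^ (- Q))%R.
Proof. by rewrite powR_gt0// dy_gt0. Qed.

Lemma tail_term_gt0 j : (0 < tail_term j)%R.
Proof. by rewrite mulr_gt0// ?yinv_gt0// powR_gt0// dy_gt0. Qed.

(** On each dyadic interval the integrand is bounded below factor by factor: the logarithmic factor
    by [1], the inverse function and [1 / t] by their values at the right end, the power of [t] by
    its value at the left end. The loss is [kap]. *)
Lemma cond_sufficient_dyadic : cond_sufficient Q alpha Phi Psi ->
  exists2 C : R, (0 < C)%R & forall (J : int) (L : nat),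
    (tail_term J <= C * yinv Psi (dy R J `^ (- Q)))%R /\
    (\sum_(i < L) tail_term (J + 1 + i%:Z) <= C * yinv Psi (dy R J `^ (- Q)))%R.
Proof.
move=> [C C0 HC]; pose kap := (2 `^ (- alpha) / 2 : R)%R.
have kap0 : (0 < kap)%R by rewrite divr_gt0// powR_gt0.
exists (C * (1 + kap^-1))%R => [|J L].
  by rewrite mulr_gt0// addr_gt0// invr_gt0.
set y := yinv Psi _; have y0 : (0 < y)%R by exact: yinv_gt0.
have dJ : (0 < dy R J)%R by exact: dy_gt0.
have := HC _ dJ; rewrite /frac_inv !(yinvE HPsi)// !(yinvE HPhi)// -!EFinM -/y.
rewrite -/(tail_term J) => H.
have T0 : 0 <= (tail_term J)%:E by rewrite lee_fin ltW// tail_term_gt0.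
pose I (i : nat) := `]dy R (J + i%:Z), dy R (J + 1 + i%:Z)]%classic : set R.
pose c (i : nat) := (yinv Phi (dy R (J + 1 + i%:Z) `^ (- Q)) *
   (dy R (J + i%:Z) `^ alpha / dy R (J + 1 + i%:Z)))%R.
have c0 i : (0 <= c i)%R.
  by rewrite mulr_ge0 ?ltW ?yinv_gt0// divr_gt0 ?powR_gt0// dy_gt0.
have dyS i : dy R (J + 1 + i%:Z) = (2 * dy R (J + i%:Z))%R.
  by rewrite addrAC (dyDn _ _ 1) expr1 mulrC.
have nd i j : (i <= j)%N -> (dy R (J + i%:Z) <= dy R (J + j%:Z))%R.
  by move=> ij; rewrite !dyDn ler_pM2l// ler_weXn2l// ler1n.
have nd' i : (dy R J <= dy R (J + i%:Z))%R by have := nd _ _ (leq0n i); rewrite addr0.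
have tail_ge0 t : (dy R J < t)%R -> 0 <= (1 + ln (t / dy R J))%:E *
     young_inv Phi (t `^ (- Q))%:E * (t `^ alpha / t)%:E.
  move=> Jt; have tp : (0 < t)%R by exact: lt_trans Jt.
  rewrite (yinvE HPhi) ?powR_gt0// -!EFinM lee_fin mulr_ge0//.
    by rewrite mulr_ge0 ?ltW ?yinv_gt0 ?powR_gt0// addr_gt0// ln_gt0// ltr_pdivlMr// mul1r.
  by rewrite divr_ge0 ?powR_ge0// ltW.
have tail : (\sum_(i < L) kap * tail_term (J + 1 + i%:Z))%R%:E <= log_tail Q alpha Phi (dy R J).
  rewrite /log_tail.
  apply: (@le_trans _ _ (\int[lebesgue_measure]_(t in `]dy R J, +oo[) \sum_(i < L) ((c i)%:E * (\1_(I i) t)%:E))); last first.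
    apply: le_ge0_integral => t /=; rewrite in_itv/= andbT => Jt.
      by apply: sume_ge0 => i _; rewrite mule_ge0// lee_fin.
    have tp : (0 < t)%R by exact: lt_trans Jt.
    have [[i Ii]|nI] := pselect (exists i : 'I_L, I i t); last first.
      rewrite big1 ?tail_ge0// => i _; rewrite indicE memNset ?mule0//.
      by move=> Ii; apply: nI; exists i.
    rewrite (bigD1 i)//= big1 ?adde0; last first.
      move=> j ji; rewrite indicE memNset ?mule0// => Ij.
      move: Ii Ij; rewrite /I /= !in_itv/= => /andP[i1 i2] /andP[j1 j2].
      have [ij|ij|/val_inj ij] := ltngtP i j.
      - have ji' : (dy R (J + 1 + i%:Z) <= dy R (J + j%:Z))%R by rewrite -addrA -intS nd.
        by have := le_lt_trans i2 (le_lt_trans ji' j1); rewrite ltxx.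
      - have ij' : (dy R (J + 1 + j%:Z) <= dy R (J + i%:Z))%R by rewrite -addrA -intS nd.
        by have := le_lt_trans j2 (le_lt_trans ij' i1); rewrite ltxx.
      - by rewrite ij eqxx in ji.
    rewrite indicE mem_set// mule1 (yinvE HPhi) ?powR_gt0// -!EFinM lee_fin.
    move: Ii; rewrite /I /= in_itv/= => /andP[i1 i2].
    apply: ler_pM => //; first by rewrite ltW ?yinv_gt0.
    - by rewrite divr_ge0 ?powR_ge0 ?dy_ge0.
    - rewrite (@le_trans _ _ (1 * yinv Phi (t `^ (- Q)))%R)//.
        rewrite mul1r; apply: yinv_mono => //.
        rewrite !powRN lef_pV2 ?posrE ?powR_gt0 ?dy_gt0//.
        by rewrite ge0_ler_powR ?nnegrE ?(ltW Q0) ?(ltW tp) ?dy_ge0.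
      rewrite ler_wpM2r ?ltW ?yinv_gt0 ?powR_gt0// ltrDl ln_gt0// ltr_pdivlMr// mul1r//.
    - apply: ler_pM; rewrite ?powR_ge0 ?invr_ge0 ?dy_ge0//.
        by rewrite ge0_ler_powR ?nnegrE ?(ltW a0) ?(ltW tp) ?dy_ge0 ?(ltW i1).
      by rewrite lef_pV2 ?posrE ?dy_gt0.
  have mI i : measurable (I i) by exact: measurable_itv.
  rewrite ge0_integral_sum//; last 2 first.
  - by move=> i; apply: measurable_funeM; apply/measurable_EFinP; apply: measurable_indic; exact: mI.
  - by move=> i t _; rewrite mule_ge0// lee_fin.
  rewrite -sumEFin; apply: lee_sum => i _.
  rewrite ge0_integralZl ?lee_fin//; last first.
    by apply/measurable_EFinP; apply: measurable_indic; exact: mI.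
  rewrite integral_indic//; last exact: mI.
  have -> : I i `&` `]dy R J, +oo[ = I i.
    apply/setIidPl => t; rewrite /I /= !in_itv/= andbT => /andP[t1 _].
    exact: le_lt_trans t1.
  rewrite /I/= lebesgue_measure_itv/= lte_fin dyS ifT; last first.
    by rewrite ltr_pMl ?dy_gt0// ltr1n.
  rewrite -EFinD -EFinM lee_fin /c /tail_term /kap dyS.
  have dd := dy_gt0 R (J + i%:Z).
  rewrite (powRM _ (ler0n R 2) (ltW dd)) powRN le_eqVlt; apply/orP; left; apply/eqP.
  by field; rewrite !gt_eqF// powR_gt0.
have ge0tail : 0 <= log_tail Q alpha Phi (dy R J).
  by apply: integral_ge0 => t /=; rewrite in_itv/= andbT; exact: tail_ge0.
split.
  have := le_trans (leeDl _ ge0tail) H; rewrite lee_fin => /le_trans; apply.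
  by rewrite ler_wpM2r ?(ltW y0)// ler_peMr ?(ltW C0)// lerDl invr_ge0 ltW.
have := le_trans tail (le_trans (leeDr _ T0) H); rewrite lee_fin -mulr_sumr.
rewrite -ler_pdivlMl// => /le_trans; apply.
rewrite mulrA (mulrC _ C) ler_wpM2r ?(ltW y0)// ler_wpM2l ?(ltW C0)//.
by rewrite lerDr.
Qed.

(* With [J] such that [Phi M] is about [2 ^ (- J * Q)], the scales up to [J] are
   estimated through [a n <= M] and sum up geometrically; the larger ones are
   estimated through [Phi (a n)] and sum up by the integral condition. *)
Lemma hedberg (c : R) : (1 <= c)%R -> cond_sufficient Q alpha Phi Psi ->
  exists2 C : R, (0 < C)%R & forall (s : seq nat) (sg : nat -> int)
    (a : nat -> R) (M : R), (0 <= M)%R -> uniq s -> {in s &, injective sg} ->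
    (forall n, n \in s -> (0 <= a n <= M)%R) ->
    (forall n, n \in s -> Phi (a n) <= (c * dy R (sg n) `^ (- Q))%:E) ->
    Psi ((\sum_(n <- s) dy R (sg n) `^ alpha * a n) / C)%R <= Phi M.
Proof.
move=> c1 /cond_sufficient_dyadic[C C0 HC].
have c0 : (0 < c)%R by exact: lt_le_trans c1.
have [HPhi1 _] := HPhi; have starPhi := young_starshaped HPhi1.
have [HPsi1 _] := HPsi; have starPsi := young_starshaped HPsi1.
pose rho : R := (2 `^ (- alpha))%R.
have rho_b : (0 <= rho < 1)%R.
  rewrite powR_ge0/= /rho powRN invf_lt1 ?powR_gt0//.
  rewrite -[ltLHS](congr1 (fun h => h alpha) (powR1 R)).
  by rewrite gt0_ltr_powR ?nnegrE// ltr1n.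
have [rho0 rho1] := andP rho_b.
have r1 : (0 < (1 - rho)^-1)%R by rewrite invr_gt0 subr_gt0.
have Q1 : (1 <= 2 `^ Q :> R)%R by rewrite -[leLHS](powRr0 2%R) ler_powR ?ler1n// ltW.
(* The summands come from the scales up to [J] and from those beyond; the factor [2] in [2 * K]
   gives the strict inequality that [lt_yinv] requires. *)
pose K := ((1 - rho)^-1 * (2 `^ Q * C) + c * C)%R.
have K0 : (0 < K)%R by rewrite addr_gt0// !mulr_gt0// powR_gt0.
exists (2 * K)%R => [|s sg a M M0 us isg aM aPhi]; first by rewrite mulr_gt0.
have [Mz|Mn0] := eqVneq M 0%R.
  rewrite big_seq big1 ?mul0r ?(star0 starPsi) ?(star_ge0 starPhi)// => n ns.
  have := aM _ ns; rewrite Mz => an; have -> : a n = 0%R by apply/le_anti; rewrite andbC.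
  by rewrite mulr0.
have Mp : (0 < M)%R by rewrite lt_neqAle eq_sym Mn0.
pose w := fine (Phi M).
have PhiM : Phi M = w%:E by rewrite fineK// youngY_fin.
have w0 : (0 < w)%R by rewrite -lte_fin -PhiM; case/andP: (HPhi.2 _ Mp).
(* The critical radius, whose power of exponent [- Q] is [Phi M]; [dy R J] is the first dyadic
   number above it, whence [lo] and [hi]. *)
have x0 : (0 < w `^ (- Q^-1))%R by exact: powR_gt0.
have [J0 /andP[J1 J2]] := dy_scale x0.
have wE : ((w `^ (- Q^-1)) `^ (- Q) = w)%R.
  by rewrite -powRrM mulrNN mulVf ?gt_eqF// powRr1// ltW.
set J := (J0 + 1)%R in J2.
have dJ := dy_gt0 R J; have dJ0 := dy_gt0 R J0.
have lo : (dy R J `^ (- Q) <= w)%R.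
  rewrite -[leRHS]wE !(powRN _ Q) lef_pV2 ?posrE ?powR_gt0//.
  by rewrite ge0_ler_powR ?nnegrE ?(ltW Q0) ?(ltW x0) ?dy_ge0 ?(ltW J2).
have hi : (w <= 2 `^ Q * dy R J `^ (- Q))%R.
  rewrite /J (dyDn _ _ 1) expr1 (powRM _ (ltW dJ0) (ler0n R 2)) mulrCA -powRD ?pnatr_eq0 ?implybT//.
  rewrite subrr powRr0 mulr1 -[leLHS]wE !(powRN _ Q) lef_pV2 ?posrE ?powR_gt0//.
  by rewrite ge0_ler_powR ?nnegrE ?(ltW Q0) ?(ltW x0) ?dy_ge0.
set y := yinv Psi (dy R J `^ (- Q)).
have y0 : (0 < y)%R by exact: yinv_gt0.
have nearM : (dy R J `^ alpha * M <= 2 `^ Q * C * y)%R.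
  have MQ : (M <= 2 `^ Q * yinv Phi (dy R J `^ (- Q)))%R.
    rewrite (le_trans _ (yinv_scale HPhi _ Q1))//.
    apply: (@le_trans _ _ (yinv Phi w)); first by apply: le_yinv => //; rewrite PhiM.
    exact: yinv_mono.
  rewrite -mulrA (le_trans (ler_wpM2l (powR_ge0 _ _) MQ))// mulrCA.
  by rewrite ler_wpM2l ?powR_ge0//; case: (HC J 0%N).
pose g1 n := absz (J - sg n)%R; pose g2 n := absz (sg n - (J + 1))%R.
have near : (\sum_(n <- s | sg n <= J) dy R (sg n) `^ alpha * a n <=
    (1 - rho)^-1 * (2 `^ Q * C * y))%R.
  rewrite -big_filter; set s1 := [seq n <- s | _].
  have s1P n : n \in s1 -> n \in s /\ sg n = (J - (g1 n)%:Z)%R.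
    rewrite mem_filter => /andP[nJ ns]; split=> //.
    by rewrite /g1 gez0_abs ?subr_ge0// opprB addrC subrK.
  apply: (@le_trans _ _ (\sum_(n <- s1) (2 `^ Q * C * y) * rho ^+ g1 n)%R).
    rewrite [leLHS]big_seq [leRHS]big_seq; apply: ler_sum => n ns1.
    have [ns sgn] := s1P _ ns1; have /andP[an0 anM] := aM _ ns.
    have dyn : (dy R (sg n) `^ alpha = dy R J `^ alpha * rho ^+ g1 n)%R.
      have -> : dy R J = (dy R (sg n) * 2 ^+ g1 n)%R by rewrite -dyDn sgn subrK.
      rewrite powRM ?dy_ge0 ?exprn_ge0// -[(2 ^+ g1 n)%R]powR_mulrn//.
      rewrite -[(rho ^+ _)%R]powR_mulrn// -mulrA /rho -!powRrM -powRD ?pnatr_eq0 ?implybT//.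
      by rewrite mulNr (mulrC alpha) subrr powRr0 mulr1.
    rewrite dyn mulrAC ler_wpM2r ?exprn_ge0// (le_trans _ nearM)//.
    by rewrite ler_wpM2l ?powR_ge0.
  rewrite -mulr_sumr mulrC ler_wpM2r ?mulr_ge0 ?powR_ge0 ?(ltW C0) ?(ltW y0)//.
  pose L := (\max_(n <- s1) g1 n).+1.
  rewrite (le_trans _ (sum_geometric_le L rho_b))//.
  apply: sum_reindex_le => //.
  - exact: filter_uniq.
  - move=> n l /s1P[ns nE] /s1P[ls lE] gg; apply: isg => //.
    by rewrite nE lE gg.
  - by move=> n ns; rewrite ltnS leq_bigmax_seq.
  - by move=> i; exact: exprn_ge0.
have far : (\sum_(n <- s | ~~ (sg n <= J)%R) dy R (sg n) `^ alpha * a n <= c * (C * y))%R.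
  rewrite -big_filter; set s1 := [seq n <- s | _].
  have s1P n : n \in s1 -> n \in s /\ sg n = (J + 1 + (g2 n)%:Z)%R.
    rewrite mem_filter -ltNge => /andP[nJ ns]; split=> //.
    by rewrite /g2 gez0_abs ?subr_ge0 ?lezD1// addrC subrK.
  apply: (@le_trans _ _ (\sum_(n <- s1) c * tail_term (J + 1 + (g2 n)%:Z)))%R.
    rewrite [leLHS]big_seq [leRHS]big_seq; apply: ler_sum => n ns1.
    have [ns sgn] := s1P _ ns1; have /andP[an0 anM] := aM _ ns.
    rewrite /tail_term -sgn mulrCA ler_wpM2l ?powR_ge0//.
    rewrite (le_trans _ (yinv_scale HPhi _ c1))//.
    by apply: le_yinv => //; rewrite ?mulr_gt0// aPhi.
  rewrite -mulr_sumr ler_wpM2l ?(ltW c0)//.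
  pose L := (\max_(n <- s1) g2 n).+1.
  have [_ HCL] := HC J L; apply: le_trans HCL.
  apply: (@sum_reindex_le _ _ _ (fun i => tail_term (J + 1 + i%:Z))) => //.
  - exact: filter_uniq.
  - move=> n l /s1P[ns nE] /s1P[ls lE] gg; apply: isg => //.
    by rewrite nE lE gg.
  - by move=> n ns; rewrite ltnS leq_bigmax_seq.
  - by move=> i; rewrite ltW// tail_term_gt0.
set S := (\sum_(n <- s) _)%R.
have S0 : (0 <= S)%R.
  rewrite /S big_seq sumr_ge0// => n ns; have /andP[an0 _] := aM _ ns.
  by rewrite mulr_ge0// powR_ge0.
have SK : (S <= K * y)%R.
  rewrite /S (bigID (fun n => (sg n <= J)%R))/= (le_trans (lerD near far))//.
  by rewrite /K mulrDl !mulrA.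
apply: (@le_trans _ _ (dy R J `^ (- Q))%:E); last by rewrite PhiM lee_fin.
apply: lt_yinv => //; first by rewrite divr_ge0// ltW// mulr_gt0.
by rewrite ltr_pdivrMr ?mulr_gt0// (le_lt_trans SK)// mulrC ltr_pM2l// ltr_pMl// ltr1n.
Qed.

End Hedberg.

(** * Duality *)

Section Conjugate.
Context (R : realType) (Psi : R -> \bar R).
Hypothesis HPsi : youngY Psi.
Let star : starshaped Psi. Proof. by apply: young_starshaped; case: HPsi. Qed.

Definition conjugate (u : R) : \bar R :=
  ereal_sup [set (u * v)%:E - Psi v | v in [set v : R | (0 <= v)%R]].

Definition youngr (v : R) : R := fine (Psi v).

Lemma youngrE v : (0 <= v)%R -> Psi v = (youngr v)%:E.
Proof. by move=> v0; rewrite fineK// youngY_fin. Qed.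

Lemma youngr_ge0 v : (0 <= v)%R -> (0 <= youngr v)%R.
Proof. by move=> v0; rewrite -lee_fin -youngrE// (star_ge0 star). Qed.

Lemma youngr_gt0 v : (0 < v)%R -> (0 < youngr v)%R.
Proof. by move=> v0; rewrite -lte_fin -youngrE ?ltW//; case/andP: (HPsi.2 _ v0). Qed.

Lemma youngr_slope (u v : R) : (0 < u)%R -> (u <= v)%R ->
  (youngr u / u <= youngr v / v)%R.
Proof.
move=> u0 uv; have v0 := lt_le_trans u0 uv.
have uv1 : (0 <= u / v <= 1)%R by rewrite divr_ge0 ?(ltW u0) ?(ltW v0)//= ler_pdivrMr// mul1r.
have := star_shrink star uv1 (ltW v0); rewrite divfK ?gt_eqF//.
rewrite (youngrE (ltW u0)) (youngrE (ltW v0)) -EFinM lee_fin => H; rewrite ler_pdivrMr// (le_trans H)// le_eqVlt.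
by apply/orP; left; apply/eqP; field; rewrite gt_eqF.
Qed.

Lemma conjugate_ge u v : (0 <= v)%R -> (u * v)%:E <= Psi v + conjugate u.
Proof.
move=> v0; rewrite addeC -leeBlDr ?youngY_fin//.
by apply: ereal_sup_ubound; exists v.
Qed.

Lemma conjugate_le u c : (forall v, (0 <= v)%R -> (u * v - youngr v)%:E <= c) ->
  conjugate u <= c.
Proof.
move=> H; apply: ge_ereal_sup => _ [v /= v0 <-].
by rewrite youngrE// -EFinB H.
Qed.

Lemma conjugate_starshaped : starshaped conjugate.
Proof.
have N0 u : 0 <= conjugate u.
  by have := conjugate_ge u (lexx 0%R); rewrite mulr0 (star0 star) add0e.
split=> //.
- apply/le_anti; rewrite N0 andbT; apply: conjugate_le => v v0.
  by rewrite mul0r sub0r lee_fin oppr_le0 youngr_ge0.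
- move=> c r /andP[c0 c1] r0; apply: conjugate_le => v v0.
  apply: (@le_trans _ _ (c%:E * (r * v - youngr v)%:E)).
    rewrite -EFinM lee_fin mulrBr mulrA lerD2l lerN2.
    by rewrite ler_piMl ?youngr_ge0.
  apply: lee_wpmul2l; first by rewrite lee_fin.
  by rewrite EFinB leeBlDr// addeC -youngrE// conjugate_ge.
Qed.

(** The supremum defining [conjugate (k * r)] is tested at [2 * v]: as [Psi (2 * v)] is at most
    [k0 * Psi v], the choice [k = 1 + k0] leaves at least [2 * k * (r * v - Psi v)]. *)
Lemma conjugate_nabla : Delta2 Psi -> exists2 k : R, (1 < k)%R &
  forall r : R, (0 <= r)%R -> conjugate r <= ((2 * k)^-1)%:E * conjugate (k * r)%R.
Proof.
move=> [k0 k01 Hk]; exists (1 + k0)%R; first by rewrite ltrDl (lt_trans _ k01).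
have kp : (0 < 1 + k0)%R by rewrite addr_gt0// (lt_trans _ k01).
move=> r r0; rewrite lee_pdivlMl ?mulr_gt0//; apply: (@le_trans _ _ ((2 * (1 + k0))%:E * conjugate r)) => //.
rewrite -lee_pdivlMl ?mulr_gt0//; apply: conjugate_le => v v0.
rewrite lee_pdivlMl ?mulr_gt0// -EFinM.
have v20 : (0 <= 2 * v)%R by rewrite mulr_ge0.
apply: (@le_trans _ _ ((1 + k0) * r * (2 * v) - youngr (2 * v))%:E); last first.
  by rewrite EFinB leeBlDr// addeC -youngrE// conjugate_ge.
rewrite lee_fin.
have H2 : (youngr (2 * v) <= k0 * youngr v)%R.
  have [->|vn] := eqVneq v 0%R.
    by rewrite mulr0 /youngr (star0 star)/= mulr0.
  by rewrite -lee_fin EFinM -!youngrE// Hk// lt_neqAle eq_sym vn.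
have := youngr_ge0 v0.
have : (0 <= k0 * youngr v)%R by rewrite mulr_ge0 ?youngr_ge0// (le_trans _ (ltW k01)).
rewrite (_ : ((1 + k0) * r * (2 * v) = 2 * (1 + k0) * (r * v))%R); last by ring.
rewrite mulrBr; lra.
Qed.

(** The quotient [Psi u / u] is a test element for [u]: its product with [u] is [Psi u], and its
    conjugate modular is no larger. In the supremum, [v <= u] contributes at most [Psi u], and
    [v > u] nothing positive since the slopes increase. At [u = 0] the quotient is [0] by
    convention. *)
Lemma conjugate_slope (u : R) : (0 <= u)%R -> conjugate (youngr u / u)%R <= Psi u.
Proof.
rewrite le_eqVlt => /predU1P[<-|u0].
  by rewrite invr0 mulr0 (star0 star) (star0 conjugate_starshaped).
have u0w := ltW u0; rewrite (youngrE u0w); apply: conjugate_le => v v0; rewrite lee_fin.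
have [vu|uv] := leP v u.
  rewrite lerBlDr (@le_trans _ _ (youngr u))//; last by rewrite lerDl youngr_ge0.
  by rewrite mulrAC ler_pdivrMr// ler_wpM2l// youngr_ge0// ltW.
have vp := lt_trans u0 uv.
rewrite (@le_trans _ _ 0%R) ?youngr_ge0 ?(ltW u0)// subr_le0 -ler_pdivlMr//.
by rewrite youngr_slope// ltW.
Qed.

End Conjugate.

Section Duality.
Context (R : realType) (d : measure_display) (X : measurableType d).
Variable mu : {measure set X -> \bar R}.
Variables (B : nat -> set X) (m : nat -> R) (P : nat -> nat) (D : R).
Hypothesis HB : ball_basis mu B m P D.
Variables (Psi : R -> \bar R) (t : nat) (k : R).
Hypotheses (HPsi : youngY Psi) (t0 : (0 < t)%N).
Hypotheses (k1 : (1 < k)%R) (kt : (k < 2 ^+ t)%R).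
Hypothesis nabla : forall r : R, (0 <= r)%R ->
  conjugate Psi r <= ((2 * k)^-1)%:E * conjugate Psi (k * r)%R.
Variables (b : X -> R) (a : nat -> R) (K : R).
Hypotheses (mb : measurable_fun [set: X] b) (K0 : (0 <= K)%R).
Hypothesis bK : forall n,
  \int[mu]_(x in B n) (`|b x - a n| ^+ t.+1)%:E <= (K * m n)%:E.
Variables (E Dc : nat -> set X) (c : R).
Hypotheses (mE : forall n, measurable (E n)) (mDc : forall n, measurable (Dc n)).
Hypotheses (EB : forall n, E n `<=` B n) (DB : forall n, Dc n `<=` B n).
Hypothesis c0 : (0 < c)%R.
Hypothesis ED : forall n, E n !=set0 -> (m n)%:E <= c%:E * mu (Dc n).

Let star : starshaped Psi. Proof. by apply: young_starshaped; case: HPsi. Qed.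
Let Nstar := conjugate_starshaped HPsi.
Let mB := bb_measurable HB.
Let C0 := modular_const D t k.
Let C0_gt0 : (0 < C0)%R. Proof. exact: (modular_const_gt0 HB t0 k1 kt). Qed.

Let osc (al : nat -> R) (L : nat) (x : X) : R :=
  (\sum_(n < L) al n * (`|b x - a n| * \1_(E n) x))%R.
Let core (al : nat -> R) (L : nat) (x : X) : R :=
  (\sum_(n < L) al n * \1_(Dc n) x)%R.

Let mosc al L : measurable_fun [set: X] (osc al L).
Proof.
apply: measurable_sum => n; apply: measurable_funM => //; apply: measurable_funM.
  by apply: measurableT_comp => //; exact: measurable_funB.
exact: measurable_indic.
Qed.

Let mcore al L : measurable_fun [set: X] (core al L).
Proof.
apply: measurable_sum => n; apply: measurable_funM => //; exact: measurable_indic.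
Qed.

Let osc_ge0 al L x : (forall n, (0 <= al n)%R) -> (0 <= osc al L x)%R.
Proof. by move=> al0; apply: sumr_ge0 => n _; rewrite !mulr_ge0. Qed.

Let core_ge0 al L x : (forall n, (0 <= al n)%R) -> (0 <= core al L x)%R.
Proof. by move=> al0; apply: sumr_ge0 => n _; rewrite mulr_ge0. Qed.

Let C1 : R := ((K + 1) * c + 1)%R.
Let C1_ge1 : (1 <= C1)%R.
Proof. by rewrite lerDr mulr_ge0// ?addr_ge0// ltW. Qed.
Let C1_gt0 : (0 < C1)%R. Proof. exact: lt_le_trans C1_ge1. Qed.

(** Hoelder trades the oscillation for [avgq] of [g], which the maximal function dominates at every
    point of [B n]. The measure of [B n] is then charged to the core, for which [ED] gives a lower
    bound. *)
Let pairing al L g : (forall n, (0 <= al n)%R) -> bounded_nneg g ->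
  \int[mu]_x (osc al L x * g x)%:E <=
  C1%:E * \int[mu]_x (core al L x * maxq mu B m t L g x)%:E.
Proof.
move=> al0 bg; have [mg [M gM]] := bg.
have g0 x : (0 <= g x)%R by case/andP: (gM x).
have mbE n : measurable_fun [set: X] (fun x => (`|b x - a n| * \1_(E n) x * g x)%:E).
  apply/measurable_EFinP; apply: measurable_funM => //; apply: measurable_funM.
    by apply: measurableT_comp => //; exact: measurable_funB.
  exact: measurable_indic.
have mM : measurable_fun [set: X] (maxq mu B m t L g) by exact: (measurable_maxq HB).
have -> : \int[mu]_x (osc al L x * g x)%:E =
    \sum_(n < L) (al n)%:E * \int[mu]_x (`|b x - a n| * \1_(E n) x * g x)%:E.
  under eq_integral do rewrite /osc mulr_suml -sumEFin.
  rewrite ge0_integral_sum//; last 2 first.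
  - move=> n; under eq_fun do rewrite -mulrA EFinM; exact: measurable_funeM.
  - by move=> n x _; rewrite lee_fin !mulr_ge0.
  apply: eq_bigr => n _; rewrite -ge0_integralZl_EFin//.
    by apply: eq_integral => x _; rewrite -EFinM !mulrA.
  by move=> x _; rewrite lee_fin !mulr_ge0.
have -> : \int[mu]_x (core al L x * maxq mu B m t L g x)%:E =
    \sum_(n < L) (al n)%:E * \int[mu]_(x in Dc n) (maxq mu B m t L g x)%:E.
  under eq_integral do rewrite /core mulr_suml -sumEFin.
  rewrite ge0_integral_sum//; last 2 first.
  - move=> n; apply/measurable_EFinP; apply: measurable_funM => //.
    by apply: measurable_funM => //; exact: measurable_indic.
  - by move=> n x _; rewrite lee_fin !mulr_ge0// maxq_ge0.
  apply: eq_bigr => n _; rewrite [in RHS]integral_mkcond -ge0_integralZl_EFin//; last 2 first.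
  - by move=> x _; rewrite patchE; case: ifP => // _; rewrite lee_fin maxq_ge0.
  - by apply/(measurable_restrictT _ (mDc n)); apply: measurable_funTS; exact/measurable_EFinP.
  apply: eq_integral => x _; rewrite patchE indicE; case: ifP => _.
    by rewrite mulr1.
  by rewrite mulr0 mul0r mule0.
rewrite ge0_sume_distrr; last first.
  by move=> n _; rewrite mule_ge0 ?lee_fin// integral_ge0// => x _; rewrite lee_fin maxq_ge0.
apply: lee_sum => n _; rewrite muleCA; apply: lee_wpmul2l; first by rewrite lee_fin.
have I0 : 0 <= \int[mu]_(x in Dc n) (maxq mu B m t L g x)%:E.
  by apply: integral_ge0 => x _; rewrite lee_fin maxq_ge0.
have [En|/eqP/set0P En] := pselect (E n = set0).
  rewrite (_ : integral _ _ _ = 0); first by rewrite mule_ge0// lee_fin ltW.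
  by apply: integral0_eq => x _; rewrite En indic0 mulr0 mul0r.
apply: (@le_trans _ _ (\int[mu]_(x in B n) (`|b x - a n| * g x)%:E)).
  rewrite [leRHS]integral_mkcond; apply: le_ge0_integral => x _.
    by rewrite lee_fin !mulr_ge0.
  rewrite patchE indicE; have [xE|xE] := boolP (x \in E n).
    by rewrite mem_set ?mulr1//; apply: EB; rewrite inE in xE.
  by rewrite mulr0 mul0r; case: ifP => // _; rewrite lee_fin mulr_ge0.
rewrite (le_trans (avgq_hoelder HB t0 bg _ _ K0 (bK n)))//.
  by apply: measurableT_comp => //; exact: measurable_funB.
have av0 := avgq_ge0 mu B m t g n.
apply: (@le_trans _ _ (((K + 1) * avgq mu B m t g n)%:E * (c%:E * mu (Dc n)))).
  rewrite EFinM; apply: lee_wpmul2l; last exact: ED.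
  by rewrite lee_fin mulr_ge0// addr_ge0.
apply: (@le_trans _ _ (((K + 1) * c)%:E * \int[mu]_(x in Dc n) (maxq mu B m t L g x)%:E)); last first.
  by apply: lee_wpmul2r => //; rewrite lee_fin lerDl.
rewrite muleA -EFinM mulrAC EFinM -muleA; apply: lee_wpmul2l.
  by rewrite lee_fin mulr_ge0 ?addr_ge0// ltW.
rewrite -integral_cst//; apply: ge0_le_integral => //.
- by apply: measurable_funTS; exact/measurable_EFinP.
- by move=> x xD; rewrite lee_fin; apply: (avgq_le_maxq _ _ _ _ (ltn_ord n)); exact: DB.
Qed.

(** Small enough for the absorption in [trunc_bound], where [C1 * (C0 * (2 * k * eps)) <= 1 / 2],
    and for shrinking the conjugate by the factor [2 * k * eps <= 1]. *)
Let eps : R := (4 * k * C1 * (C0 + 1))^-1%R.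
Let k0 : (0 < k)%R. Proof. exact: lt_trans k1. Qed.
Let eps_gt0 : (0 < eps)%R.
Proof. by rewrite invr_gt0 !mulr_gt0// addr_gt0. Qed.
Let epsw : (0 <= eps)%R. Proof. exact: ltW. Qed.
Let k0w : (0 <= k)%R. Proof. exact: ltW. Qed.
Let keps : (2 * k * eps = (2 * C1 * (C0 + 1))^-1)%R.
Proof. by rewrite /eps; field; rewrite !gt_eqF// addr_gt0. Qed.
Let keps1 : (0 <= 2 * k * eps <= 1)%R.
Proof.
have C01 : (0 < C0 + 1)%R by rewrite addr_gt0.
have p : (0 < 2 * C1 * (C0 + 1))%R by rewrite !mulr_gt0.
rewrite keps invr_ge0 (ltW p)/= invf_le1//.
by have := C1_ge1; have := C0_gt0; nra.
Qed.

Let keps0 : (0 <= 2 * k * eps)%R. Proof. by case/andP: keps1. Qed.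

(** With [A] the oscillation sum, the left-hand side [Z] is the pairing of [A] with [g = Psi A / A]
    on the truncation set. After [pairing], Young's inequality leaves the modular of the core sum
    and a conjugate modular of the maximal function of [g], which is a small multiple of [Z] and is
    absorbed. Absorption requires [Z] to be finite: hence the truncation at [l] and the finite
    number of balls, which carry the support of [A]. *)
Let trunc_bound al L (l : R) : (forall n, (0 <= al n)%R) -> (0 < l)%R ->
  \int[mu]_(x in [set x | (osc al L x <= l)%R]) Psi (osc al L x) <=
  (2 * C1)%:E * \int[mu]_x Psi (core al L x / eps)%R.
Proof.
move=> al0 l0; set A := osc al L.
have A0 x : (0 <= A x)%R by exact: osc_ge0.
have mA : measurable_fun [set: X] A by exact: mosc.
pose S := [set x | (A x <= l)%R].
have mS : measurable S.
  have -> : S = ~` [set x | (cst l x < A x)%R].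
    rewrite /S; apply/seteqP; split=> x /=; first by rewrite leNgt => /negP.
    by move=> /negP; rewrite -leNgt.
  by apply: measurableC; exact: measurable_set_lt.
have mPsiA : measurable_fun [set: X] (fun x => Psi (A x)).
  exact: star_measurable_comp.
have PsiA0 x : 0 <= Psi (A x) by exact: (star_ge0 star).
pose g x := (youngr Psi (A x) / A x * \1_S x)%R.
pose M := (youngr Psi l / l)%R.
have M0 : (0 < M)%R by rewrite divr_gt0// youngr_gt0.
have gM x : (0 <= g x <= M)%R.
  rewrite /g indicE; have [xS|] := boolP (x \in S); last by rewrite mulr0 lexx ltW.
  rewrite mulr1 divr_ge0 ?youngr_ge0//=.
  have [->|An] := eqVneq (A x) 0%R; first by rewrite invr0 mulr0 ltW.
  apply: youngr_slope => //; first by rewrite lt_neqAle eq_sym An A0.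
  by rewrite inE in xS.
have mg : measurable_fun [set: X] g.
  apply: measurable_funM; last exact: measurable_indic.
  apply: measurable_funM.
    have -> : (fun x => youngr Psi (A x)) = fine \o (fun x => Psi (A x)) by [].
    exact: measurableT_comp.
  have -> : (fun x => (A x)^-1%R) = fun x => (A x `^ (-1))%R.
    by apply/funext => x; rewrite powR_inv1.
  by apply: (@measurableT_comp _ _ _ _ _ _ (fun u : R => u `^ (-1))%R); [exact: measurable_powR|].
have bg : bounded_nneg g by split=> //; exists M.
set Z := \int[mu]_(x in S) Psi (A x).
have ZE : Z = \int[mu]_x (A x * g x)%:E.
  rewrite /Z integral_mkcond; apply: eq_integral => x _; rewrite patchE /g indicE.
  case: ifP => _; last by rewrite !mulr0.
  have [A00|An] := eqVneq (A x) 0%R; first by rewrite A00 (star0 star) mul0r.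
  by rewrite mulr1 mulrCA divff// mulr1 youngrE.
have Zfin : Z \is a fin_num.
  rewrite ge0_fin_numE; last by apply: integral_ge0.
  pose W := \big[setU/set0]_(n < L) B n.
  have mW : measurable W by exact: bigsetU_measurable.
  apply: (@le_lt_trans _ _ ((youngr Psi l)%:E * mu W)).
    rewrite -integral_cst// /Z integral_mkcond [leRHS]integral_mkcond.
    apply: le_ge0_integral => x _; first by rewrite patchE; case: ifP.
    rewrite !patchE; case: ifPn => [xS|_]; last first.
      by case: ifP => // _; rewrite lee_fin youngr_ge0// ltW.
    case: ifPn => [xW|/negP xW].
      rewrite -youngrE ?(ltW l0)//; apply: (star_mono star) => //.
      by rewrite inE in xS.
    rewrite (_ : A x = 0%R) ?(star0 star)// /A /osc big1// => n _.
    rewrite indicE memNset ?mulr0// => En; apply: xW; rewrite inE /W -bigcup_mkord.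
    by exists n => //=; exact: EB.
  apply: lte_mul_pinfty; rewrite ?lee_fin ?youngr_ge0 ?(ltW l0)//.
  apply: (@le_lt_trans _ _ (\sum_(n < L) mu (B n))).
    rewrite /W -!(big_mkord xpredT B) -(big_mkord xpredT (fun n => mu (B n))).
    elim: (index_iota 0 L) => [|n s IH]; first by rewrite !big_nil measure0.
    rewrite !big_cons (le_trans (measureU2 _ _ _))//; last exact: leeD2l.
    exact: bigsetU_measurable.
  by under eq_bigr do rewrite (bb_mu HB); rewrite sumEFin ltry.
have Ng : \int[mu]_x conjugate Psi (eps * (2 * k * g x))%R <= (2 * k * eps)%:E * Z.
  apply: (@le_trans _ _ (\int[mu]_x ((2 * k * eps)%:E * ((Psi \o A) \_ S) x))).
    apply: le_ge0_integral => x _; have /andP[gx0 _] := gM x.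
      apply: (star_ge0 Nstar); apply: mulr_ge0 => //; apply: mulr_ge0 => //.
      exact: mulr_ge0.
    rewrite mulrA (mulrC eps) (le_trans (star_shrink Nstar keps1 gx0))//.
    apply: lee_wpmul2l; first by rewrite lee_fin.
    rewrite patchE /g indicE; case: ifP => _.
      by rewrite mulr1; exact: conjugate_slope.
    by rewrite mulr0 (star0 Nstar).
  rewrite ge0_integralZl_EFin//; last 2 first.
  - by move=> x _; rewrite patchE; case: ifP => // _; exact: PsiA0.
  - apply/(measurable_restrictT _ mS); exact: measurable_funTS.
  by rewrite /Z [in leRHS]integral_mkcond.
have mM : measurable_fun [set: X] (maxq mu B m t L g) by exact: (measurable_maxq HB).
(* Scaling the argument by [eps] preserves the constant [k] of [nabla], hence [C0]; so [eps] may
   depend on [C0] without circularity. *)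
pose Theta (u : R) := conjugate Psi (eps * u)%R.
have Tstar : starshaped Theta.
  split; rewrite /Theta; first by rewrite mulr0 (star0 Nstar).
  - by move=> r r0; apply: (star_ge0 Nstar); rewrite mulr_ge0.
  - move=> u r u01 r0; rewrite mulrCA; apply: (star_shrink Nstar) => //.
    by rewrite mulr_ge0.
have Tnabla r : (0 <= r)%R -> Theta r <= ((2 * k)^-1)%:E * Theta (k * r)%R.
  by move=> r0; rewrite /Theta [(eps * (k * r))%R]mulrCA nabla// mulr_ge0.
have NM : \int[mu]_x Theta (maxq mu B m t L g x) <= (C0 * (2 * k * eps))%:E * Z.
  rewrite (le_trans (modular_maxq HB t0 k1 kt Tstar Tnabla M0 L mg gM))//.
  rewrite (EFinM C0) -muleA; apply: lee_wpmul2l => //.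
  by rewrite lee_fin; exact: ltW.
have F0 x : (0 <= core al L x)%R by exact: core_ge0.
have mF : measurable_fun [set: X] (fun x => Psi (core al L x / eps)%R).
  apply: star_measurable_comp => //; first by apply: measurable_funM => //; exact: mcore.
  by move=> x; rewrite divr_ge0.
have F1 x : 0 <= Psi (core al L x / eps)%R.
  by apply: (star_ge0 star); rewrite divr_ge0.
have T0 x : 0 <= Theta (maxq mu B m t L g x) by apply: (star_ge0 Tstar); exact: maxq_ge0.
have mT : measurable_fun [set: X] (fun x => Theta (maxq mu B m t L g x)).
  by apply: star_measurable_comp => // x; exact: maxq_ge0.
set IF := \int[mu]_x Psi (core al L x / eps)%R.
have I0 : 0 <= IF by exact: integral_ge0.
have main : Z <= C1%:E * (IF + (C0 * (2 * k * eps))%:E * Z).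
  rewrite {1}ZE (le_trans (pairing _ al0 bg))//; apply: lee_wpmul2l => //.
    by rewrite lee_fin ltW.
  apply: (@le_trans _ _ (\int[mu]_x (Psi (core al L x / eps)%R + Theta (maxq mu B m t L g x)))).
    apply: le_ge0_integral => x _; first by rewrite lee_fin mulr_ge0// maxq_ge0.
    rewrite (_ : core al L x * maxq mu B m t L g x = (eps * maxq mu B m t L g x) * (core al L x / eps))%R; last first.
      by field; rewrite gt_eqF.
    by rewrite conjugate_ge// divr_ge0.
  by rewrite ge0_integralD// leeD2l.
have half : (C1 * (C0 * (2 * k * eps)) <= 2^-1)%R.
  rewrite keps (_ : (C1 * (C0 * (2 * C1 * (C0 + 1))^-1) = 2^-1 * (C0 / (C0 + 1)))%R); last first.
    by field; rewrite !gt_eqF// addr_gt0.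
  by rewrite ler_piMr// ler_pdivrMr ?addr_gt0// mul1r lerDl.
have Z0 : 0 <= Z by exact: integral_ge0.
clear ZE Ng NM; clearbody Z IF.
case: Z main Zfin Z0 => [z||]//; case: IF I0 => [i||]//.
  move=> i0 main _; rewrite lee_fin => z0; move: main.
  rewrite -(EFinM _ z) -(EFinD i) -(EFinM C1) !lee_fin => main.
  have : (C1 * (C0 * (2 * k * eps)) * z <= 2^-1 * z)%R by rewrite ler_wpM2r.
  move: main; rewrite mulrDr !mulrA; lra.
by move=> _ _ _ _; rewrite gt0_muley ?leey// lte_fin mulr_gt0.
Qed.

(* By duality, [osc] is the adjoint of an operator dominated by the maximal
   function, which is bounded on the Orlicz space of the conjugate function. *)
Lemma oscillation_core_bound : exists2 C : R, (0 < C)%R &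
  forall al L, (forall n, (0 <= al n)%R) ->
  \int[mu]_x Psi (osc al L x / C)%R <= \int[mu]_x Psi (core al L x).
Proof.
(* With the coefficients multiplied by [eps / (2 * C1)], the core sum in [trunc_bound] appears
   divided by [2 * C1], and [star_shrink] cancels the factor in front of the integral. *)
exists (2 * C1 / eps)%R => [|al L al0]; first by rewrite divr_gt0// mulr_gt0.
have C10 : (0 < 2 * C1)%R by rewrite mulr_gt0.
pose al' n := (al n * (eps / (2 * C1)))%R.
have e0 : (0 <= eps / (2 * C1))%R by rewrite divr_ge0// ltW.
have al'0 n : (0 <= al' n)%R by exact: mulr_ge0.
have oE x : osc al' L x = (osc al L x / (2 * C1 / eps))%R.
  by rewrite /osc mulr_suml; apply: eq_bigr => n _; rewrite /al' invf_div mulrAC.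
have cE x : (core al' L x / eps = (2 * C1)^-1 * core al L x)%R.
  rewrite /core mulr_suml mulr_sumr; apply: eq_bigr => n _; rewrite /al'.
  by field; rewrite !gt_eqF.
have F0 x : (0 <= core al L x)%R by exact: core_ge0.
have mO : measurable_fun [set: X] (fun x => Psi (osc al' L x)).
  by apply: star_measurable_comp => // x; exact: osc_ge0.
have O0 x : 0 <= Psi (osc al' L x) by apply: (star_ge0 star); exact: osc_ge0.
have trunc (l : R) : (0 < l)%R -> \int[mu]_(x in [set x | (osc al' L x <= l)%R]) Psi (osc al' L x) <=
    \int[mu]_x Psi (core al L x).
  move=> l0; rewrite (le_trans (trunc_bound L al'0 l0))//.
  under eq_integral do rewrite cE.
  have mPc : measurable_fun [set: X] (fun x => Psi (core al L x)).
    by apply: star_measurable_comp => //; exact: mcore.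
  have C1i : (0 <= (2 * C1)^-1 <= 1)%R.
    by rewrite invr_ge0 (ltW C10)/= invf_le1//; have := C1_ge1; lra.
  apply: (@le_trans _ _ ((2 * C1)%:E * \int[mu]_x (((2 * C1)^-1)%:E * Psi (core al L x)))).
    apply: lee_wpmul2l; first by rewrite lee_fin ltW.
    apply: le_ge0_integral => x _; last exact: star_shrink.
    by apply: (star_ge0 star); rewrite mulr_ge0//; case/andP: C1i.
  rewrite ge0_integralZl_EFin//; last 2 first.
  - by move=> x _; exact: (star_ge0 star).
  - by case/andP: C1i.
  by rewrite muleA -EFinM divff ?mul1e// gt_eqF.
under eq_integral do rewrite -oE.
pose S (l : nat) := [set x | (osc al' L x <= l.+1%:R)%R].
have mS l : measurable (S l).
  have -> : S l = ~` [set x | (cst l.+1%:R x < osc al' L x)%R].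
    rewrite /S; apply/seteqP; split=> x /=; first by rewrite leNgt => /negP.
    by move=> /negP; rewrite -leNgt.
  by apply: measurableC; exact: measurable_set_lt.
have SS l l' : (l <= l')%N -> S l `<=` S l'.
  by move=> ll x /= /le_trans; apply; rewrite ler_nat.
have cov : \bigcup_l S l = [set: X].
  rewrite -subTset => x _; exists (Num.truncn (osc al' L x)) => //=.
  by rewrite /S /= ltW// truncnS_gt.
apply: (@le_trans _ _ (\int[mu]_(x in \bigcup_l S l) Psi (osc al' L x))).
  by rewrite cov.
apply: integral_bigcup_le => // N.
apply: (le_trans _ (trunc N.+1%:R _)) => //; apply: ge0_subset_integral => //.
- exact: bigsetU_measurable.
- exact: mS.
- exact: measurable_funTS.
- move=> x; rewrite -bigcup_mkord => -[l /= lN]; apply: SS; exact: ltnW.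
Qed.

End Duality.

(** * The discretized operator *)

Section DiscreteOperator.
Context (R : realType) (d : measure_display) (X : measurableType d).
Variable mu : {measure set X -> \bar R}.
Variables (B : nat -> set X) (m : nat -> R) (P : nat -> nat) (D : R).
Hypothesis HB : ball_basis mu B m P D.
Hypothesis leb : average_dominated mu B m.
Variables (Q alpha : R) (Phi Psi : R -> \bar R).
Hypotheses (alpha0 : (0 < alpha)%R) (Q0 : (0 < Q)%R).
Hypotheses (HPhi : youngY Phi) (HPsi : youngY Psi).
Hypotheses (nablaPhi : nabla2 Phi) (deltaPsi : Delta2 Psi).
Hypothesis suff : cond_sufficient Q alpha Phi Psi.
Variables (sg : nat -> int) (c1 : R).
Hypothesis c11 : (1 <= c1)%R.
Hypothesis m_le : forall n, (m n <= c1 * dy R (sg n) `^ Q)%R.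
Hypothesis m_ge : forall n, (dy R (sg n) `^ Q <= c1 * m n)%R.
Variables (E Dc : nat -> set X) (c2 : R).
Hypotheses (mE : forall n, measurable (E n)) (mDc : forall n, measurable (Dc n)).
Hypotheses (EB : forall n, E n `<=` B n) (DB : forall n, Dc n `<=` B n).
Hypothesis c20 : (0 < c2)%R.
Hypothesis ED : forall n, E n !=set0 -> (m n)%:E <= c2%:E * mu (Dc n).
Hypothesis E_disj : forall n l x, E n x -> E l x -> sg n = sg l -> n = l.
Hypothesis D_disj : forall n l x, Dc n x -> Dc l x -> sg n = sg l -> n = l.
Variables (b : X -> R) (a : nat -> R) (beta : R).
Hypotheses (mb : measurable_fun [set: X] b) (beta0 : (0 <= beta)%R).
Hypothesis ab : forall n,
  \int[mu]_(x in B n) `|b x - a n|%:E <= (beta * m n)%:E.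

(* The discretization of the integral operator with kernel
   [(`|b x - a n| + `|b y - a n|) / rho x y `^ (Q - alpha)]. *)
Definition discrete_op (L : nat) (f : X -> R) (x : X) : R :=
  (\sum_(n < L) dy R (sg n) `^ (alpha - Q) * \1_(E n) x *
     (`|b x - a n| * fine (\int[mu]_(y in B n) (f y)%:E) +
      fine (\int[mu]_(y in B n) (`|b y - a n| * f y)%:E)))%R.

Let starPhi : starshaped Phi. Proof. by apply: young_starshaped; case: HPhi. Qed.
Let starPsi : starshaped Psi. Proof. by apply: young_starshaped; case: HPsi. Qed.
Let mB := bb_measurable HB.
Let c10 : (0 < c1)%R. Proof. exact: lt_le_trans c11. Qed.

Lemma discrete_op_ge0 L f x : (forall x, (0 <= f x)%R) -> (0 <= discrete_op L f x)%R.
Proof.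
move=> f0; apply: sumr_ge0 => n _; rewrite !mulr_ge0 ?powR_ge0// addr_ge0//.
  by rewrite mulr_ge0// fine_ge0// integral_ge0// => y _; rewrite lee_fin.
by rewrite fine_ge0// integral_ge0// => y _; rewrite lee_fin mulr_ge0.
Qed.

Lemma measurable_discrete_op L f : measurable_fun [set: X] (discrete_op L f).
Proof.
apply: measurable_sum => n; apply: measurable_funM.
  by apply: measurable_funM => //; exact: measurable_indic.
apply: measurable_funD => //; apply: measurable_funM => //.
by apply: measurableT_comp => //; exact: measurable_funB.
Qed.

(** By [avgq_hoelder] both integrals in [discrete_op] are at most multiples of [avgq f n * m n]. The
    operator is thus dominated by [u], a sum over cells, and [v], the same sum weighted by the
    oscillation, which [oscillation_core_bound] moves to the cores. *)
Lemma discrete_op_bounded : exists c C : R, [/\ (0 < c)%R, (0 < C)%R &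
  forall f, bounded_nneg f -> \int[mu]_x Phi (c * f x)%R <= 1 ->
  forall L, \int[mu]_x Psi (discrete_op L f x / C)%R <= 1].
Proof.
have [kP kP1 HkP] := nablaPhi.
have [kN kN1 HkN] := conjugate_nabla HPsi deltaPsi.
have [t1 Ht1] := expr_unbounded kP (ltr1n R 2).
have [t2 Ht2] := expr_unbounded kN (ltr1n R 2).
(* One exponent for two maximal inequalities, for [Phi] and for the conjugate of [Psi]. *)
pose t := (maxn t1 t2).+1.
have t0 : (0 < t)%N by [].
have tP : (kP < 2 ^+ t)%R.
  by rewrite (lt_le_trans Ht1)// ler_weXn2l ?ler1n// leqW// leq_maxl.
have tN : (kN < 2 ^+ t)%R.
  by rewrite (lt_le_trans Ht2)// ler_weXn2l ?ler1n// leqW// leq_maxr.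
have [K K0 HK] := john_nirenberg HB leb mb beta0 ab t.+1.
have [CD CD0 HCD] := oscillation_core_bound HB HPsi t0 kN1 tN HkN mb K0 HK mE mDc EB DB c20 ED.
have [CH CH0 HCH] := hedberg alpha0 Q0 HPhi HPsi c11 suff.
pose C0 := modular_const D t kP.
have C00 : (0 < C0)%R by exact: (modular_const_gt0 HB t0 kP1 tP).
have kP0 : (0 < kP)%R by exact: lt_trans kP1.
(* The factor [2 * kP] is the dilation in [modular_maxq]; [C0 + 1] brings the modular of the maximal
   function below [1]. *)
pose c := (2 * kP * (C0 + 1))%R.
have C01 : (0 < C0 + 1)%R by rewrite addr_gt0.
have c0 : (0 < c)%R by rewrite !mulr_gt0.
(* The leading [2] lets [W_le] bound the quotient by the midpoint of [u] and [v], to which the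
   convexity of [Psi] applies. *)
pose C' := (2 * ((K + 1) * c1 * CH + 2 * c1 * (CH * CD)))%R.
have K1 : (0 < K + 1)%R by rewrite ltr_wpDl.
have C'0 : (0 < C')%R by rewrite mulr_gt0// addr_gt0// !mulr_gt0.
exists c, C'; split=> // f bf If L.
have [mf [Mf fM]] := bf.
have f0 x : (0 <= f x)%R by case/andP: (fM x).
pose av := avgq mu B m t f.
have av0 n : (0 <= av n)%R by exact: avgq_ge0.
pose M := maxq mu B m t L f.
have mM : measurable_fun [set: X] M by exact: (measurable_maxq HB).
have M0 x : (0 <= M x)%R by exact: maxq_ge0.
have mPhiM : measurable_fun [set: X] (fun x => Phi (M x)) by exact: star_measurable_comp.
have PhiM0 x : 0 <= Phi (M x) by exact: (star_ge0 starPhi).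
have IM : \int[mu]_x Phi (M x) <= 1.
  have fM1 x : (0 <= f x <= `|Mf| + 1)%R.
    rewrite f0/= (le_trans (_ : _ <= Mf)%R)//; first by case/andP: (fM x).
    by rewrite (le_trans (ler_norm _))// lerDl.
  have Mf1 : (0 < `|Mf| + 1)%R by rewrite ltr_wpDl.
  rewrite (le_trans (modular_maxq HB t0 kP1 tP starPhi HkP Mf1 L mf fM1))//.
  apply: (@le_trans _ _ (C0%:E * \int[mu]_x (((C0 + 1)^-1)%:E * Phi (c * f x)%R))).
    apply: lee_wpmul2l; first by rewrite lee_fin ltW.
    apply: le_ge0_integral => x _.
      by apply: (star_ge0 starPhi); rewrite mulr_ge0// mulr_ge0// ltW.
    have -> : (2 * kP * f x = (C0 + 1)^-1 * (c * f x))%R.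
      by rewrite /c; field; rewrite gt_eqF.
    apply: (star_shrink starPhi); last by rewrite mulr_ge0// ltW.
    by rewrite invr_ge0 (ltW C01)/= invf_le1// lerDr ltW.
  rewrite ge0_integralZl_EFin ?invr_ge0 ?(ltW C01)//; last 2 first.
  - by move=> x _; apply: (star_ge0 starPhi); rewrite mulr_ge0// ltW.
  - apply: star_measurable_comp => //; first exact: measurable_funM.
    by move=> x; rewrite mulr_ge0// ltW.
  rewrite muleA -EFinM.
  apply: (@le_trans _ _ ((C0 / (C0 + 1))%:E * 1)).
    by apply: lee_wpmul2l => //; rewrite lee_fin divr_ge0 ?ltW.
  by rewrite mule1 lee_fin ler_pdivrMr// mul1r lerDl.
(* The maximal function is at least [av n] on the whole of [B n], and its modular is at most [1]. *)
have Phi_av n : (n < L)%N -> Phi (av n) <= (c1 * dy R (sg n) `^ (- Q))%:E.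
  move=> nL; have mn := bb_gt0 HB n.
  have H : Phi (av n) * (m n)%:E <= 1.
    rewrite -(bb_mu HB) -integral_cst//; apply: le_trans IM.
    apply: (@le_trans _ _ (\int[mu]_(x in B n) Phi (M x))).
      apply: ge0_le_integral => //.
      - by move=> x _; exact: (star_ge0 starPhi).
      - exact: measurable_funTS.
      - by move=> x xB; apply: (star_mono starPhi) => //; exact: avgq_le_maxq.
    exact: ge0_subset_integral.
  have [p pE] : exists p, Phi (av n) = p%:E.
    by exists (fine (Phi (av n))); rewrite fineK// youngY_fin.
  move: H; rewrite pE -EFinM !lee_fin => H.
  rewrite (@le_trans _ _ (m n)^-1%R)//; first by rewrite -[leRHS]mul1r ler_pdivlMr.
  have dq : (0 < dy R (sg n) `^ Q)%R by rewrite powR_gt0// dy_gt0.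
  by rewrite powRN ler_pdivlMr// mulrC ler_pdivrMr.
(* Used for the cells and for the cores: disjointness at each scale makes [sg] injective on the
   indices whose set contains [x], as [hedberg] requires. *)
have hed (U : nat -> set X) : (forall n, U n `<=` B n) ->
    (forall n l x, U n x -> U l x -> sg n = sg l -> n = l) -> forall x,
    Psi ((\sum_(n < L) (dy R (sg n) `^ alpha * av n) * \1_(U n) x) / CH)%R <= Phi (M x).
  move=> UB Ud x; pose s := [seq n <- iota 0 L | x \in U n].
  have sP n : n \in s -> (n < L)%N /\ U n x.
    by rewrite mem_filter mem_iota/= add0n => /andP[]; rewrite inE.
  have -> : (\sum_(n < L) (dy R (sg n) `^ alpha * av n) * \1_(U n) x =
      \sum_(n <- s) dy R (sg n) `^ alpha * av n)%R.
    rewrite big_filter [RHS]big_mkcond.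
    rewrite -(big_mkord xpredT (fun n => (dy R (sg n) `^ alpha * av n) * \1_(U n) x)%R).
    rewrite /index_iota subn0; apply: eq_bigr => n _; rewrite indicE.
    by case: (x \in U n); rewrite ?mulr1 ?mulr0.
  apply: HCH => //.
  - by rewrite filter_uniq// iota_uniq.
  - by move=> n l /sP[_ Un] /sP[_ Ul]; exact: (Ud _ _ x).
  - move=> n /sP[nL Un]; rewrite av0/=; apply: avgq_le_maxq => //; exact: UB.
  - by move=> n /sP[nL _]; exact: Phi_av.
pose al n := (dy R (sg n) `^ alpha * av n)%R.
have al0 n : (0 <= al n)%R by rewrite mulr_ge0 ?powR_ge0.
pose u x := ((\sum_(n < L) al n * \1_(E n) x) / CH)%R.
pose v x := ((\sum_(n < L) al n * (`|b x - a n| * \1_(E n) x)) / (CH * CD))%R.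
have CHD : (0 < CH * CD)%R by rewrite mulr_gt0.
have u0 x : (0 <= u x)%R.
  apply: divr_ge0; last exact: ltW.
  by apply: sumr_ge0 => n _; apply: mulr_ge0.
have v0 x : (0 <= v x)%R.
  apply: divr_ge0; last exact: ltW.
  by apply: sumr_ge0 => n _; apply: mulr_ge0 => //; apply: mulr_ge0.
have mu_ : measurable_fun [set: X] u.
  apply: measurable_funM => //; apply: measurable_sum => n.
  by apply: measurable_funM => //; exact: measurable_indic.
have mv : measurable_fun [set: X] v.
  apply: measurable_funM => //; apply: measurable_sum => n.
  apply: measurable_funM => //; apply: measurable_funM; last exact: measurable_indic.
  by apply: measurableT_comp => //; exact: measurable_funB.
have Iu : \int[mu]_x Psi (u x) <= 1.
  apply: le_trans IM; apply: le_ge0_integral => x _; first exact: (star_ge0 starPsi).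
  exact: hed.
have Iv : \int[mu]_x Psi (v x) <= 1.
  have al'0 n : (0 <= al n / CH)%R by rewrite divr_ge0// ltW.
  have vE x : v x = ((\sum_(n < L) (al n / CH) * (`|b x - a n| * \1_(E n) x)) / CD)%R.
    rewrite /v invfM mulrA mulr_suml; congr (_ / _)%R; apply: eq_bigr => n _.
    by rewrite mulrAC.
  under eq_integral do rewrite vE.
  rewrite (le_trans (HCD _ L al'0))//.
  apply: le_trans IM; apply: le_ge0_integral => x _.
    by apply: (star_ge0 starPsi); apply: sumr_ge0 => n _; rewrite mulr_ge0.
  have -> : (\sum_(n < L) al n / CH * \1_(Dc n) x = (\sum_(n < L) al n * \1_(Dc n) x) / CH)%R.
    by rewrite mulr_suml; apply: eq_bigr => n _; rewrite mulrAC.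
  exact: hed.
have W0 x := discrete_op_ge0 L x f0.
have dyQ n : (dy R (sg n) `^ (alpha - Q) * m n <= c1 * dy R (sg n) `^ alpha)%R.
  have dn := dy_gt0 R (sg n).
  rewrite (le_trans (ler_wpM2l (powR_ge0 _ _) (m_le n)))// mulrCA -powRD ?subrK//.
  by rewrite gt_eqF ?implybT.
have W_le x : (discrete_op L f x / C' <= (1 - 2^-1) * u x + 2^-1 * v x)%R.
  rewrite ler_pdivrMr//.
  have -> : (((1 - 2^-1) * u x + 2^-1 * v x) * C' =
      (u x + v x) * ((K + 1) * c1 * CH + 2 * c1 * (CH * CD)))%R.
    by rewrite /C'; field.
  apply: (@le_trans _ _ (u x * ((K + 1) * c1 * CH) + v x * (2 * c1 * (CH * CD)))%R); last first.
    have A0 : (0 <= (K + 1) * c1 * CH)%R by rewrite ltW// !mulr_gt0.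
    have B0 : (0 <= 2 * c1 * (CH * CD))%R by rewrite ltW// !mulr_gt0.
    have cross (p q r s : R) : (0 <= p)%R -> (0 <= q)%R -> (0 <= r)%R -> (0 <= s)%R ->
        (p * r + q * s <= (p + q) * (r + s))%R by nra.
    exact: cross.
  have -> : (u x * ((K + 1) * c1 * CH) = \sum_(n < L) (K + 1) * c1 * (al n * \1_(E n) x))%R.
    by rewrite -mulr_sumr /u; field; rewrite gt_eqF.
  have -> : (v x * (2 * c1 * (CH * CD)) = \sum_(n < L) 2 * c1 * (al n * (`|b x - a n| * \1_(E n) x)))%R.
    by rewrite -mulr_sumr /v; field; rewrite !gt_eqF.
  rewrite -big_split/=; apply: ler_sum => n _.
  have mn := bb_gt0 HB n.
  have I1 : (fine (\int[mu]_(y in B n) (f y)%:E) <= 2 * av n * m n)%R.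
    have H : \int[mu]_(y in B n) (1 * f y)%:E <= ((1 + 1) * av n * m n)%:E.
      apply: (@avgq_hoelder _ _ _ _ _ _ _ _ HB t t0 f n (cst 1%R) 1%R) => //.
      under eq_integral do rewrite /cst expr1n.
      by rewrite integral_cst// (bb_mu HB).
    move: H; under eq_integral do rewrite mul1r.
    have : 0 <= \int[mu]_(y in B n) (f y)%:E by apply: integral_ge0 => y _; rewrite lee_fin.
    by case: (\int[mu]_(y in B n) (f y)%:E).
  have I2 : (fine (\int[mu]_(y in B n) (`|b y - a n| * f y)%:E) <= (K + 1) * av n * m n)%R.
    have H : \int[mu]_(y in B n) (`|b y - a n| * f y)%:E <= ((K + 1) * av n * m n)%:E.
      apply: (avgq_hoelder HB t0 bf) => //.
      by apply: measurableT_comp => //; exact: measurable_funB.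
    move: H.
    have : 0 <= \int[mu]_(y in B n) (`|b y - a n| * f y)%:E.
      by apply: integral_ge0 => y _; rewrite lee_fin mulr_ge0.
    by case: (\int[mu]_(y in B n) (`|b y - a n| * f y)%:E).
  set w := (dy R (sg n) `^ (alpha - Q))%R; set e := \1_(E n) x.
  have w0 : (0 <= w)%R by exact: powR_ge0.
  have e0 : (0 <= e)%R by rewrite /e.
  have we0 : (0 <= w * e)%R by exact: mulr_ge0.
  set z := `|b x - a n|%R; have z0 : (0 <= z)%R by exact: normr_ge0.
  apply: (@le_trans _ _ (w * e * (z * (2 * av n * m n) + (K + 1) * av n * m n))%R).
    by rewrite ler_wpM2l// lerD// ler_wpM2l.
  have -> : (w * e * (z * (2 * av n * m n) + (K + 1) * av n * m n) =
     (w * m n) * (av n * e * (2 * z + (K + 1))))%R by ring.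
  apply: (@le_trans _ _ ((c1 * dy R (sg n) `^ alpha) * (av n * e * (2 * z + (K + 1))))%R).
    by rewrite ler_wpM2r ?dyQ// !mulr_ge0// addr_ge0 ?mulr_ge0// ltW.
  rewrite /al le_eqVlt; apply/orP; left; apply/eqP; ring.
have half : (0 <= (2^-1 : R) <= 1)%R by rewrite invr_ge0 ler0n/= invf_le1// ler1n.
apply: (@le_trans _ _ (\int[mu]_x ((1 - 2^-1)%:E * Psi (u x) + 2^-1%:E * Psi (v x)))).
  apply: le_ge0_integral => x _; first by apply: (star_ge0 starPsi); rewrite divr_ge0// ltW.
  have Wx0 : (0 <= discrete_op L f x / C')%R by rewrite divr_ge0// ltW.
  rewrite (le_trans (star_mono starPsi Wx0 (W_le x)))//.
  by case: (HPsi) => Y _; exact: (young_convex Y).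
have h1 : (0 <= 1 - 2^-1 :> R)%R by lra.
have mPu : measurable_fun [set: X] (fun x => Psi (u x)) by exact: star_measurable_comp.
have mPv : measurable_fun [set: X] (fun x => Psi (v x)) by exact: star_measurable_comp.
have Pu0 x : 0 <= Psi (u x) by exact: (star_ge0 starPsi).
have Pv0 x : 0 <= Psi (v x) by exact: (star_ge0 starPsi).
rewrite ge0_integralD//; last 4 first.
- by move=> x _; rewrite mule_ge0// lee_fin.
- exact: measurable_funeM.
- by move=> x _; rewrite mule_ge0// lee_fin.
- exact: measurable_funeM.
rewrite !ge0_integralZl_EFin//.
apply: (@le_trans _ _ ((1 - 2^-1)%:E * 1 + (2^-1)%:E * 1)).
  by apply: leeD; apply: lee_wpmul2l => //; rewrite lee_fin.
by rewrite !mule1 -EFinD subrK.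
Qed.

End DiscreteOperator.

(** * Nets of balls at all dyadic scales *)

Section BallNet.
Context (R : realType) (d : measure_display) (X : topMeasurableType d).
Variables (rho : X -> X -> R) (mu : {measure set X -> \bar R}) (Q : R).

(* [sg n] is the scale of the ball [B n], up to constants of radius
   [2 ^ sg n]; at each scale, the cells [E n] partition the space, and the cores
   [Dc n] are disjoint subballs of comparable measure.  Indices which code no
   ball of the net have empty cell and core. *)
Record ball_net (B : nat -> set X) (m : nat -> R) (P : nat -> nat) (D : R)
    (sg : nat -> int) (c1 : R) (E Dc : nat -> set X) (c2 : R) : Prop := {
  bn_basis : ball_basis mu B m P D ;
  bn_nbhs : forall (x : X) (U : set X), nbhs x U -> exists2 n, B n x & B n `<=` U ;
  bn_ball : forall n, exists x, exists2 r : R, (0 < r)%R & B n = qball rho x r ;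
  bn_c1 : (1 <= c1)%R ;
  bn_le : forall n, (m n <= c1 * dy R (sg n) `^ Q)%R ;
  bn_ge : forall n, (dy R (sg n) `^ Q <= c1 * m n)%R ;
  bn_mE : forall n, measurable (E n) ;
  bn_mD : forall n, measurable (Dc n) ;
  bn_EB : forall n, E n `<=` B n ;
  bn_DB : forall n, Dc n `<=` B n ;
  bn_c2 : (0 < c2)%R ;
  bn_ED : forall n, E n !=set0 -> (m n)%:E <= c2%:E * mu (Dc n) ;
  bn_Edisj : forall n l x, E n x -> E l x -> sg n = sg l -> n = l ;
  bn_Ddisj : forall n l x, Dc n x -> Dc l x -> sg n = sg l -> n = l ;
  bn_cover : forall x j, exists2 n, sg n = j & E n x ;
  bn_near : forall n x y, E n x -> (rho x y < dy R (sg n))%R -> B n y }.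

Hypotheses (hX : homogeneous_type rho mu) (hQ : Q_homogeneous rho mu Q).
Hypotheses (Q0 : (0 < Q)%R) (x0 : X).

Let mball x (r : R) : (0 < r)%R -> measurable (qball rho x r).
Proof. by move=> r0; exact: (ht_measurable hX). Qed.

Let hd := ht_quasi_distance hX.

(** Otherwise infinitely many points of the ball could be picked at mutual distance at least [e].
    The balls of radius [e / (2 * K)] around them are disjoint, of measure bounded below, and
    contained in one ball of finite measure. *)
Lemma qball_finite_cover (K : R) : (1 <= K)%R ->
  (forall x y z, (rho x y <= K * (rho x z + rho z y))%R) ->
  forall r e : R, (0 < r)%R -> (0 < e)%R -> exists l : seq X,
  forall x, (rho x0 x < r)%R -> exists2 i, (i < size l)%N & (rho (nth x0 l i) x < e)%R.
Proof.
move=> K1 tri r e r0 e0; apply: contrapT => H.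
have K0 : (0 < K)%R by exact: lt_le_trans K1.
have /choice[nx Hnx] : forall l : seq X, exists x, (rho x0 x < r)%R /\
    forall i, (i < size l)%N -> (e <= rho (nth x0 l i) x)%R.
  move=> l; apply: contrapT => Hl; apply: H; exists l => x xr.
  apply: contrapT => Hx; apply: Hl; exists x; split=> // i il.
  by rewrite leNgt; apply/negP => ri; apply: Hx; exists i.
pose L := fix L n := if n is n'.+1 then rcons (L n') (nx (L n')) else [::].
have sL n : size (L n) = n by elim: n => //= n IH; rewrite size_rcons IH.
have nL n i : (i < n)%N -> nth x0 (L n) i = nx (L i).
  elim: n => // n IH; rewrite ltnS leq_eqVlt => /predU1P[->|ilt] /=.
    by rewrite nth_rcons sL ltnn eqxx.
  by rewrite nth_rcons sL ilt IH.
pose z n := nx (L n).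
have sep i n : (i < n)%N -> (e <= rho (z i) (z n))%R.
  by move=> iln; have [_ /(_ i)] := Hnx (L n); rewrite sL nL//; apply.
pose dl := (e / (2 * K))%R; have dl0 : (0 < dl)%R by rewrite divr_gt0// mulr_gt0.
pose F n := qball rho (z n) dl.
have mF n : measurable (F n) by exact: mball.
have tF : trivIset setT F.
  apply/trivIsetP => i n _ _; wlog iln : i n / (i < n)%N.
    move=> W; rewrite neq_ltn => /orP[iln|nli]; first by apply: W; rewrite // neq_ltn iln.
    by rewrite setIC; apply: W; rewrite // neq_ltn nli.
  move=> _; apply/seteqP; split=> // x [] /= xi xn.
  have : (e < e)%R; last by rewrite ltxx.
  rewrite (le_lt_trans (sep _ _ iln))// (le_lt_trans (tri _ _ x))//.
  rewrite (qd_sym hd x) -ltr_pdivlMl//; move: xi xn; rewrite /qball/= => xi xn.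
  by rewrite (lt_le_trans (ltrD xi xn))// /dl le_eqVlt; apply/orP; left; apply/eqP; field; rewrite gt_eqF.
pose R1 := (K * (r + dl))%R.
have R10 : (0 < R1)%R by rewrite mulr_gt0// addr_gt0.
have [K3 K31 HK3] := hQ.
have K30 : (0 < K3)%R by exact: lt_le_trans K31.
pose v := (K3^-1 * dl `^ Q)%R.
have v0 : (0 < v)%R by rewrite mulr_gt0 ?invr_gt0 ?powR_gt0.
have bound N : (N%:R * v <= K3 * R1 `^ Q)%R.
  rewrite -lee_fin; apply: (@le_trans _ _ (mu (\big[setU/set0]_(n < N) F n))).
    rewrite (measure_bigsetU mu)//; apply: (@le_trans _ _ (\sum_(n < N) v%:E)).
      by rewrite sumEFin sumr_const card_ord -[leRHS]/(_%:E) lee_fin mulr_natl.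
    by apply: lee_sum => n _; case/andP: (HK3 (z n) dl dl0).
  have /andP[_ ub] := HK3 x0 R1 R10; apply: le_trans ub.
  apply: le_measure; rewrite ?inE.
  - exact: bigsetU_measurable.
  - exact: mball.
  - move=> y; rewrite -bigcup_mkord => -[n _]; rewrite /F /qball /= => ny.
    rewrite (le_lt_trans (tri _ _ (z n)))// ltr_pM2l// ltrD//.
    by case: (Hnx (L n)).
pose N := (Num.truncn (K3 * R1 `^ Q / v)%R).+1.
have := bound N; rewrite -ler_pdivlMr// leNgt => /negP; apply.
exact: truncnS_gt.
Qed.

Lemma dense_sequence : exists z : nat -> X,
  forall x (e : R), (0 < e)%R -> exists n, (rho (z n) x < e)%R.
Proof.
have [K K1 tri] := qd_triangle hd.
have /choice[l Hl] : forall p : nat * nat, exists l : seq X,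
    forall x, (rho x0 x < p.1.+1%:R)%R ->
      exists2 i, (i < size l)%N & (rho (nth x0 l i) x < p.2.+1%:R^-1)%R.
  by move=> p; apply: (qball_finite_cover K1 tri); rewrite ?invr_gt0.
pose z n := if (unpickle n : option (nat * nat * nat)) is Some p
            then nth x0 (l p.1) p.2 else x0.
exists z => x e e0.
have [k _ /(_ k (leqnn k)) /= ke] := near_infty_natSinv_lt (PosNum e0).
have [|i _ Hi] := Hl (Num.truncn (rho x0 x), k) x; first exact: truncnS_gt.
exists (pickle (Num.truncn (rho x0 x), k, i)); rewrite /z pickleK.
exact: lt_trans ke.
Qed.

Section Greedy.
Variable z : nat -> X.

(** A maximal [dy R j]-separated subfamily of [z], built in one pass over the indices; the list
    contains the retained indices below [n]. *)
Fixpoint greedy (j : int) (n : nat) : seq nat :=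
  if n is n'.+1 then
    let s := greedy j n' in
    if all (fun i => dy R j <= rho (z i) (z n'))%R s then rcons s n' else s
  else [::].

Definition selected (j : int) (n : nat) : bool := n \in greedy j n.+1.

Lemma greedy_lt j n i : i \in greedy j n -> (i < n)%N.
Proof.
elim: n => //= n IH; case: ifP => _; rewrite ?mem_rcons ?inE.
  by move=> /predU1P[->//|/IH/ltnW]; rewrite ltnS.
by move=> /IH/ltnW.
Qed.

Lemma greedyE j n i : (i \in greedy j n) = (i < n)%N && selected j i.
Proof.
elim: n => [|n IH] //.
have [->|ni] := eqVneq i n; first by rewrite ltnSn.
have -> : (i \in greedy j n.+1) = (i \in greedy j n).
  by rewrite /=; case: ifP => _ //; rewrite mem_rcons inE (negbTE ni).
by rewrite IH ltnS (leq_eqVlt i) (negbTE ni).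
Qed.

Lemma selected_sep j i n : (i < n)%N -> selected j i -> selected j n ->
  (dy R j <= rho (z i) (z n))%R.
Proof.
move=> iln si; rewrite /selected/=; case: ifPn => [/allP H _|_].
  by apply: H; rewrite greedyE iln.
by move/greedy_lt; rewrite ltnn.
Qed.

(** An index is rejected only when a retained point is closer than [dy R j]. *)
Lemma selected_dense j n : exists2 i, selected j i & (rho (z i) (z n) < dy R j)%R.
Proof.
have [/allP H|] := boolP (all (fun i => dy R j <= rho (z i) (z n))%R (greedy j n)).
  exists n; last by rewrite (qd_eq0 hd _ _).2// dy_gt0.
  by rewrite /selected/=; case: ifPn => [_|/allP//]; rewrite mem_rcons mem_head.
move=> /allPn[i]; rewrite greedyE -ltNge => /andP[_ si] ri.
by exists i.
Qed.

End Greedy.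

(** An index codes a scale and a point of the dense sequence. Every such pair has a ball, so that
    the parent can be the concentric ball [aN] scales up and small balls exist near every point;
    only the balls centred at selected points receive a cell and a core. *)
Lemma ball_net_exists : exists B m P D sg c1 E Dc c2,
  ball_net B m P D sg c1 E Dc c2.
Proof.
have [K K1 tri] := qd_triangle hd.
have K0 : (0 < K)%R by exact: lt_le_trans K1.
have [K3 K31 HK3] := hQ.
have K30 : (0 < K3)%R by exact: lt_le_trans K31.
have [z Hz] := dense_sequence.
(* An index that codes nothing is sent to scale [0] and point [0]; the round trip tested in [valid]
   prevents it from repeating the cell of the genuine code. *)
pose dec n : int * nat := odflt (0%R, 0%N) (unpickle n).
have decK p : dec (pickle p) = p by rewrite /dec pickleK.
pose valid n := (pickle (dec n) == n) && selected z (dec n).1 (dec n).2.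
pose sg n := (dec n).1; pose ctr n := z (dec n).2.
(* A point closer than [dy R j] to a cell of radius [2 * K * dy R j] is within [2 * K ^+ 2 + K]
   times [dy R j] of the centre, which [cB] exceeds. *)
pose cB := (4 * K ^+ 2)%R.
have KK : (1 <= K ^+ 2)%R by rewrite exprn_ege1.
have cB1 : (1 < cB)%R by rewrite /cB; lra.
have cB0 : (0 < cB)%R by exact: lt_trans cB1.
pose rad n := (cB * dy R (sg n))%R.
have rad0 n : (0 < rad n)%R by rewrite mulr_gt0// dy_gt0.
pose B n := qball rho (ctr n) (rad n).
pose m n := fine (mu (B n)).
have mB n : measurable (B n) by exact: mball.
have muB n : mu (B n) = (m n)%:E.
  rewrite fineK// ge0_fin_numE//; have /andP[_ ub] := HK3 (ctr n) (rad n) (rad0 n).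
  by rewrite (le_lt_trans ub)// ltry.
have m_up n : (m n <= K3 * rad n `^ Q)%R.
  by rewrite -lee_fin -muB; case/andP: (HK3 (ctr n) (rad n) (rad0 n)).
have m_lo n : (K3^-1 * rad n `^ Q <= m n)%R.
  by rewrite -lee_fin -muB; case/andP: (HK3 (ctr n) (rad n) (rad0 n)).
have m0 n : (0 < m n)%R.
  by rewrite (lt_le_trans _ (m_lo n))// mulr_gt0 ?invr_gt0 ?powR_gt0.
(* By homogeneity a comparison of measures becomes one of radii: [m n <= m l] implies
   [rad n <= H * rad l]. *)
pose H := ((K3 * K3) `^ Q^-1)%R.
have H0 : (0 < H)%R by rewrite powR_gt0// mulr_gt0.
have [a1 Ha1] := expr_unbounded (K * (1 + 2 * K * H))%R (ltr1n R 2).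
have [a2 Ha2] := expr_unbounded ((2 * (K3 * K3)) `^ Q^-1)%R (ltr1n R 2).
(* [a1] serves the engulfing property, [a2] the doubling of the measure from a ball to its
   parent. *)
pose aN := maxn a1 a2.
have p2 (i : nat) : (0 <= 2 ^+ i :> R)%R by exact: exprn_ge0.
have HaN1 : (K * (1 + 2 * K * H) <= 2 ^+ aN)%R.
  by rewrite (le_trans (ltW Ha1))// ler_weXn2l ?ler1n// leq_maxl.
have HaN2 : (2 * (K3 * K3) <= (2 ^+ aN) `^ Q)%R.
  have -> : (2 * (K3 * K3) = ((2 * (K3 * K3)) `^ Q^-1) `^ Q)%R.
    by rewrite -powRrM mulVf ?gt_eqF// powRr1// !mulr_ge0// ltW.
  rewrite ge0_ler_powR ?nnegrE ?powR_ge0 ?(ltW Q0)//.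
  by rewrite (le_trans (ltW Ha2))// ler_weXn2l ?ler1n// leq_maxr.
pose P n := pickle ((sg n + aN%:Z)%R, (dec n).2).
have radP n : rad (P n) = (rad n * 2 ^+ aN)%R.
  by rewrite /rad /sg decK/= dyDn mulrA.
have ctrP n : ctr (P n) = ctr n by rewrite /ctr decK.
pose D := (K3 * K3 * (2 ^+ aN) `^ Q)%R.
have basis : ball_basis mu B m P D.
  split=> //.
  - move=> n; rewrite (le_trans (m_up _))// radP powRM ?(ltW (rad0 _))// /D.
    rewrite [leRHS](_ : _ = K3 * ((K3 * m n) * (2 ^+ aN) `^ Q))%R; last by ring.
    rewrite ler_wpM2l ?(ltW K30)// ler_wpM2r ?powR_ge0//.
    by have := m_lo n; rewrite ler_pdivrMl.
  - move=> n; apply: le_trans (m_lo _); rewrite radP powRM ?(ltW (rad0 _))//.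
    rewrite ler_pdivlMl//; apply: (@le_trans _ _ (K3 * (2 * (K3 * rad n `^ Q)))%R).
      by rewrite ler_wpM2l ?(ltW K30)// ler_wpM2l.
    rewrite (_ : (K3 * (2 * (K3 * rad n `^ Q)) = rad n `^ Q * (2 * (K3 * K3)))%R); last by ring.
    by rewrite ler_wpM2l ?powR_ge0.
  - move=> n l [w [nw lw]] mnl y ny.
    have rnl : (rad n <= H * rad l)%R.
      have : (rad n `^ Q <= K3 * K3 * rad l `^ Q)%R.
        rewrite -mulrA -ler_pdivrMl// (le_trans (m_lo n))// (le_trans mnl)//.
      have -> : (K3 * K3 * rad l `^ Q = (H * rad l) `^ Q)%R.
        rewrite powRM ?(ltW H0) ?(ltW (rad0 _))// /H -powRrM mulVf ?gt_eqF// powRr1//.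
        by rewrite mulr_ge0// ltW.
      move=> HH; rewrite leNgt; apply/negP => lt.
      have := @gt0_ltr_powR R Q Q0 (H * rad l)%R (rad n).
      rewrite !nnegrE => /(_ _ _ lt); rewrite ltNge HH => /(_ _ _)/negP; apply => //.
        by rewrite mulr_ge0// ltW.
      exact: ltW.
    rewrite /B ctrP radP /qball/=; move: nw lw ny; rewrite /B /qball/= => nw lw ny.
    rewrite (le_lt_trans (tri _ _ w))//.
    have wy : (rho w y <= K * (2 * rad n))%R.
      rewrite (le_trans (tri _ _ (ctr n)))// ler_wpM2l ?(ltW K0)//.
      by rewrite mulr_natl mulr2n (qd_sym hd w) lerD// ltW.
    rewrite (@lt_le_trans _ _ (K * (rad l + K * (2 * (H * rad l))))%R)//.
      rewrite ltr_pM2l// ltr_leD// (le_trans wy)// ler_wpM2l ?(ltW K0)//.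
      by rewrite ler_wpM2l.
    rewrite (_ : (K * (rad l + K * (2 * (H * rad l))) = rad l * (K * (1 + 2 * K * H)))%R); last by ring.
    by rewrite ler_wpM2l// ltW.
pose c1 := (K3 * cB `^ Q)%R.
have cBQ : (1 <= cB `^ Q)%R by rewrite -[leLHS](powRr0 cB) ler_powR// ltW.
have c11 : (1 <= c1)%R by rewrite mulr_ege1.
pose c2 := (c1 * (K3 * (2 * K) `^ Q))%R.
have K20 : (0 < 2 * K)%R by rewrite mulr_gt0.
have c20 : (0 < c2)%R by rewrite !mulr_gt0 ?powR_gt0.
(* Selected centres are [dy R j] apart, so with this radius the quasi-triangle inequality keeps the
   cores of one scale disjoint. *)
pose Dc n := if valid n then qball rho (ctr n) (dy R (sg n) / (2 * K)) else set0.
(* Removing the balls around earlier selected points puts each point in the cell of the first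
   selected centre close enough to it, which gives both disjointness and covering. *)
pose E n := if valid n then qball rho (ctr n) (2 * K * dy R (sg n)) `\`
   \big[setU/set0]_(l <- greedy z (sg n) (dec n).2) qball rho (z l) (2 * K * dy R (sg n))
   else set0.
have dK0 n : (0 < dy R (sg n) / (2 * K))%R by rewrite divr_gt0// dy_gt0.
have Kd0 j : (0 < 2 * K * dy R j)%R by rewrite mulr_gt0// dy_gt0.
have mleq n : (m n <= c1 * dy R (sg n) `^ Q)%R.
  by rewrite (le_trans (m_up n))// /rad powRM ?dy_ge0 ?(ltW cB0)// mulrA.
have valid_eq n l : valid n -> valid l -> sg n = sg l -> (dec n).2 = (dec l).2 -> n = l.
  move=> /andP[/eqP nE _] /andP[/eqP lE _] s1 s2; rewrite -nE -lE; congr pickle.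
  by move: s1 s2; rewrite /sg; case: (dec n) => ? ?; case: (dec l) => ? ? /= -> ->.
have Kle : (K <= K ^+ 2)%R by rewrite expr2 ler_peMl// ltW.
exists B, m, P, D, sg, c1, E, Dc, c2; split.
- exact: basis.
- move=> x U /(ht_nbhs hX)[r r0 rU].
  have e0 : (0 < r / (2 * K * cB))%R by rewrite divr_gt0// mulr_gt0.
  have [j /andP[jr _]] := dy_scale e0.
  have [i Hi] := Hz x _ (dy_gt0 R j).
  have pE : B (pickle (j, i)) = qball rho (z i) (cB * dy R j).
    by rewrite /B /ctr /rad /sg decK.
  have dj := dy_gt0 R j.
  exists (pickle (j, i)); rewrite pE /qball/=.
    by rewrite (lt_trans Hi)// ltr_pMl.
  move=> y /= iy; apply: rU; rewrite /qball/=.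
  rewrite (le_lt_trans (tri _ _ (z i)))// (qd_sym hd x).
  apply: (@lt_le_trans _ _ (K * (cB * dy R j + cB * dy R j))%R).
    by rewrite ltr_pM2l// ltrD// (lt_trans Hi)// ltr_pMl.
  have := jr; rewrite ler_pdivlMr ?mulr_gt0// => /(le_trans _); apply.
  by rewrite le_eqVlt; apply/orP; left; apply/eqP; ring.
- by move=> n; exists (ctr n), (rad n).
- exact: c11.
- exact: mleq.
- move=> n; have := m_lo n; rewrite ler_pdivrMl// /rad powRM ?dy_ge0 ?(ltW cB0)// => h.
  apply: (@le_trans _ _ (cB `^ Q * dy R (sg n) `^ Q)%R).
    by rewrite ler_peMl ?powR_ge0.
  rewrite (le_trans h)// /c1 ler_wpM2r ?(ltW (m0 n))// ler_peMr// ltW//.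
- move=> n; rewrite /E; case: ifP => // _; apply: measurableD; first exact: mball.
  by apply: bigsetU_measurable => l _; exact: mball.
- by move=> n; rewrite /Dc; case: ifP => // _; exact: mball.
- move=> n; rewrite /E; case: ifP => _; last exact: sub0set.
  move=> x [] + _; rewrite /B /qball/= => /lt_le_trans; apply.
  rewrite /rad /cB ler_wpM2r ?dy_ge0//; lra.
- move=> n; rewrite /Dc; case: ifP => _; last exact: sub0set.
  move=> x; rewrite /B /qball/= => /lt_le_trans; apply.
  rewrite ler_pdivrMr// /rad -mulrA mulrCA ler_peMr ?dy_ge0//.
  by rewrite mulr_ege1 ?(ltW cB1)//; have := K1; lra.
- exact: c20.
- move=> n [x]; rewrite /E /Dc; case: ifP => // _ _.
  have /andP[lo _] := HK3 (ctr n) _ (dK0 n).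
  apply: (@le_trans _ _ (c2%:E * (K3^-1 * (dy R (sg n) / (2 * K)) `^ Q)%:E)); last first.
    by apply: lee_wpmul2l => //; rewrite lee_fin ltW.
  rewrite -EFinM lee_fin (le_trans (mleq n))// /c2.
  have qE : ((dy R (sg n) / (2 * K)) `^ Q * (2 * K) `^ Q = dy R (sg n) `^ Q)%R.
    rewrite -powRM ?(ltW (dK0 n)) ?(ltW K20)//; congr (_ `^ _)%R.
    by rewrite divfK// gt_eqF.
  rewrite -qE le_eqVlt; apply/orP; left; apply/eqP; field; by rewrite gt_eqF.
- move=> n l x; rewrite /E; case: ifP => [vn|_ []]; case: ifP => [vl|_ _ []].
  move=> [xn Hn] [xl Hl] nl; apply: (valid_eq _ _ vn vl nl); rewrite nl in xn Hn.
  case: (ltngtP (dec n).2 (dec l).2) => [nlt|llt|->]; last by [].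
  + exfalso; apply: Hl; rewrite -bigcup_seq; exists (dec n).2 => //=.
    by rewrite greedyE nlt/=; case/andP: vn => _; rewrite -/(sg n) nl.
  + exfalso; apply: Hn; rewrite -bigcup_seq; exists (dec l).2 => //=.
    by rewrite greedyE llt/=; case/andP: vl.
- move=> n l x; rewrite /Dc; case: ifP => [vn|_ []]; case: ifP => [vl|_ _ []].
  rewrite /qball/= => xn xl nl; apply: (valid_eq _ _ vn vl nl); rewrite nl in xn.
  have sl : selected z (sg l) (dec l).2 by case/andP: vl.
  have sn : selected z (sg l) (dec n).2 by rewrite -nl; case/andP: vn.
  have bad : (rho (ctr n) (ctr l) < dy R (sg l))%R.
    rewrite (le_lt_trans (tri _ _ x))// (qd_sym hd x) -ltr_pdivlMl//.
    rewrite (lt_le_trans (ltrD xn xl))// le_eqVlt; apply/orP; left; apply/eqP.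
    by field; rewrite gt_eqF.
  case: (ltngtP (dec n).2 (dec l).2) => [nlt|llt|->]; last by [].
  + by have := le_lt_trans (selected_sep nlt sn sl) bad; rewrite ltxx.
  + rewrite (qd_sym hd) in bad.
    by have := le_lt_trans (selected_sep llt sl sn) bad; rewrite ltxx.
- move=> x j; have [n0 Hn0] := Hz x _ (dy_gt0 R j).
  have [i0 si0 Hi0] := selected_dense z j n0.
  have [|i Hi mini] := @ex_minnP (fun i => selected z j i && (rho (z i) x < 2 * K * dy R j)%R).
    exists i0; rewrite si0/= (le_lt_trans (tri _ _ (z n0)))//.
    by rewrite (mulrC 2%R) -mulrA ltr_pM2l// mulr_natl mulr2n ltrD.
  case/andP: Hi => si Hi.
  exists (pickle (j, i)); first by rewrite /sg decK.
  rewrite /E /valid /ctr /sg !decK/= eqxx si/=; split=> //.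
  rewrite -bigcup_seq => -[l /=]; rewrite greedyE => /andP[li sl] lx.
  have : (i <= l)%N by apply: mini; rewrite sl.
  by rewrite leqNgt li.
- move=> n x y; rewrite /E; case: ifP => // _ [+ _]; rewrite /B /qball/= => xn xy.
  rewrite (le_lt_trans (tri _ _ x))//.
  apply: (@lt_le_trans _ _ (K * (2 * K * dy R (sg n) + dy R (sg n)))%R).
    by rewrite ltr_pM2l// ltrD.
  have dn := dy_gt0 R (sg n).
  rewrite /rad /cB (_ : (K * (2 * K * dy R (sg n) + dy R (sg n)) = (2 * K ^+ 2 + K) * dy R (sg n))%R); last by ring.
  rewrite ler_wpM2r ?dy_ge0//; lra.
Qed.

End BallNet.

(** * Measurability of integrals depending on a parameter *)

Section SigmaFiniteFubini.
Context (R : realType) (d : measure_display) (X : measurableType d).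
Variable mu : {measure set X -> \bar R}.
Hypothesis sf : sigma_finite [set: X] mu.

(* A copy of [mu], on which the structure required by Fubini's theorem is put. *)
Definition sigma_finite_copy of sigma_finite [set: X] mu : set X -> \bar R := mu.

HB.instance Definition _ := isMeasure.Build _ _ _ (sigma_finite_copy sf)
  (measure0 mu) (measure_ge0 mu) (@measure_semi_sigma_additive _ _ _ mu).

HB.instance Definition _ :=
  @Measure_isSigmaFinite.Build _ _ _ (sigma_finite_copy sf) sf.

(** Tonelli's theorem applies to the positive and negative parts; the real integral is [fine] of
    their difference, and so measurable also where it takes a default value. *)
Lemma measurable_integral_section (f : X * X -> R) :
  measurable_fun [set: X * X] f ->
  measurable_fun [set: X] (fun x => (\int[mu]_y f (x, y))%R).
Proof.
move=> mf.
have H (g : X * X -> \bar R) : measurable_fun [set: X * X] g ->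
    (forall x, 0 <= g x) -> measurable_fun [set: X] (fun x => \int[mu]_y g (x, y)).
  move=> mg g0.
  exact: (@measurable_fun_fubini_tonelli_F _ _ X X R
    (sigma_finite_copy sf : {sigma_finite_measure set X -> \bar R}) g mg g0).
have mfE : measurable_fun [set: X * X] (EFin \o f) by exact/measurable_EFinP.
have m1 := H _ (measurable_funepos mfE) (funepos_ge0 _).
have m2 := H _ (measurable_funeneg mfE) (funeneg_ge0 _).
have -> : (fun x => (\int[mu]_y f (x, y))%R) = fine \o (fun x =>
    \int[mu]_y ((EFin \o f)^\+ (x, y)) - \int[mu]_y ((EFin \o f)^\- (x, y))).
  apply/funext => x; rewrite /Rintegral [in LHS]integralE; congr (fine (_ - _)); apply: eq_integral => y _.
    by rewrite !funeposE.
  by rewrite !funenegE.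
have mF : measurable_fun [set: X] (fun x =>
    \int[mu]_y ((EFin \o f)^\+ (x, y)) - \int[mu]_y ((EFin \o f)^\- (x, y))).
  exact: emeasurable_funB.
exact: (measurableT_comp (fine_measurable measurableT) mF).
Qed.

End SigmaFiniteFubini.

(** * Sufficiency *)

Section KernelDomination.
Context (R : realType) (d : measure_display) (X : topMeasurableType d).
Variables (rho : X -> X -> R) (mu : {measure set X -> \bar R}) (Q alpha : R).
Hypothesis hX : homogeneous_type rho mu.
Hypothesis alphaQ : (alpha < Q)%R.
Let hd := ht_quasi_distance hX.

Lemma measurable_rho x : measurable_fun [set: X] (rho x).
Proof.
apply: (measurability _ (RGenInftyO.measurableE R)) => // _ [_ [r ->] <-].
rewrite setTI.
have -> : rho x @^-1` `]-oo, r[%classic = qball rho x r.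
  by apply/seteqP; split=> y; rewrite /qball /= in_itv.
have [r0|r0] := ltP 0%R r; first exact: (ht_measurable hX).
rewrite (_ : qball _ _ _ = set0)//; apply/seteqP; split=> // y; rewrite /qball/= => yr.
by have := le_lt_trans (qd_ge0 hd x y) (lt_le_trans yr r0); rewrite ltxx.
Qed.

Variable b : X -> R.
Hypothesis mb : measurable_fun [set: X] b.
Local Notation aker := (abs_commutator_ker rho b Q alpha).

Lemma measurable_powR_inv (d' : measure_display) (T : measurableType d') (f : T -> R) :
  measurable_fun [set: T] f ->
  measurable_fun [set: T] (fun x => (f x `^ (Q - alpha))^-1%R).
Proof.
move=> mf; under eq_fun do rewrite -powRN.
by apply: (@measurableT_comp _ _ _ _ _ _ (fun u : R => u `^ (- (Q - alpha)))%R);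
  [exact: measurable_powR|].
Qed.

Lemma measurable_aker x : measurable_fun [set: X] (aker x).
Proof.
apply: measurable_funM; last exact/measurable_powR_inv/measurable_rho.
by apply: measurableT_comp => //; exact: measurable_funB.
Qed.

Lemma aker_ge0 x y : (0 <= aker x y)%R.
Proof. by rewrite divr_ge0// powR_ge0. Qed.

Variables (B : nat -> set X) (m : nat -> R) (P : nat -> nat) (D : R)
    (sg : nat -> int) (c1 : R) (E Dc : nat -> set X) (c2 : R).
Hypothesis HN : ball_net rho mu Q B m P D sg c1 E Dc c2.
Variables (a : nat -> R) (beta : R).
Hypothesis beta0 : (0 <= beta)%R.
Hypothesis ab : forall n,
  \int[mu]_(x in B n) `|b x - a n|%:E <= (beta * m n)%:E.
Let HB := bn_basis HN.
Let mB := bb_measurable HB.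

(** On bounded functions the integrals inside [discrete_op] are finite, so that [fine] is faithful
    there. *)
Definition truncate (h : X -> R) (N : nat) (x : X) : R := Num.min (h x) N%:R.

Lemma measurable_truncate (h : X -> R) N : measurable_fun [set: X] h ->
  measurable_fun [set: X] (truncate h N).
Proof. by move=> mh; exact: measurable_minr. Qed.

Lemma truncate_ge0 (h : X -> R) N x : (0 <= h x)%R -> (0 <= truncate h N x)%R.
Proof. by move=> h0; rewrite le_min h0 ler0n. Qed.

Lemma bounded_truncate (h : X -> R) N : measurable_fun [set: X] h ->
  (forall x, (0 <= h x)%R) -> bounded_nneg (truncate h N).
Proof.
move=> mh h0; split; first exact: measurable_truncate.
by exists N%:R => x; rewrite truncate_ge0//= ge_min lexx orbT.
Qed.

Lemma ball_integral_fin (f : X -> R) n : bounded_nneg f ->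
  \int[mu]_(y in B n) (f y)%:E \is a fin_num /\
  \int[mu]_(y in B n) (`|b y - a n| * f y)%:E \is a fin_num.
Proof.
move=> [mf [M fM]].
have f0 y : (0 <= f y)%R by case/andP: (fM y).
have fle y : (f y <= `|M|)%R.
  by rewrite (le_trans _ (ler_norm M))//; case/andP: (fM y).
have mby : measurable_fun [set: X] (fun y => `|b y - a n|%R).
  by apply: measurableT_comp => //; exact: measurable_funB.
split.
  rewrite ge0_fin_numE; last by apply: integral_ge0 => y _; rewrite lee_fin.
  apply: (@le_lt_trans _ _ (`|M| * m n)%:E); last exact: ltry.
  rewrite EFinM -(bb_mu HB) -integral_cst//; apply: ge0_le_integral => //.
  - by move=> y _; rewrite lee_fin.
  - by apply: measurable_funTS; exact/measurable_EFinP.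
  - by move=> y _; rewrite lee_fin.
rewrite ge0_fin_numE; last by apply: integral_ge0 => y _; rewrite lee_fin mulr_ge0.
apply: (@le_lt_trans _ _ (`|M|%:E * (beta * m n)%:E)); last first.
  by rewrite -EFinM ltry.
apply: (le_trans _ (lee_wpmul2l _ (ab n))); last by rewrite lee_fin.
rewrite -ge0_integralZl_EFin//; last first.
  by apply: measurable_funTS; exact/measurable_EFinP.
apply: le_ge0_integral => y _; first by rewrite lee_fin mulr_ge0.
by rewrite -EFinM lee_fin mulrC ler_wpM2r.
Qed.

Lemma discrete_op_mono (f g : X -> R) L L' x : bounded_nneg f -> bounded_nneg g ->
  (forall y, (f y <= g y)%R) -> (L <= L')%N ->
  (discrete_op mu B Q alpha sg E b a L f x <= discrete_op mu B Q alpha sg E b a L' g x)%R.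
Proof.
move=> bf bg fg LL.
have f0 y : (0 <= f y)%R by case: bf => _ [M /(_ y)/andP[]].
have g0 y : (0 <= g y)%R by case: bg => _ [M /(_ y)/andP[]].
apply: (@le_trans _ _ (discrete_op mu B Q alpha sg E b a L g x)).
  apply: ler_sum => n _; rewrite ler_wpM2l ?mulr_ge0 ?powR_ge0//.
  have [f1 f2] := ball_integral_fin n bf; have [g1 g2] := ball_integral_fin n bg.
  rewrite lerD//.
    rewrite ler_wpM2l// fine_le//; apply: le_ge0_integral => y _; rewrite lee_fin//.
  rewrite fine_le//; apply: le_ge0_integral => y _; rewrite lee_fin ?mulr_ge0//.
  by rewrite ler_wpM2l.
pose F n : R := (dy R (sg n) `^ (alpha - Q) * \1_(E n) x *
  (`|b x - a n| * fine (\int[mu]_(y in B n) (g y)%:E) +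
   fine (\int[mu]_(y in B n) (`|b y - a n| * g y)%:E)))%R.
have F0 n : (0 <= F n)%R.
  rewrite /F !mulr_ge0 ?powR_ge0// addr_ge0//.
    by rewrite mulr_ge0// fine_ge0// integral_ge0// => y _; rewrite lee_fin.
  by rewrite fine_ge0// integral_ge0// => y _; rewrite lee_fin mulr_ge0.
rewrite /discrete_op -!(big_mkord xpredT F).
by rewrite [leRHS](big_cat_nat (leq0n L) LL)/= lerDl sumr_ge0.
Qed.

Local Notation W := (discrete_op mu B Q alpha sg E b a).

(** The same index [N] counts the balls and truncates [h], so that a single monotone limit recovers
    the integral against the kernel. *)
Lemma kernel_le_discrete (h : X -> R) (x : X) (w : R) :
  measurable_fun [set: X] h -> (forall x, (0 <= h x)%R) ->
  (forall N, (W N (truncate h N) x <= w)%R) ->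
  \int[mu]_y (aker x y * h y)%:E <= (2 `^ (Q - alpha) * w)%:E.
Proof.
move=> mh h0 Ww.
pose k2 : R := (2 `^ (Q - alpha))%R; have k20 : (0 <= k2)%R by exact: powR_ge0.
pose cf n : R := (k2 * (dy R (sg n) `^ (alpha - Q) * \1_(E n) x))%R.
have cf0 n : (0 <= cf n)%R by rewrite mulr_ge0// mulr_ge0 ?powR_ge0.
pose tm N n y : R := (cf n * (\1_(B n) y * (`|b x - b y| * truncate h N y)))%R.
have tr0 N y : (0 <= truncate h N y)%R by exact: truncate_ge0.
have tm0 N n y : (0 <= tm N n y)%R by rewrite mulr_ge0// mulr_ge0// mulr_ge0.
pose s N y : \bar R := (\sum_(n < N) tm N n y)%R%:E.
have mbx c : measurable_fun [set: X] (fun y => `|c - b y|%R).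
  by apply: measurableT_comp => //; exact: measurable_funB.
have mby c : measurable_fun [set: X] (fun y => `|b y - c|%R).
  by apply: measurableT_comp => //; exact: measurable_funB.
have mtr N : measurable_fun [set: X] (truncate h N) by exact: measurable_truncate.
have mtm N n : measurable_fun [set: X] (tm N n).
  apply: measurable_funM => //; apply: measurable_funM; first exact: measurable_indic.
  exact: measurable_funM.
have ms N : measurable_fun [set: X] (s N).
  by apply/measurable_EFinP; exact: measurable_sum.
have s0 N y : 0 <= s N y by rewrite lee_fin sumr_ge0.
have tr_nd y i j : (i <= j)%N -> (truncate h i y <= truncate h j y)%R.
  by move=> ij; rewrite le_min !ge_min lexx/= ler_nat ij orbT.
have nds y : nondecreasing_seq (s ^~ y).
  move=> i j ij; rewrite lee_fin.
  rewrite -(big_mkord xpredT (fun n => tm i n y)) -(big_mkord xpredT (fun n => tm j n y)).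
  rewrite [leRHS](big_cat_nat (leq0n i) ij)/= -[leLHS]addr0 lerD ?sumr_ge0//.
  apply: ler_sum => n _; rewrite ler_wpM2l// ler_wpM2l// ler_wpM2l//; exact: tr_nd.
have pt y : (aker x y * h y)%:E <= limn (s ^~ y).
  rewrite (cvg_lim _ (ereal_nondecreasing_cvgn (nds y)))//.
  suff [N HNN] : exists N, (aker x y * h y)%:E <= s N y.
    by apply: (le_trans HNN); apply: ereal_sup_ubound; exists N.
  have [xy|xy] := eqVneq (rho x y) 0%R.
    exists 0%N; have -> : x = y by apply/(qd_eq0 hd).
    by rewrite /abs_commutator_ker subrr normr0 !mul0r.
  have r0 : (0 < rho x y)%R by rewrite lt_neqAle eq_sym xy (qd_ge0 hd).
  have [j /andP[j1 j2]] := dy_scale r0.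
  (* A cell through [x] one scale above the distance: its ball contains [y], and the kernel exceeds
     the weight of the ball by at most the factor [k2]. *)
  have [n nj En] := bn_cover HN x (j + 1).
  have Bn : B n y by apply: (bn_near HN En); rewrite nj.
  exists (maxn n (Num.truncn (h y))).+1; rewrite /s lee_fin.
  set N := (maxn _ _).+1.
  have nN : (n < N)%N by rewrite ltnS leq_maxl.
  have trN : truncate h N y = h y.
    apply/min_idPl; rewrite (le_trans (ltW (truncnS_gt _)))// ler_nat ltnS leq_maxr//.
  rewrite (bigD1 (Ordinal nN))//= (@le_trans _ _ (tm N n y))//; last first.
    by rewrite lerDl sumr_ge0.
  rewrite /tm /cf !indicE !mem_set// mulr1 mul1r trN mulrA ler_wpM2r//.
  rewrite /abs_commutator_ker mulrC ler_wpM2r// nj.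
  have -> : (k2 * dy R (j + 1) `^ (alpha - Q) = dy R j `^ (alpha - Q))%R.
    rewrite (dyDn _ _ 1) expr1 powRM ?dy_ge0//.
    rewrite mulrCA -powRD ?pnatr_eq0 ?implybT// addrA subrK subrr powRr0 mulr1//.
  rewrite -powRN opprB.
  rewrite -[(alpha - Q)%R]opprB !powRN lef_pV2 ?posrE ?powR_gt0 ?dy_gt0//.
  by rewrite ge0_ler_powR ?nnegrE ?subr_ge0 ?(ltW alphaQ) ?dy_ge0 ?(ltW r0).
apply: (@le_trans _ _ (\int[mu]_y limn (s ^~ y))).
  apply: le_ge0_integral => y _; last exact: pt.
  by rewrite lee_fin mulr_ge0 ?aker_ge0.
rewrite monotone_convergence//.
apply: lime_le.
  apply: ereal_nondecreasing_is_cvgn => i j ij; apply: ge0_le_integral => // y _.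
  exact: nds.
apply: nearW => N.
apply: (@le_trans _ _ (k2 * W N (truncate h N) x)%:E); last first.
  by rewrite lee_fin ler_wpM2l.
rewrite /s; under eq_integral do rewrite -sumEFin.
rewrite ge0_integral_sum//; last 2 first.
- by move=> n; exact/measurable_EFinP.
- by move=> n y _; rewrite lee_fin.
rewrite /discrete_op mulr_sumr -sumEFin; apply: lee_sum => n _.
have trN y : (truncate h N y <= N%:R)%R by rewrite ge_min lexx orbT.
set It := \int[mu]_(y in B n) (truncate h N y)%:E.
set Jt := \int[mu]_(y in B n) (`|b y - a n| * truncate h N y)%:E.
have mn := bb_gt0 HB n.
have It0 : 0 <= It by apply: integral_ge0 => y _; rewrite lee_fin.
have Jt0 : 0 <= Jt by apply: integral_ge0 => y _; rewrite lee_fin mulr_ge0.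
have [Itf Jtf] := ball_integral_fin n (bounded_truncate N mh h0).
have -> : \int[mu]_y (tm N n y)%:E =
    (cf n)%:E * \int[mu]_(y in B n) (`|b x - b y| * truncate h N y)%:E.
  have mm : measurable_fun [set: X] (fun y => (`|b x - b y| * truncate h N y)%:E).
    by apply/measurable_EFinP; exact: measurable_funM.
  rewrite [in RHS]integral_mkcond -ge0_integralZl_EFin//; last 2 first.
  - by move=> y _; rewrite patchE; case: ifP => // _; rewrite lee_fin mulr_ge0.
  - by apply/(measurable_restrictT _ (mB n)); exact: measurable_funTS.
  apply: eq_integral => y _; rewrite patchE /tm indicE; case: ifP => _.
    by rewrite mul1r EFinM.
  by rewrite mul0r mulr0 mule0.
rewrite /cf -/It -/Jt -[(dy _ _ `^ _ * _ * _)%R]mulrA.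
rewrite (_ : (k2 * (dy R (sg n) `^ (alpha - Q) * (\1_(E n) x * (`|b x - a n| * fine It + fine Jt))))%R
  = (cf n * (`|b x - a n| * fine It + fine Jt))%R); last by rewrite /cf !mulrA.
rewrite (EFinM (cf n)); apply: lee_wpmul2l; first exact: (cf0 n).
rewrite EFinD EFinM !fineK//.
rewrite /It /Jt -ge0_integralZl_EFin//; last 2 first.
- by move=> y _; rewrite lee_fin.
- by apply: measurable_funTS; exact/measurable_EFinP.
rewrite -ge0_integralD//; last 4 first.
- by move=> y _; rewrite mule_ge0 ?lee_fin.
- by apply: measurable_funTS; apply: measurable_funeM; exact/measurable_EFinP.
- by move=> y _; rewrite lee_fin mulr_ge0.
- by apply: measurable_funTS; apply/measurable_EFinP; exact: measurable_funM.
apply: le_ge0_integral => y _; first by rewrite lee_fin mulr_ge0.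
rewrite -EFinM -EFinD lee_fin -mulrDl ler_wpM2r//.
by rewrite [`|b y - _|%R]distrC ler_distD.
Qed.

End KernelDomination.

Section Sufficiency.
Context (R : realType) (d : measure_display) (X : topMeasurableType d).
Variables (rho : X -> X -> R) (mu : {measure set X -> \bar R}) (Q alpha : R).
Variables (Phi Psi : R -> \bar R).
Hypotheses (hX : homogeneous_type rho mu) (hinf : mu [set: X] = +oo).
Hypotheses (hdense : Cc_dense_L1 mu) (hQ : Q_homogeneous rho mu Q).
Hypotheses (alpha0 : (0 < alpha)%R) (alphaQ : (alpha < Q)%R).
Hypotheses (HPhi : youngY Phi) (HPsi : youngY Psi).
Let starPhi : starshaped Phi. Proof. by apply: young_starshaped; case: HPhi. Qed.
Let starPsi : starshaped Psi. Proof. by apply: young_starshaped; case: HPsi. Qed.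
Let Q0 : (0 < Q)%R. Proof. exact: lt_trans alphaQ. Qed.

Lemma homogeneous_point : exists x : X, True.
Proof.
apply: contrapT => nX; have X0 : [set: X] = set0.
  by apply/seteqP; split=> // x _; apply: nX; exists x.
by move: hinf; rewrite X0 measure0.
Qed.

Lemma homogeneous_sigma_finite : sigma_finite [set: X] mu.
Proof.
have [x0 _] := homogeneous_point; have [K3 K31 HK3] := hQ.
exists (fun n => qball rho x0 n.+1%:R).
  apply/seteqP; split=> // x _; exists (Num.truncn (rho x0 x)) => //.
  exact: truncnS_gt.
move=> n; split; first exact: (ht_measurable hX).
by have /andP[_ ub] := HK3 x0 n.+1%:R (ltr0Sn _ _); rewrite (le_lt_trans ub)// ltry.
Qed.

Lemma bmo_mean_oscillation (b : X -> R) : BMO rho mu b ->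
  exists2 beta : R, (0 <= beta)%R & forall x (r : R), (0 < r)%R ->
  \int[mu]_(y in qball rho x r) `|b y - mean mu (qball rho x r) b|%:E <=
    (beta * fine (mu (qball rho x r)))%:E.
Proof.
move=> [_ bfin]; have [x0 _] := homogeneous_point; have [K3 K31 HK3] := hQ.
have K30 : (0 < K3)%R by exact: lt_le_trans K31.
have mpos x (r : R) : (0 < r)%R -> (0 < fine (mu (qball rho x r)))%R.
  move=> r0; have /andP[lo hi] := HK3 x r r0.
  rewrite fine_gt0// (lt_le_trans _ lo)/=; first by rewrite (le_lt_trans hi)// ltry.
  by rewrite lte_fin mulr_gt0 ?invr_gt0 ?powR_gt0.
have ub x (r : R) : (0 < r)%R -> mean_oscillation mu (qball rho x r) b <= bmo_norm rho mu b.
  by move=> r0; apply: ereal_sup_ubound; exists (x, r).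
have mo0 x (r : R) : (0 < r)%R -> 0 <= mean_oscillation mu (qball rho x r) b.
  move=> r0; apply: mule_ge0; last exact: integral_ge0.
  by rewrite lee_fin invr_ge0 ltW// mpos.
have bfin' : bmo_norm rho mu b \is a fin_num.
  by rewrite ge0_fin_numE// (le_trans (mo0 x0 1%R ltr01))// ub.
exists (fine (bmo_norm rho mu b)) => [|x r r0].
  by rewrite fine_ge0// (le_trans (mo0 x0 1%R ltr01))// ub.
have := ub x r r0; rewrite /mean_oscillation lee_pdivrMl ?mpos// => /le_trans; apply.
by rewrite EFinM (fineK bfin') muleC.
Qed.

Lemma orlicz_scale (f : X -> R) : orlicz rho mu Phi f ->
  exists2 l : R, (0 < l)%R & \int[mu]_x Phi (`|f x| / l)%R <= 1.
Proof.
move=> [[mf _] [e e0 If]].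
have mPe : measurable_fun [set: X] (fun x => Phi (e * `|f x|)%R).
  apply: star_measurable_comp => //.
    by apply: measurable_funM => //; exact: measurableT_comp.
  by move=> x; rewrite mulr_ge0// ltW.
have Pe0 x : 0 <= Phi (e * `|f x|)%R by apply: (star_ge0 starPhi); rewrite mulr_ge0// ltW.
have I0 : 0 <= \int[mu]_x Phi (e * `|f x|)%R by exact: integral_ge0.
have [I IE] : exists I, \int[mu]_x Phi (e * `|f x|)%R = I%:E.
  by exists (fine (\int[mu]_x Phi (e * `|f x|)%R)); rewrite fineK// ge0_fin_numE.
rewrite IE lee_fin in I0.
have I1 : (0 < I + 1)%R by rewrite ltr_wpDl.
exists ((I + 1) / e)%R; first by rewrite divr_gt0.
apply: (@le_trans _ _ (\int[mu]_x (((I + 1)^-1)%:E * Phi (e * `|f x|)%R))).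
  apply: le_ge0_integral => x _.
    by apply: (star_ge0 starPhi); rewrite divr_ge0// divr_ge0// ltW.
  rewrite (_ : (`|f x| / ((I + 1) / e) = (I + 1)^-1 * (e * `|f x|))%R); last first.
    by field; rewrite !gt_eqF.
  apply: (star_shrink starPhi); last by rewrite mulr_ge0// ltW.
  by rewrite invr_ge0 ltW//= invf_le1// lerDr.
rewrite ge0_integralZl_EFin ?invr_ge0 ?(ltW I1)// IE -EFinM lee_fin.
by rewrite ler_pdivrMl// mulr1 lerDl.
Qed.

Hypotheses (nablaPhi : nabla2 Phi) (deltaPsi : Delta2 Psi).
Hypothesis suff : cond_sufficient Q alpha Phi Psi.
Variable b : X -> R.
Hypothesis hb : BMO rho mu b.
Let mb : measurable_fun [set: X] b. Proof. by case: hb => [[]]. Qed.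
Local Notation aker := (abs_commutator_ker rho b Q alpha).

(** [H] is the increasing limit of the measurable functions [Psi (W N x / C)], whose integrals are
    at most [1]; it stands in for the modular of an image that may fail to be measurable. Its
    finiteness at [x] also gives the convergence of the kernel integral at [x]. *)
Lemma abs_kernel_majorant : exists2 C : R, (0 < C)%R &
  forall (f : X -> R) (l : R), measurable_fun [set: X] f -> (0 < l)%R ->
    \int[mu]_x Phi (`|f x| / l)%R <= 1 ->
  exists H : X -> \bar R, [/\ measurable_fun [set: X] H, (forall x, 0 <= H x),
    \int[mu]_x H x <= 1 & forall x, H x < +oo -> exists2 tau : R, (0 <= tau)%R &
      \int[mu]_y (aker x y * `|f y|)%:E = tau%:E /\ Psi (tau / (C * l))%R <= H x].
Proof.
have [x0 _] := homogeneous_point.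
have [B [m [P [D [sg [c1 [E [Dc [c2 HN]]]]]]]]] := ball_net_exists hX hQ Q0 x0.
have HB := bn_basis HN.
have leb : average_dominated mu B m.
  by move=> h ih; exact: (le_average_ae HB (bn_nbhs HN) hdense ih).
have [beta beta0 Hbeta] := bmo_mean_oscillation hb.
pose a n := mean mu (B n) b.
have ab n : \int[mu]_(x in B n) `|b x - a n|%:E <= (beta * m n)%:E.
  rewrite /a; have [x [r r0 BE]] := bn_ball HN n.
  have := Hbeta x r r0; rewrite -BE => /le_trans; apply.
  by rewrite (bb_mu HB).
have [c [C [c0 C0 HC]]] := discrete_op_bounded HB leb alpha0 Q0 HPhi HPsi nablaPhi
  deltaPsi suff (bn_c1 HN) (bn_le HN) (bn_ge HN) (bn_mE HN) (bn_mD HN) (bn_EB HN)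
  (bn_DB HN) (bn_c2 HN) (bn_ED HN) (bn_Edisj HN) (bn_Ddisj HN) mb beta0 ab.
pose k2 : R := (2 `^ (Q - alpha))%R; have k20 : (0 < k2)%R by exact: powR_gt0.
exists (2 * k2 * C * c)%R => [|f l mf l0 If]; first by rewrite !mulr_gt0.
have cl0 : (0 < c * l)%R by rewrite mulr_gt0.
pose h y := (`|f y| / (c * l))%R.
have h0 y : (0 <= h y)%R by rewrite divr_ge0// ltW.
have mh : measurable_fun [set: X] h.
  by apply: measurable_funM => //; exact: measurableT_comp.
pose W N x := discrete_op mu B Q alpha sg E b a N (truncate h N) x.
have bt N := bounded_truncate N mh h0.
have W0 N x : (0 <= W N x)%R.
  by apply: discrete_op_ge0 => y; exact: truncate_ge0.
have mW N : measurable_fun [set: X] (W N) by apply: measurable_discrete_op => //; exact: (bn_mE HN).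
have WC0 N x : (0 <= W N x / C)%R by rewrite divr_ge0// ltW.
have IW N : \int[mu]_x Psi (W N x / C)%R <= 1.
  apply: HC; first exact: bt.
  apply: le_trans If; apply: le_ge0_integral => x _.
    by apply: (star_ge0 starPhi); rewrite mulr_ge0 ?truncate_ge0// ltW.
  apply: (star_mono starPhi); first by rewrite mulr_ge0 ?truncate_ge0// ltW.
  rewrite (@le_trans _ _ (c * h x)%R)//; first by rewrite ler_wpM2l ?(ltW c0)// ge_min lexx.
  by rewrite /h le_eqVlt; apply/orP; left; apply/eqP; field; rewrite !gt_eqF.
have ndW x : {homo (fun N => W N x) : i j / (i <= j)%N >-> (i <= j)%R}.
  move=> i j ij; apply: (discrete_op_mono _ mb HN ab) => // y.
  by rewrite le_min !ge_min lexx/= ler_nat ij orbT.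
pose g N x := Psi (W N x / C)%R.
have mg N : measurable_fun [set: X] (g N).
  by apply: star_measurable_comp => //; exact: measurable_funM.
have g0 N x : 0 <= g N x by exact: (star_ge0 starPsi).
have ndg x : nondecreasing_seq (g ^~ x).
  move=> i j ij; apply: (star_mono starPsi) => //.
  by rewrite ler_wpM2r ?invr_ge0 ?(ltW C0)// ndW.
have gcvg x : cvgn (g ^~ x) by exact: ereal_nondecreasing_is_cvgn.
pose H x := limn (g ^~ x).
have gH N x : g N x <= H x.
  rewrite /H (cvg_lim _ (ereal_nondecreasing_cvgn (ndg x)))//.
  by apply: ereal_sup_ubound; exists N.
exists H; split.
- by apply: (emeasurable_fun_cvg g) => // x _; exact: gcvg.
- by move=> x; rewrite (le_trans (g0 0%N x)).
- rewrite monotone_convergence//; apply: lime_le; last by apply: nearW.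
  apply: ereal_nondecreasing_is_cvgn => i j ij.
  by apply: ge0_le_integral => // x _; exact: ndg.
move=> x Hx.
have [eta etaE] : exists eta, H x = eta%:E.
  by exists (fine (H x)); rewrite fineK// ge0_fin_numE// (le_trans (g0 0%N x)).
have p1 : (0 < youngr Psi 1%R)%R by exact: youngr_gt0.
have eta0 : (0 <= eta)%R by rewrite -lee_fin -etaE (le_trans (g0 0%N x)).
(* From [1] on, [Psi] grows at least linearly with slope [Psi 1]; hence a finite [H x] bounds all
   the [W N x]. *)
pose w := (C * (eta / youngr Psi 1%R + 1))%R.
have Ww N : (W N x <= w)%R.
  rewrite /w -ler_pdivrMl// mulrC leNgt; apply/negP => lt.
  have u1 : (1 <= W N x / C)%R by rewrite (le_trans _ (ltW lt))// lerDr divr_ge0// ltW.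
  have := gH N x; rewrite etaE /g => Hg.
  have := le_trans (star_dilate starPsi u1 ler01) _; rewrite mulr1 => /(_ _ Hg).
  rewrite (youngrE HPsi ler01) -EFinM lee_fin -ler_pdivlMr// leNgt => /negP; apply.
  by rewrite (lt_trans _ lt)// ltrDl.
have dom w' := @kernel_le_discrete _ _ _ _ _ _ _ hX alphaQ _ mb _ _ _ _ _ _ _ _ _ HN _ _ ab h x w' mh h0.
have Tw := dom _ Ww.
set T := \int[mu]_y (aker x y * h y)%:E in Tw.
have T0 : 0 <= T by apply: integral_ge0 => y _; rewrite lee_fin mulr_ge0// aker_ge0.
have [tau tauE] : exists tau, T = tau%:E.
  by exists (fine T); rewrite fineK// ge0_fin_numE// (le_lt_trans Tw)// ltry.
have tau0 : (0 <= tau)%R by rewrite -lee_fin -tauE.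
exists (c * l * tau)%R; first by rewrite mulr_ge0// ltW.
split.
  rewrite EFinM -tauE /T -ge0_integralZl_EFin//; last 3 first.
  - by move=> y _; rewrite lee_fin mulr_ge0// aker_ge0.
  - apply/measurable_EFinP; apply: measurable_funM => //.
    exact: (measurable_aker _ _ hX mb).
  - exact: ltW.
  apply: eq_integral => y _; rewrite -EFinM /h; congr EFin.
  by field; rewrite gt_eqF// gt_eqF.
rewrite (_ : (c * l * tau / (2 * k2 * C * c * l) = tau / (2 * k2) / C)%R); last first.
  by field; rewrite !gt_eqF.
have k220 : (0 < 2 * k2)%R by rewrite mulr_gt0.
have tc0 : (0 <= tau / (2 * k2) / C)%R.
  by apply: divr_ge0; [apply: divr_ge0 => //; exact: ltW|exact: ltW].
(* If the bound failed, all [W N x] would be at most [tau / (2 * k2)], and [kernel_le_discrete]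
   would give [tau <= tau / 2]. Then [tau = 0], for which the bound is clear. The factor [2] in the
   constant is there for this. *)
rewrite leNgt; apply/negP => Hlt.
have Wt N : (W N x <= tau / (2 * k2))%R.
  rewrite leNgt; apply/negP => tW; move: Hlt; rewrite ltNge => /negP; apply.
  apply: le_trans (gH N x); apply: (star_mono starPsi) => //.
  by rewrite ler_wpM2r ?invr_ge0 ?(ltW C0) ?(ltW tW).
have := dom _ Wt; rewrite -/T tauE lee_fin -/k2.
rewrite (_ : (k2 * (tau / (2 * k2)) = tau / 2)%R); last by field; rewrite gt_eqF.
move=> tle; have tz : tau = 0%R by lra.
move: Hlt; rewrite tz !mul0r (star0 starPsi) ltNge => /negP; apply.
by rewrite (le_trans (g0 0%N x)).
Qed.

(** Only the absolute value of the kernel enters the estimates, so both commutators are treated at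
    once. *)
Lemma kernel_bounded_of_abs (k : X -> X -> R) :
  (forall x y, `|k x y|%R = aker x y) ->
  (forall x, measurable_fun [set: X] (k x)) ->
  (measurable_fun [set: X * X] (fun p : X * X => rho p.1 p.2) ->
   measurable_fun [set: X * X] (fun p : X * X => k p.1 p.2)) ->
  kernel_bounded rho mu k Phi Psi.
Proof.
move=> kE mk mkk; have [C C0 HC] := abs_kernel_majorant.
exists C => // f Hf; have [[mf _] _] := Hf.
have mkf x : measurable_fun [set: X] (fun y => (k x y * f y)%:E).
  by apply/measurable_EFinP; exact: measurable_funM.
have absE x y : `|(k x y * f y)%:E| = (aker x y * `|f y|)%:E.
  by rewrite abse_EFin normrM kE.
have bound l : (0 < l)%R -> \int[mu]_x Phi (`|f x| / l)%R <= 1 ->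
    {ae mu, forall x, mu.-integrable [set: X] (fun y => (k x y * f y)%:E)} /\
    \int[mu]_x Psi (`|kernel_op mu k f x| / (C * l))%R <= 1.
  move=> l0 If; have [H [mH H0 IH HH]] := HC f l mf l0 If.
  have int x : H x < +oo -> mu.-integrable [set: X] (fun y => (k x y * f y)%:E).
    move=> /HH[tau tau0 [tauE _]]; apply/integrableP; split=> //.
    by under eq_integral do rewrite absE; rewrite tauE ltry.
  split.
    have iH : mu.-integrable [set: X] H.
      apply/integrableP; split=> //; under eq_integral do rewrite gee0_abs//.
      by rewrite (le_lt_trans IH)// ltry.
    apply: filterS (integrable_ae measurableT iH) => x /(_ I) Hx; apply: int.
    by rewrite ltey_eq Hx.
  apply: le_trans IH; apply: le_ge0_integral => x _.
    by apply: (star_ge0 starPsi); rewrite divr_ge0// mulr_ge0// ltW.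
  have [Hx|] := ltP (H x) +oo; last by rewrite leye_eq => /eqP ->; rewrite leey.
  have [tau tau0 [tauE Ht]] := HH x Hx; apply: le_trans Ht.
  apply: (star_mono starPsi); first by rewrite divr_ge0// mulr_ge0// ltW.
  rewrite ler_wpM2r ?invr_ge0 ?mulr_ge0 ?(ltW C0) ?(ltW l0)//.
  rewrite /kernel_op (le_trans (le_normr_Rintegral _ (int x Hx)))//.
  rewrite /Rintegral (_ : integral _ _ _ = tau%:E)//.
  by rewrite -tauE; apply: eq_integral => y _; rewrite normrM kE.
have [l l0 If] := orlicz_scale Hf.
have [ae1 IPsi] := bound l l0 If.
split=> //.
- move=> mrho.
  have mT : measurable_fun [set: X] (kernel_op mu k f).
    apply: (measurable_integral_section homogeneous_sigma_finite
      (f := fun p : X * X => k p.1 p.2 * f p.2)%R).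
    apply: measurable_funM; first exact: mkk.
    by apply: (measurableT_comp mf); exact: measurable_snd.
  set g := kernel_op mu k f in mT IPsi *.
  have Cl : (0 < C * l)%R by rewrite mulr_gt0.
  have mPg : measurable_fun [set: X] (fun x => Psi (`|g x| / (C * l))%R).
    apply: star_measurable_comp => //.
      by apply: measurable_funM => //; exact: measurableT_comp.
    by move=> x; rewrite divr_ge0// ltW.
  have Pg0 x : 0 <= Psi (`|g x| / (C * l))%R.
    by apply: (star_ge0 starPsi); rewrite divr_ge0// ltW.
  split; last first.
    exists (C * l)^-1%R; first by rewrite invr_gt0.
    under eq_integral do rewrite mulrC.
    by rewrite (le_lt_trans IPsi)// ltry.
  split=> // x r r0.
  have mqb : measurable (qball rho x r) by exact: (ht_measurable hX).
  have mug : mu (qball rho x r) < +oo.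
    by have [K3 _ HK3] := hQ; have /andP[_ ub] := HK3 x r r0; rewrite (le_lt_trans ub)// ltry.
  apply/integrableP; split; first by apply: measurable_funTS; exact/measurable_EFinP.
  have p1 : (0 < youngr Psi 1%R)%R by exact: youngr_gt0.
  (* Local integrability: where the absolute value of [g] exceeds [C * l], the linear growth of
     [Psi] bounds it by [q] times the modular integrand. *)
  pose q := ((C * l) / youngr Psi 1%R)%R; have q0 : (0 < q)%R by rewrite divr_gt0.
  apply: (@le_lt_trans _ _ (\int[mu]_(y in qball rho x r) ((C * l)%:E + q%:E * Psi (`|g y| / (C * l))%R))).
    apply: le_ge0_integral => y _ //=.
    have [g1|g1] := leP (`|g y| / (C * l))%R 1%R.
      rewrite (@le_trans _ _ (C * l)%:E)//; first by rewrite lee_fin -[leRHS]mul1r -ler_pdivrMr.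
      by rewrite leeDl// mule_ge0// lee_fin ltW.
    rewrite (@le_trans _ _ (q%:E * Psi (`|g y| / (C * l))%R))//; last first.
      by rewrite leeDr// lee_fin ltW.
    have := star_dilate starPsi (ltW g1) ler01; rewrite mulr1 (youngrE HPsi ler01) => Hd.
    apply: (le_trans _ (lee_wpmul2l _ Hd)); last by rewrite lee_fin ltW.
    rewrite -!EFinM lee_fin /q le_eqVlt; apply/orP; left; apply/eqP.
    by field; rewrite !gt_eqF.
  rewrite ge0_integralD//; last 3 first.
  - by move=> y _; rewrite lee_fin ltW.
  - by move=> y _; rewrite mule_ge0// lee_fin ltW.
  - by apply: measurable_funeM; exact: measurable_funTS.
  rewrite integral_cst// lte_add_pinfty//.
    by rewrite lte_mul_pinfty// lee_fin ltW.
  rewrite ge0_integralZl_EFin ?(ltW q0)//; last by exact: measurable_funTS.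
  rewrite lte_mul_pinfty// ?lee_fin ?(ltW q0)//.
  rewrite (@le_lt_trans _ _ 1)// ?ltry//; apply: le_trans IPsi.
  exact: ge0_subset_integral.
- rewrite /orlicz_norm -lee_pdivrMl//.
  apply: le_ereal_inf_tmp => _ [l' [l'0 If'] <-]; rewrite lee_pdivrMl//.
  apply: ereal_inf_lbound; exists (C * l')%R => //; split; first by rewrite mulr_gt0.
  by case: (bound l' l'0 If').
Qed.

Lemma abs_commutator_bounded_of_sufficient :
  abs_commutator_bounded rho mu b Q alpha Phi Psi.
Proof.
apply: kernel_bounded_of_abs.
- by move=> x y; rewrite ger0_norm// aker_ge0.
- exact: (measurable_aker _ _ hX mb).
- move=> mrho; apply: measurable_funM.
    apply: measurableT_comp => //; apply: measurable_funB.
      by apply: (measurableT_comp mb); exact: measurable_fst.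
    by apply: (measurableT_comp mb); exact: measurable_snd.
  exact: measurable_powR_inv.
Qed.

Lemma commutator_bounded_of_sufficient :
  commutator_bounded rho mu b Q alpha Phi Psi.
Proof.
apply: kernel_bounded_of_abs.
- by move=> x y; rewrite normrM normfV (ger0_norm (powR_ge0 _ _)).
- move=> x; apply: measurable_funM; first exact: measurable_funB.
  exact/measurable_powR_inv/(measurable_rho hX).
- move=> mrho; apply: measurable_funM.
    apply: measurable_funB.
      by apply: (measurableT_comp mb); exact: measurable_fst.
    by apply: (measurableT_comp mb); exact: measurable_snd.
  exact: measurable_powR_inv.
Qed.

End Sufficiency.

(** * Necessity *)

Section Necessity.
Context (R : realType) (d : measure_display) (X : topMeasurableType d).
Variables (rho : X -> X -> R) (mu : {measure set X -> \bar R}) (Q alpha : R).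
Variables (Phi Psi : R -> \bar R).
Hypotheses (hX : homogeneous_type rho mu) (hinf : mu [set: X] = +oo).
Hypothesis hQ : Q_homogeneous rho mu Q.
Hypotheses (alpha0 : (0 < alpha)%R) (alphaQ : (alpha < Q)%R).
Hypotheses (HPhi : youngY Phi) (HPsi : youngY Psi).
Let Q0 : (0 < Q)%R. Proof. exact: lt_trans alphaQ. Qed.
Let hd := ht_quasi_distance hX.
Let mball x (r : R) : (0 < r)%R -> measurable (qball rho x r).
Proof. by move=> r0; exact: (ht_measurable hX). Qed.

Let fball x (r : R) : (0 < r)%R -> mu (qball rho x r) < +oo.
Proof.
by have [K3 _ HK3] := hQ => r0; have /andP[_ ub] := HK3 x r r0; rewrite (le_lt_trans ub)// ltry.
Qed.

Lemma L1loc_indic (A : set X) : measurable A -> L1loc rho mu (\1_A : X -> R).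
Proof.
move=> mA; split=> [|x r r0]; first exact: measurable_indic.
apply/integrableP; split.
  by apply: measurable_funTS; apply/measurable_EFinP; exact: measurable_indic.
apply: (@le_lt_trans _ _ (\int[mu]_(y in qball rho x r) 1)).
  apply: le_ge0_integral => // y _ /=.
  by rewrite lee_fin indicE; case: (_ \in _); rewrite ?normr1 ?normr0.
by rewrite integral_cst ?mul1e ?fball//; exact: mball.
Qed.

(** The values and the mean lie in [[0, 1]], so every mean oscillation is at most [1]. *)
Lemma BMO_indic (A : set X) : measurable A -> BMO rho mu (\1_A : X -> R).
Proof.
move=> mA; split; first exact: L1loc_indic.
apply: (@le_lt_trans _ _ 1); last exact: ltry.
apply: ge_ereal_sup => _ [[x r] /= r0 <-]; rewrite /mean_oscillation.
set B := qball rho x r; have mB : measurable B by exact: mball.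
have [M ME] : exists M, mu B = M%:E.
  by exists (fine (mu B)); rewrite fineK// ge0_fin_numE// fball.
have M0 : (0 < M)%R.
  have [K3 K31 HK3] := hQ; rewrite -lte_fin -ME.
  have /andP[lo _] := HK3 x r r0; apply: lt_le_trans lo.
  by rewrite lte_fin mulr_gt0 ?invr_gt0 ?powR_gt0// (lt_le_trans _ K31).
have IB : (0 <= \int[mu]_(y in B) (\1_A y : R) <= M)%R.
  have I0 : 0 <= \int[mu]_(y in B) (\1_A y : R)%:E.
    by apply: integral_ge0 => y _; rewrite lee_fin.
  have I1 : \int[mu]_(y in B) (\1_A y : R)%:E <= M%:E.
    rewrite -ME -[leRHS]mul1e -integral_cst//; apply: le_ge0_integral => y _.
      by rewrite lee_fin.
    by rewrite lee_fin indicE lern1 leq_b1.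
  rewrite /Rintegral -!lee_fin fineK ?I0 ?I1//.
  by rewrite ge0_fin_numE// (le_lt_trans I1)// ltry.
have a01 : (0 <= mean mu B (\1_A : X -> R) <= 1)%R.
  rewrite /mean ME/=; case/andP: IB => I0 I1.
  by rewrite mulr_ge0 ?invr_ge0 ?(ltW M0)//= ler_pdivrMl// mulr1.
rewrite ME/= lee_pdivrMl// mule1 -ME -[leRHS]mul1e -integral_cst//.
apply: le_ge0_integral => y _; rewrite lee_fin//.
move: a01; set a := mean _ _ _ => /andP[a0 a1]; rewrite indicE ler_norml.
by case: (_ \in _) => /=; apply/andP; split; lra.
Qed.

Lemma integral_comp_indic (Theta : R -> \bar R) (A : set X) (u : R) :
  measurable A -> Theta 0%R = 0 -> 0 <= Theta u ->
  \int[mu]_x Theta (u * `|\1_A x|)%R = Theta u * mu A.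
Proof.
move=> mA T0 Tu; rewrite -integral_cst// [RHS]integral_mkcond.
apply: eq_integral => x _; rewrite patchE indicE.
by case: ifP => _; rewrite ?normr1 ?mulr1// normr0 mulr0.
Qed.

Lemma measure_setD_null (A N : set X) : measurable A -> measurable N ->
  mu A < +oo -> mu N = 0 -> mu (A `\` N) = mu A.
Proof.
move=> mA mN fA N0.
have AN0 : mu (A `&` N) = 0.
  apply/eqP; rewrite -measure_le0 -N0.
  by apply: le_measure; rewrite ?inE//; exact: measurableI.
transitivity (mu A - mu (A `&` N)); first exact: measureD.
by rewrite AN0 sube0.
Qed.

Section Annuli.
Variables (M : R) (x0 : X).
Hypothesis M1 : (1 < M)%R.
Let M0 : (0 < M)%R. Proof. exact: lt_trans M1. Qed.
Let rr0 (j : int) : (0 < M ^ j)%R. Proof. exact: exprz_gt0. Qed.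

Definition annulus (j : int) : set X :=
  qball rho x0 (M ^ (j + 1))%R `\` qball rho x0 (M ^ j)%R.

Definition even_annuli : set X := \bigcup_(i in [set: int]) annulus (2 * i)%R.

Lemma annulusE j y : annulus j y <-> (M ^ j <= rho x0 y < M ^ (j + 1))%R.
Proof.
rewrite /annulus /qball/=; split=> [[-> /negP]|/andP[h ->]]; first by rewrite -leNgt => ->.
by split=> //; apply/negP; rewrite -leNgt.
Qed.

Lemma measurable_annulus j : measurable (annulus j).
Proof. by apply: measurableD; exact: mball. Qed.

Lemma measurable_even_annuli : measurable even_annuli.
Proof.
apply: countable_bigcupT_measurable; first exact: countableP.
by move=> i; exact: measurable_annulus.
Qed.

Lemma annulus_inj i j y : annulus i y -> annulus j y -> i = j.
Proof.
move=> /annulusE/andP[i1 i2] /annulusE/andP[j1 j2].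
have := le_lt_trans i1 j2; have := le_lt_trans j1 i2.
rewrite !(ltr_eXz2l M1); lia.
Qed.

(* The indicator of the even annuli jumps between consecutive annuli, so on
   such a pair the commutator kernel is the full fractional kernel. *)
Lemma even_annuli_jump k x y : annulus (k + 1) x -> annulus k y ->
  (`|\1_even_annuli x - \1_even_annuli y| = 1 :> R)%R.
Proof.
move=> Ax Ay; have odd_even j z : annulus j z ->
    (\1_even_annuli z = ((j %% 2)%Z == 0%R)%:R :> R)%R.
  move=> Az; rewrite indicE; congr (_%:R); congr (nat_of_bool _).
  apply/idP/eqP => [/set_mem[i _ /(annulus_inj Az) ->]|j2]; first by lia.
  apply/mem_set; exists (j %/ 2)%Z => //.
  by rewrite (_ : (2 * _ = j)%R)//; lia.
rewrite (odd_even _ _ Ax) (odd_even _ _ Ay).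
have -> : (((k + 1) %% 2)%Z == 0%R) = ~~ ((k %% 2)%Z == 0%R) by lia.
by case: (_ == _); rewrite /= ?subr0 ?sub0r ?normrN normr1.
Qed.

End Annuli.

(** The function [b] is fixed before [r], so that one constant [C] serves all radii. The norm of the
    indicator of a set is in essence the reciprocal of the inverse Young function at the reciprocal
    measure, which turns the norm inequality for one annulus and the next into the condition. *)
Lemma cond_star_of_abs_commutator_bounded :
  (forall b : X -> R, BMO rho mu b ->
    abs_commutator_bounded rho mu b Q alpha Phi Psi) ->
  cond_star Q alpha Phi Psi.
Proof.
move=> H; have [x0 _] := homogeneous_point hinf.
have starPhi : starshaped Phi by apply: young_starshaped; case: HPhi.
have starPsi : starshaped Psi by apply: young_starshaped; case: HPsi.
have [K K1 tri] := qd_triangle hd.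
have K0 : (0 < K)%R by exact: lt_le_trans K1.
have [K3 K31 HK3] := hQ.
have K30 : (0 < K3)%R by exact: lt_le_trans K31.
(* Enlarging the radius by [M] makes the lower bound for the measure of the ball twice the upper
   bound for the original one, so that each annulus has measure comparable to that of its balls. *)
pose M := ((2 * (K3 * K3)) `^ Q^-1)%R.
have K33 : (1 <= K3 * K3)%R by rewrite mulr_ege1.
have MQ : (M `^ Q = 2 * (K3 * K3))%R.
  by rewrite -powRrM mulVf ?gt_eqF// powRr1// mulr_ge0// ltW// mulr_gt0.
have M0 : (0 < M)%R by rewrite powR_gt0// mulr_gt0// mulr_gt0.
have M1 : (1 < M)%R.
  rewrite ltNge; apply/negP => Mle.
  have : (M `^ Q <= 1 `^ Q)%R by rewrite ge0_ler_powR ?nnegrE ?(ltW Q0) ?(ltW M0).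
  by rewrite MQ powR1; lra.
pose rr (j : int) : R := (M ^ j)%R.
have rr0 j : (0 < rr j)%R by exact: exprz_gt0.
have rrS j : rr (j + 1)%R = (M * rr j)%R by rewrite /rr expfzDr ?gt_eqF// expr1z mulrC.
pose A := annulus M x0; have mA j : measurable (A j) by exact: measurable_annulus.
pose m j := fine (mu (A j)).
have muA j : mu (A j) = (m j)%:E.
  rewrite fineK// ge0_fin_numE// (le_lt_trans _ (fball x0 (rr0 (j + 1)%R)))//.
  by apply: le_measure; rewrite ?inE//; [exact: mball|exact: subDsetl].
have fA j : mu (A j) < +oo by rewrite muA ltry.
have rrQ j : (rr (j + 1) `^ Q = 2 * (K3 * K3) * rr j `^ Q)%R.
  by rewrite rrS powRM ?(ltW M0) ?(ltW (rr0 j))// MQ.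
have mlo j : (K3 * rr j `^ Q <= m j)%R.
  rewrite -lee_fin -muA /A /annulus measureD; [|exact: mball|exact: mball|exact: fball].
  have /andP[l _] := HK3 x0 _ (rr0 (j + 1)%R).
  have u : mu (qball rho x0 (rr (j + 1)%R) `&` qball rho x0 (rr j)) <= (K3 * rr j `^ Q)%:E.
    have /andP[_ u] := HK3 x0 _ (rr0 j); apply: le_trans u.
    by apply: le_measure; rewrite ?inE; [apply: measurableI|exact: mball|exact: subIsetr]; exact: mball.
  apply: le_trans (leeB l u); rewrite -EFinB lee_fin rrQ le_eqVlt.
  by apply/orP; left; apply/eqP; field; rewrite gt_eqF.
have mhi j : (m j <= 2 * K3 ^+ 3 * rr j `^ Q)%R.
  rewrite -lee_fin -muA; have /andP[_ u] := HK3 x0 _ (rr0 (j + 1)%R).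
  rewrite (@le_trans _ _ (mu (qball rho x0 (rr (j + 1)%R))))//.
    by apply: le_measure; rewrite ?inE//; [exact: mball|exact: subDsetl].
  rewrite (le_trans u)// lee_fin rrQ le_eqVlt.
  by apply/orP; left; apply/eqP; ring.
have rQ0 j : (0 < rr j `^ Q)%R by exact: powR_gt0.
have m0 j : (0 < m j)%R by rewrite (lt_le_trans _ (mlo j))// mulr_gt0.
pose b : X -> R := \1_(even_annuli M x0).
have [C C0 HC] := H b (BMO_indic (measurable_even_annuli x0 M1)).
(* Points of the annuli [k + 1] and [k] are at distance at most [G * rr k], by the quasi-triangle
   inequality through [x0]. *)
pose G := (2 * K * M ^+ 2)%R.
have G0 : (0 < G)%R by rewrite !mulr_gt0// exprn_gt0.
pose c1 := (G `^ (alpha - Q))%R; have c10 : (0 < c1)%R by exact: powR_gt0.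
pose E0 := (2 * K3 ^+ 3)%R.
have E01 : (1 <= E0)%R.
  by rewrite /E0; have := exprn_ege1 3 K31; lra.
have E00 : (0 < E0)%R by exact: lt_le_trans E01.
have Ac0 : (0 < M `^ alpha * E0 / c1)%R.
  by apply: divr_gt0 => //; apply: mulr_gt0 => //; exact: powR_gt0.
exists (M `^ alpha * E0 / c1 * (4 * C))%R => [|r r0].
  by apply: mulr_gt0 => //; exact: mulr_gt0.
have [k /andP[kr rk]] := exprz_scale M1 r0; rewrite -!/(rr _) in kr rk.
pose f : X -> R := \1_(A k).
have Hf : orlicz rho mu Phi f.
  split; first exact: L1loc_indic.
  exists 1%R => //; rewrite /f integral_comp_indic ?(star0 starPhi) ?(star_ge0 starPhi)//.
  by rewrite muA -(fineK (youngY_fin HPhi ler01)) -EFinM ltry.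
have [ae1 _ nle] := HC f Hf.
pose y1 := yinv Phi (m k)^-1; have y10 : (0 < y1)%R by rewrite yinv_gt0// invr_gt0.
(* The reciprocal of [l0] is half of [y1], strictly below the inverse as [lt_yinv] requires. *)
pose l0 := (2 / y1)%R; have l00 : (0 < l0)%R by rewrite divr_gt0.
have nf : orlicz_norm mu Phi f <= l0%:E.
  apply: ereal_inf_lbound; exists l0 => //; split=> //.
  under eq_integral do rewrite mulrC.
  have p0 : (0 <= l0^-1)%R by rewrite invr_ge0 ltW.
  rewrite integral_comp_indic ?(star0 starPhi) ?(star_ge0 starPhi)// muA.
  have : Phi l0^-1%R <= (m k)^-1%:E.
    apply: (lt_yinv HPhi) => //; first by rewrite invr_gt0.
    by rewrite -/y1 /l0 invf_div ltr_pdivrMr// ltr_pMr// ltr1n.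
  move=> /(fun h => lee_wpmul2r (x := (m k)%:E) _ h) h.
  rewrite (le_trans (h _)) ?lee_fin ?(ltW (m0 k))//.
  by rewrite mulVf ?gt_eqF.
(* The infimum need not be attained; a strict bound, twice as large, provides an admissible [l]. *)
have : orlicz_norm mu Psi (kernel_op mu (abs_commutator_ker rho b Q alpha) f) < (2 * C * l0)%:E.
  apply: (le_lt_trans nle); apply: (@le_lt_trans _ _ (C * l0)%:E).
    by rewrite EFinM lee_wpmul2l// lee_fin ltW.
  by rewrite lte_fin -mulrA ltr_pMl ?ltr1n// mulr_gt0.
move=> /ereal_inf_lt[_ [l [lp IPsi] <-]]; rewrite lte_fin => ll0.
(* Off the null set [N] the integral converges, so that the operator takes its true value and not
   the default of [fine]. *)
have [N [mN N0 HN]] := ae1.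
set T := kernel_op _ _ _ in IPsi.
pose w := ((G * rr k) `^ (alpha - Q))%R.
pose v := (w * m k)%R; have v0 : (0 <= v)%R by rewrite mulr_ge0 ?powR_ge0// ltW.
have Tv x : A (k + 1)%R x -> ~ N x -> (v <= T x)%R.
  move=> Ax Nx; have ix : mu.-integrable [set: X]
      (fun y => (abs_commutator_ker rho b Q alpha x y * f y)%:E).
    by apply: contrapT => nix; apply: Nx; apply: HN.
  rewrite /T /kernel_op /Rintegral.
  have IE : \int[mu]_y (w * f y)%:E = v%:E.
    under eq_integral do rewrite EFinM.
    rewrite ge0_integralZl_EFin ?powR_ge0//; last 2 first.
    - by move=> y _; rewrite lee_fin.
    - by apply/measurable_EFinP; exact: measurable_indic.
    by rewrite integral_indic// setIT muA -EFinM.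
  rewrite -lee_fin fineK; last exact: integrable_fin_num.
  rewrite -IE; apply: le_ge0_integral => y _.
    by rewrite lee_fin mulr_ge0// powR_ge0.
  rewrite lee_fin /f indicE.
  have [/set_mem Ay|_] := boolP (y \in A k); last by rewrite !mulr0.
  rewrite !mulr1 /abs_commutator_ker (even_annuli_jump M1 Ax Ay) mul1r /w.
  have Gk0 : (0 < G * rr k)%R by rewrite mulr_gt0.
  have rxy : (0 < rho x y)%R.
    rewrite lt_neqAle (qd_ge0 hd) andbT eq_sym; apply/eqP => /(qd_eq0 hd) xy.
    have := annulus_inj M1 Ax; rewrite xy => /(_ k Ay)/eqP.
    by rewrite -[eqbRHS]addr0 (inj_eq (addrI k)).
  rewrite -opprB powRN lef_pV2 ?posrE ?powR_gt0//.
  rewrite ge0_ler_powR ?nnegrE ?subr_ge0 ?(ltW alphaQ) ?(ltW rxy) ?(ltW Gk0)//.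
  move: Ax Ay => /annulusE/andP[_ Ax] /annulusE/andP[_ Ay].
  rewrite -!/(rr _) in Ax Ay; rewrite (le_trans (tri x y x0))// (qd_sym hd x).
  have rS : (rr (k + 1) <= rr (k + 1 + 1))%R.
    by rewrite (rrS (k + 1)%R) ler_peMl ?(ltW (rr0 _)) ?(ltW M1).
  apply: (@le_trans _ _ (K * (rr (k + 1 + 1) + rr (k + 1 + 1)))%R).
    by rewrite ler_wpM2l ?(ltW K0)// lerD// ltW// (lt_le_trans Ay).
  by rewrite !rrS /G le_eqVlt; apply/orP; left; apply/eqP; ring.
have m1 := m0 (k + 1)%R.
have vy : (v / l <= yinv Psi (m (k + 1))^-1)%R.
  apply: le_yinv => //; rewrite ?invr_gt0 ?divr_ge0 ?(ltW lp)//.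
  rewrite -[leRHS]mul1e muleC lee_pdivlMl// -muA muleC.
  have P0 : 0 <= Psi (v / l)%R by rewrite (star_ge0 starPsi)// divr_ge0// ltW.
  have -> : mu (A (k + 1)%R) = mu (A (k + 1)%R `\` N).
    by apply/esym/measure_setD_null => //; exact: fA.
  rewrite -integral_cst; last exact: measurableD.
  apply: le_trans IPsi; rewrite [leLHS]integral_mkcond; apply: le_ge0_integral => x _.
    by rewrite patchE; case: ifP.
  rewrite patchE; case: ifPn => [/set_mem[Ax Nx]|_]; last first.
    by rewrite (star_ge0 starPsi)// divr_ge0// ltW.
  apply: (star_mono starPsi); first by rewrite divr_ge0// ltW.
  by rewrite ler_wpM2r ?invr_ge0 ?(ltW lp)// (le_trans (Tv x Ax Nx))// ler_norm.
have rmQ : (0 < r `^ (- Q))%R by exact: powR_gt0.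
rewrite /frac_inv !yinvE// -!EFinM lee_fin.
have hPhi : (yinv Phi (r `^ (- Q)) <= E0 * y1)%R.
  apply: le_trans (yinv_scale HPhi _ E01); last by rewrite invr_gt0.
  apply: yinv_mono => //; rewrite powRN ler_pdivlMr//.
  rewrite mulrC ler_pdivrMr ?powR_gt0// (le_trans (mhi k))// ler_wpM2l ?(ltW E00)//.
  by rewrite ge0_ler_powR ?nnegrE ?(ltW Q0) ?(ltW (rr0 k)) ?(ltW r0).
have hPsi : (yinv Psi (m (k + 1))^-1 <= yinv Psi (r `^ (- Q)))%R.
  apply: yinv_mono => //; first by rewrite invr_gt0.
  rewrite powRN lef_pV2 ?posrE ?powR_gt0// (le_trans _ (mlo _))//.
  rewrite (@le_trans _ _ (rr (k + 1) `^ Q)%R)//; last by rewrite ler_peMl ?(ltW (rQ0 _)).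
  by rewrite ge0_ler_powR ?nnegrE ?(ltW Q0) ?(ltW (rr0 _)) ?(ltW r0) ?(ltW rk).
have hv : (c1 * rr k `^ alpha <= v)%R.
  rewrite /v /w powRM ?(ltW G0) ?(ltW (rr0 _))// -mulrA ler_wpM2l ?(ltW c10)//.
  have -> : (rr k `^ alpha = rr k `^ (alpha - Q) * rr k `^ Q)%R.
    by rewrite -powRD ?subrK//; apply/implyP => _; rewrite gt_eqF.
  rewrite ler_wpM2l ?powR_ge0// (le_trans _ (mlo k))// ler_peMl ?(ltW (rQ0 k))//.
have hr : (r `^ alpha <= M `^ alpha * rr k `^ alpha)%R.
  rewrite -powRM ?(ltW M0) ?(ltW (rr0 _))// -rrS.
  by rewrite ge0_ler_powR ?nnegrE ?(ltW alpha0) ?(ltW (rr0 _)) ?(ltW r0) ?(ltW rk).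
have hvy : (v * y1 <= 4 * C * yinv Psi (r `^ (- Q)))%R.
  have yp : (0 < yinv Psi (r `^ (- Q)))%R by exact: yinv_gt0.
  have : (v <= yinv Psi (r `^ (- Q)) * (2 * C * l0))%R.
    move: (le_trans vy hPsi); rewrite ler_pdivrMr// => /le_trans; apply.
    by rewrite ler_wpM2l ?(ltW yp) ?(ltW ll0).
  move=> /(ler_wpM2r (ltW y10)) /le_trans; apply.
  by rewrite /l0 le_eqVlt; apply/orP; left; apply/eqP; field; rewrite gt_eqF.
apply: (@le_trans _ _ (M `^ alpha * rr k `^ alpha * (E0 * y1))%R).
  by rewrite ler_pM ?powR_ge0// ltW// yinv_gt0.
apply: (@le_trans _ _ (M `^ alpha * E0 / c1 * (v * y1))%R).
  rewrite (_ : (M `^ alpha * rr k `^ alpha * (E0 * y1) =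
    M `^ alpha * E0 / c1 * (c1 * rr k `^ alpha * y1))%R); last by field; rewrite gt_eqF.
  by apply: ler_wpM2l; [exact: ltW|rewrite ler_wpM2r ?(ltW y10)].
by rewrite -[leRHS]mulrA; apply: ler_wpM2l; first exact: ltW.
Qed.

End Necessity.

(** * The integral condition under the tail condition *)

Lemma cond_sufficient_of_star (R : realType) (Q alpha : R) (Phi Psi : R -> \bar R) :
  youngY Phi -> cond_tail Q alpha Phi -> cond_star Q alpha Phi Psi ->
  cond_sufficient Q alpha Phi Psi.
Proof.
move=> HPhi [C C0 HC] [A A0 HA].
exists ((1 + C) * A)%R => [|r r0]; first by rewrite mulr_gt0// addr_gt0.
have f0 : 0 <= frac_inv Q alpha Phi r.
  by rewrite /frac_inv yinvE ?powR_gt0// -EFinM lee_fin mulr_ge0 ?powR_ge0// ltW// yinv_gt0// powR_gt0.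
apply: (@le_trans _ _ ((1 + C)%:E * frac_inv Q alpha Phi r)).
  rewrite EFinD ge0_muleDl ?mul1e ?lee_fin ?(ltW C0)//.
  by rewrite leeD2l// HC.
by rewrite EFinM -muleA lee_wpmul2l ?HA// lee_fin addr_ge0// ltW.
Qed.

Local Close Scope ereal_scope.
Theorem theorem5p7 (R : realType) (d : measure_display)
    (X : topMeasurableType d) (rho : X -> X -> R)
    (mu : {measure set X -> \bar R}) (Q alpha : R) (Phi Psi : R -> \bar R)
    (hX : homogeneous_type rho mu)
    (hinf : mu [set: X] = +oo%E)
    (hdense : Cc_dense_L1 mu)
    (hQ : Q_homogeneous rho mu Q)
    (halpha : 0 < alpha < Q)
    (hPhi : youngY Phi) (hPsi : youngY Psi) :
  [/\ nabla2 Phi -> Delta2 Psi -> cond_sufficient Q alpha Phi Psi ->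
        forall b : X -> R, BMO rho mu b ->
          commutator_bounded rho mu b Q alpha Phi Psi,
      Delta2 Psi ->
        (forall b : X -> R, BMO rho mu b ->
           abs_commutator_bounded rho mu b Q alpha Phi Psi) ->
        cond_star Q alpha Phi Psi
    & nabla2 Phi -> Delta2 Psi -> cond_tail Q alpha Phi ->
        (cond_star Q alpha Phi Psi <->
         forall b : X -> R, BMO rho mu b ->
           abs_commutator_bounded rho mu b Q alpha Phi Psi)].
Proof.
case/andP: halpha => alpha0 alphaQ.
have necessity := cond_star_of_abs_commutator_bounded hX hinf hQ alpha0 alphaQ hPhi hPsi.
split.
- move=> nPhi dPsi suff b hb.
  exact: (commutator_bounded_of_sufficient hX hinf hdense hQ alpha0 alphaQ).
- by move=> _; exact: necessity.
- move=> nPhi dPsi tail; split=> [star b hb|]; last exact: necessity.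
  apply: (abs_commutator_bounded_of_sufficient hX hinf hdense hQ alpha0 alphaQ) => //.
  exact: cond_sufficient_of_star.
Qed.
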